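(* Let $X=\Sigma_{\mathbf a}$ be an $\mathbf a$-adic solenoid. Let $p,q$ be relatively prime integers with $pq\neq 0$, and assume that $f_p, f_q, f_{p+q}, f_{p-q}\in \mathrm{Aut}(X)$. The following statements hold: 1. Assume that $pq=-3$. Let $\xi_1,\xi_2$ be independent random variables with values in $X$ and distributions $\mu_1,\mu_2$. If the conditional distribution of the linear form $L_2=p\xi_1+q\xi_2$ given $L_1=\xi_1+\xi_2$ is symmetric, then at least one of the distributions satisfies $\mu_j\in\Gamma(X)*I(X)$. 2. Assume that $pq\neq -3$. Then there exist independent random variables $\xi_1,\xi_2$ with values in $X$ and distributions $\mu_1,\mu_2$ such that the conditional distribution of the linear form $L_2=p\xi_1+q\xi_2$ given $L_1=\xi_1+\xi_2$ is symmetric and $\mu_j\notin\Gamma(X)*I(X)$ for $j=1,2$.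
   Context: For $\mathbf a=(a_0,a_1,\dots)$ with all $a_j\in\mathbb Z$, $a_j>1$, the group $\Delta_{\mathbf a}$ of $\mathbf a$-adic integers is the set $\prod_{n=0}^\infty\{0,1,\dots,a_n-1\}$ with the product topology and addition with carry: $\mathbf x+\mathbf y=\mathbf z$, where $x_0+y_0=t_0a_0+z_0$ and $x_{k+1}+y_{k+1}+t_k=t_{k+1}a_{k+1}+z_{k+1}$ with $z_k\in\{0,\dots,a_k-1\}$, $t_k\in\{0,1\}$. Put $\mathbf u=(1,0,0,\dots)\in\Delta_{\mathbf a}$ and $B=\{(n,n\mathbf u):n\in\mathbb Z\}\subset\mathbb R\times\Delta_{\mathbf a}$. The $\mathbf a$-adic solenoid is $\Sigma_{\mathbf a}=(\mathbb R\times\Delta_{\mathbf a})/B$; it is a compact connected Abelian group, whose character group is topologically isomorphic to the discrete group $H_{\mathbf a}=\{m/(a_0a_1\cdots a_n): n=0,1,\dots;\ m\in\mathbb Z\}\subset\mathbb Q$. $\mathrm{Aut}(X)$ is the group of topological automorphisms of $X$. For a nonzero integer $n$, $f_n:X\to X$ is the homomorphism $f_nx=nx$. Let $Y=X^*$ be the character group of $X$, $(x,y)$ the value of $y\in Y$ at $x\in X$, and $\hat\mu(y)=\int_X(x,y)\,d\mu(x)$ the characteristic function of a probability distribution $\mu$ on $X$. A probability distribution $\gamma$ on $X$ is Gaussian if $\hat\gamma(y)=(x,y)\exp\{-\varphi(y)\}$ for some $x\in X$ and some continuous nonnegative function $\varphi$ on $Y$ satisfying $\varphi(u+v)+\varphi(u-v)=2[\varphi(u)+\varphi(v)]$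 for all $u,v\in Y$ (degenerate distributions are included, with $\varphi=0$). $\Gamma(X)$ is the set of Gaussian distributions on $X$. $I(X)$ is the set of idempotent distributions, i.e. the set of shifts of Haar (probability) distributions $m_K$ of compact subgroups $K$ of $X$. $\Gamma(X)*I(X)$ is the set of all convolutions $\gamma*\omega$ with $\gamma\in\Gamma(X)$, $\omega\in I(X)$. The conditional distribution of $L_2$ given $L_1$ is symmetric if the conditional distributions of $L_2$ and of $-L_2$ given $L_1$ coincide, i.e. $(L_1,L_2)$ and $(L_1,-L_2)$ have the same joint distribution. *)

(* Defs.v *)
From HB Require Import structures.
From mathcomp Require Import all_boot all_order all_algebra.
From mathcomp Require Import generic_quotient ring_quotient.
From mathcomp Require Import complex zify.
From mathcomp Require Import all_classical all_reals all_analysis.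

Set Implicit Arguments.
Unset Strict Implicit.
Unset Printing Implicit Defensive.

Import Order.TTheory GRing.Theory Num.Theory.
Import numFieldNormedType.Exports.

Local Open Scope classical_set_scope.
Local Open Scope ring_scope.

(* The group of a-adic integers, with the product of the discrete topologies. *)
Definition adic (a : nat -> nat) (ha : forall n, (1 < a n)%N) : Type :=
  prod_topology (fun n => discrete_topology 'I_(a n)).

Section Adic.
Context {a : nat -> nat} {ha : forall n, (1 < a n)%N}.
Local Notation Delta := (adic ha).
Implicit Types x y z : Delta.
Local Open Scope nat_scope.

HB.instance Definition _ := Topological.copy Delta
  (prod_topology (fun n => discrete_topology 'I_(a n))).

Definition digit x (n : nat) : 'I_(a n) := x n.

Lemma adic_radix_gt0 n : 0 < a n.
Proof. exact: ltnW. Qed.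

Lemma adic_ext x y : (forall n, digit x n = digit y n :> nat) -> x = y.
Proof.
by move=> xy; apply: functional_extensionality_dep => n; apply/val_inj/xy.
Qed.

(* The carry into position n, so that [carry x y n.+1] is t_n. *)
Fixpoint carry x y (n : nat) : nat :=
  if n is m.+1 then (digit x m + digit y m + carry x y m) %/ a m else 0.

Definition adic_add x y : Delta := fun n : nat =>
  Ordinal (ltn_pmod (digit x n + digit y n + carry x y n) (adic_radix_gt0 n)).

Definition adic_zero : Delta := fun n : nat => Ordinal (adic_radix_gt0 n).

Lemma adic_unit_subproof n : (n == 0) < a n.
Proof. by apply: leq_ltn_trans (ha n); case: (n == 0). Qed.

(* u = (1, 0, 0, ...) *)
Definition adic_unit : Delta := fun n : nat => Ordinal (adic_unit_subproof n).

Definition adic_compl x : Delta := fun n : nat => rev_ord (digit x n).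

(* - x = (a_n - 1 - x_n)_n + u *)
Definition adic_opp x : Delta := adic_add (adic_compl x) adic_unit.

Definition adic_base n := \prod_(j < n) a j.
Definition adic_trunc x n := \sum_(k < n) digit x k * adic_base k.

Lemma adic_baseS n : adic_base n.+1 = adic_base n * a n.
Proof. by rewrite /adic_base big_ord_recr. Qed.

Lemma adic_base_gt0 n : 0 < adic_base n.
Proof. by apply: prodn_gt0 => j; exact: adic_radix_gt0. Qed.

Lemma adic_truncS x n :
  adic_trunc x n.+1 = adic_trunc x n + digit x n * adic_base n.
Proof. by rewrite /adic_trunc big_ord_recr. Qed.

Lemma adic_trunc_lt x n : adic_trunc x n < adic_base n.
Proof.
elim: n => [|n IH]; first by rewrite /adic_trunc /adic_base !big_ord0.
rewrite adic_truncS adic_baseS mulnC.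
apply: (@leq_trans (adic_base n * (digit x n).+1)).
  by rewrite mulnS mulnC ltn_add2r.
by rewrite leq_mul2l ltn_ord orbT.
Qed.

#[local] Hint Resolve adic_base_gt0 adic_trunc_lt : core.

Lemma adic_trunc_inj x y : (forall n, adic_trunc x n = adic_trunc y n) -> x = y.
Proof.
move=> xy; apply: adic_ext => n; have := xy n.+1.
by rewrite !adic_truncS xy => /addnI /eqP; rewrite eqn_pmul2r// => /eqP.
Qed.

Lemma adic_truncD x y n :
  adic_trunc (adic_add x y) n = (adic_trunc x n + adic_trunc y n) %% adic_base n.
Proof.
have H m : adic_trunc (adic_add x y) m + carry x y m * adic_base m =
    adic_trunc x m + adic_trunc y m.
  elim: m => [|m IH]; first by rewrite /adic_trunc !big_ord0.
  set c := carry x y m in IH *; set s := digit x m + digit y m + c.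
  have E : s = s %/ a m * a m + s %% a m := divn_eq s (a m).
  have D : digit (adic_add x y) m = s %% a m :> nat by [].
  have -> : carry x y m.+1 = s %/ a m by [].
  rewrite !adic_truncS adic_baseS D addnACA -IH -mulnDl.
  have := congr1 (muln^~ (adic_base m)) E; rewrite /= {1}/s.
  move: {E} (s %/ a m) (s %% a m) (adic_base m) => t r b; lia.
have := adic_trunc_lt (adic_add x y) n; rewrite -H => h.
by rewrite addnC modnMDl modn_small.
Qed.

Let adic_addC : commutative adic_add.
Proof. by move=> x y; apply: adic_trunc_inj => n; rewrite !adic_truncD addnC. Qed.

Let adic_addA : associative adic_add.
Proof.
move=> x y z; apply: adic_trunc_inj => n.
by rewrite !adic_truncD modnDml modnDmr addnA.
Qed.

Lemma adic_trunc0 n : adic_trunc adic_zero n = 0.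
Proof. by rewrite /adic_trunc big1. Qed.

Let adic_add0 : left_id adic_zero adic_add.
Proof.
move=> x; apply: adic_trunc_inj => n.
by rewrite adic_truncD adic_trunc0 add0n modn_small.
Qed.

Lemma adic_trunc_unit n : adic_trunc adic_unit n.+1 = 1.
Proof.
rewrite /adic_trunc big_ord_recl /= /adic_base big_ord0 muln1 big1 ?addn0//.
Qed.

Lemma adic_trunc_compl x n :
  (adic_trunc (adic_compl x) n + adic_trunc x n).+1 = adic_base n.
Proof.
elim: n => [|n IH]; first by rewrite /adic_trunc /adic_base !big_ord0.
rewrite !adic_truncS adic_baseS addnACA -addSn IH -mulnDl.
rewrite (_ : nat_of_ord (digit (adic_compl x) n) = a n - (digit x n).+1)//.
have := ltn_ord (digit x n); set b := adic_base n; nia.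
Qed.

Let adic_addN : left_inverse adic_zero adic_opp adic_add.
Proof.
move=> x; apply: adic_trunc_inj => -[|n].
  by rewrite /adic_trunc !big_ord0.
rewrite adic_truncD adic_trunc0 /adic_opp adic_truncD modnDml addnAC.
by rewrite adic_trunc_unit addn1 adic_trunc_compl modnn.
Qed.

HB.instance Definition _ :=
  GRing.isZmodule.Build Delta adic_addA adic_addC adic_add0 adic_addN.

End Adic.

Lemma continuous_pair (T U V : topologicalType) (f : T -> U) (g : T -> V) :
  continuous f -> continuous g -> continuous (fun x => (f x, g x)).
Proof. by move=> cf cg x; exact: cvg_pair (cf x) (cg x). Qed.

Section AdicTopology.
Context {a : nat -> nat} {ha : forall n, (1 < a n)%N}.
Local Notation Delta := (adic ha).

Lemma adic_continuousP (T : topologicalType) (f : T -> Delta) :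
  (forall t n, \forall s \near t, f s n = f t n) -> continuous f.
Proof.
move=> H t; apply/cvg_sup => n U [V [[W _ <-] Wt] WU].
by apply: filterS (H t n) => s /= st; apply: WU => /=; rewrite st.
Qed.

Lemma near_adic (x : Delta) n : \forall y \near x, y n = x n.
Proof.
exact: (@proj_continuous nat (fun n => discrete_topology 'I_(a n)) n x
  [set x n] (discrete_set1 _)).
Qed.

Lemma near_adicn (x : Delta) m :
  \forall y \near x, forall n, (n < m)%N -> y n = x n.
Proof.
elim: m => [|m IH]; first by near=> y => n; rewrite ltn0.
apply: (filterS2 (F := nbhs x)) IH (near_adic x m) => y IH ym n; rewrite ltnS leq_eqVlt.
by move=> /orP[/eqP ->|/IH].
Unshelve. all: by end_near. Qed.

Let carryE m (x y x' y' : Delta) :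
  (forall n, (n < m)%N -> x' n = x n) -> (forall n, (n < m)%N -> y' n = y n) ->
  carry x' y' m = carry x y m.
Proof.
elim: m => [//|m IH] xx yy /=; rewrite /digit xx// yy// IH// => n nm.
  by apply: xx; exact: ltnW.
by apply: yy; exact: ltnW.
Qed.

Let adic_add_continuous : continuous (fun z : Delta * Delta => z.1 + z.2).
Proof.
apply: adic_continuousP => -[x y] n.
exists ([set x' | forall k, (k < n.+1)%N -> x' k = x k],
        [set y' | forall k, (k < n.+1)%N -> y' k = y k]) => /=.
  by split; exact: near_adicn.
move=> [x' y'] /= [xx yy]; apply/val_inj => /=.
by rewrite /digit xx// yy// (carryE (x := x) (y := y))// => k kn;
  [apply: xx|apply: yy]; exact: ltnW.
Qed.

HB.instance Definition _ :=
  PreTopologicalNmodule_isTopologicalNmodule.Build Delta adic_add_continuous.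

Let adic_opp_continuous : continuous (-%R : Delta -> Delta).
Proof.
have cc : continuous (@adic_compl a ha).
  apply: adic_continuousP => y n.
  by apply: filterS (near_adic y n) => y' yy; rewrite /adic_compl /digit yy.
have cu : continuous (fun _ : Delta => adic_unit : Delta).
  exact: cst_continuous.
pose f x : Delta * Delta := (adic_compl x, adic_unit).
have -> : (-%R : Delta -> Delta) = (fun z => z.1 + z.2) \o f by [].
move=> x; apply: continuous_comp; first exact: (continuous_pair cc cu).
exact: adic_add_continuous.
Qed.

HB.instance Definition _ :=
  TopologicalNmodule_isTopologicalZmodule.Build Delta adic_opp_continuous.

End AdicTopology.

Section Solenoid.
Variable R : realType.
Context {a : nat -> nat} (ha : forall n, (1 < a n)%N).
Local Notation Delta := (adic ha).

(* Own type for R x Delta: a generic instance on [prod] would clash with the one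
   declared for products of locally convex spaces. *)
Definition cover : Type := (R^o * Delta)%type.

HB.instance Definition _ := Topological.on cover.
HB.instance Definition _ := GRing.Zmodule.on cover.

Let cover_sub_continuous : continuous (fun z : cover * cover => z.1 - z.2).
Proof.
pose T := (cover * cover)%type.
have c1 : continuous (fst : T -> _) by move=> ?; exact: cvg_fst.
have c2 : continuous (snd : T -> _) by move=> ?; exact: cvg_snd.
have f1 : continuous (fst : cover -> _) by move=> ?; exact: cvg_fst.
have f2 : continuous (snd : cover -> _) by move=> ?; exact: cvg_snd.
have comp (S U V : topologicalType) (f : S -> U) (g : U -> V) :
    continuous f -> continuous g -> continuous (g \o f).
  by move=> cf cg x; exact: continuous_comp (cf x) (cg _).
have cA := comp _ _ _ _ _
  (continuous_pair (comp _ _ _ _ _ c1 f1) (comp _ _ _ _ _ c2 f1))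
  (@sub_continuous R^o).
have cB := comp _ _ _ _ _
  (continuous_pair (comp _ _ _ _ _ c1 f2) (comp _ _ _ _ _ c2 f2))
  (@sub_continuous Delta).
exact: continuous_pair cA cB.
Qed.

HB.instance Definition _ :=
  PreTopologicalNmodule_isTopologicalZmodule.Build cover cover_sub_continuous.

(* B = {(n, nu) : n \in Z} *)
Definition winding : {pred cover} :=
  fun z => `[< exists n : int, z = (n%:~R, (adic_unit : Delta) *~ n) >].

Let winding_zmod_closed : zmod_closed winding.
Proof.
split; first by apply/asboolP; exists 0; rewrite !mulr0z.
move=> _ _ /asboolP[m ->] /asboolP[n ->]; apply/asboolP; exists (m - n).
by rewrite !mulrzBr.
Qed.

HB.instance Definition _ := GRing.isZmodClosed.Build _ winding winding_zmod_closed.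

(* Not [quotient_topology], whose choice structure differs from the one of
   the quotient group. *)
Definition solenoid : Type := Quotient.quot winding.

HB.instance Definition _ := EqQuotient.on solenoid.
HB.instance Definition _ := GRing.Zmodule.on solenoid.

Definition solenoid_pi (z : cover) : solenoid := \pi_solenoid%qT z.

Lemma solenoid_piB : {morph solenoid_pi : z w / z - w}.
Proof. exact: (raddfB \pi_(Quotient.quot winding)%qT). Qed.

Let qopen := [set U : set solenoid | open (solenoid_pi @^-1` U)].

Let qopenT : qopen setT.
Proof. by rewrite /qopen /= preimage_setT; exact: openT. Qed.

Let qopenI : setI_closed qopen.
Proof. by move=> U V; exact: openI. Qed.

Let qopen_bigU (I : Type) (f : I -> set solenoid) :
  (forall i, qopen (f i)) -> qopen (\bigcup_i f i).
Proof. by move=> of_; apply: bigcup_open => i _; exact: of_. Qed.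

HB.instance Definition _ :=
  isOpenTopological.Build solenoid qopenT qopenI qopen_bigU.

Lemma solenoid_pi_continuous : continuous solenoid_pi.
Proof. by apply: (proj2 (@continuousP _ _ _)) => U. Qed.

Lemma solenoid_pi_open (U : set cover) :
  open U -> open (solenoid_pi @` U).
Proof.
move=> oU; rewrite /open/= /qopen/=.
rewrite (_ : _ @^-1` _ = \bigcup_(w in winding) ((fun z => z - w) @^-1` U)).
  apply: bigcup_open => w _; move: U oU; apply: (proj1 (@continuousP _ _ _)) => z.
  have c : continuous (fun z : cover => (z, w)).
    exact: continuous_pair (fun=> cvg_id) (@cst_continuous _ _ w).
  apply: (@continuous_comp _ _ _ (fun z : cover => (z, w))
    (fun t => t.1 - t.2)); first exact: c.
  exact: sub_continuous.
apply/seteqP; split => [z [z' Uz' /eqP]|z [w /= wB Uzw]].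
  rewrite eq_sym /solenoid_pi -Quotient.idealrBE => zz'.
  by exists (z - z') => //=; rewrite subKr.
exists (z - w) => //; apply/eqP; rewrite /solenoid_pi -Quotient.idealrBE.
by rewrite addrAC subrr add0r rpredN.
Qed.

Lemma nbhs_solenoid_pi (z : cover) (V : set cover) :
  nbhs z V -> nbhs (solenoid_pi z) (solenoid_pi @` V).
Proof.
rewrite nbhsE => -[W [oW Wz] WV].
apply: (@filterS _ _ _ (solenoid_pi @` W)); first exact: image_subset.
by apply: open_nbhs_nbhs; split; [exact: solenoid_pi_open|exists z].
Qed.

Let solenoid_sub_continuous :
  continuous (fun x : solenoid * solenoid => x.1 - x.2).
Proof.
move=> [x y].
have [z <-] : exists z, solenoid_pi z = x by exists (repr x); exact: reprK.
have [w <-] : exists w, solenoid_pi w = y by exists (repr y); exact: reprK.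
move=> U /=; rewrite -solenoid_piB => nU.
have [[V W] /= [nV nW] VWU] : nbhs (z, w)
    ((fun t : cover * cover => t.1 - t.2) @^-1` (solenoid_pi @^-1` U)).
  by apply: (@sub_continuous cover); exact: solenoid_pi_continuous.
exists (solenoid_pi @` V, solenoid_pi @` W) => /=.
  by split; exact: nbhs_solenoid_pi.
move=> [_ _] /= [[v Vv <-] [t Wt <-]].
by rewrite -solenoid_piB; exact: (VWU (v, t)).
Qed.

HB.instance Definition _ :=
  PreTopologicalNmodule_isTopologicalZmodule.Build solenoid
    solenoid_sub_continuous.

End Solenoid.

(* A topological abelian group with its Borel sigma-algebra. The sigma-algebra
   that [borel X * borel X] inherits from the library is the product one; it is
   the Borel sigma-algebra of X * X when X is second countable, as solenoids
   are. *)
Definition borel (X : topologicalZmodType) : Type := X.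

HB.instance Definition _ (X : topologicalZmodType) := Choice.on (borel X).
HB.instance Definition _ (X : topologicalZmodType) :=
  isPointed.Build (borel X) (0 : X).
HB.instance Definition _ (X : topologicalZmodType) := Measurable.copy (borel X)
  (g_sigma_algebraType (@open X : set (set (borel X)))).

Definition topological_automorphism (X : topologicalZmodType) (f : X -> X) :=
  [/\ {morph f : x y / x + y}, continuous f &
      exists g : X -> X, [/\ cancel f g, cancel g f & continuous g]].

Section Dual.
Variables (R : realType) (X : topologicalZmodType).

Definition is_character (chi : X -> R[i]) :=
  [/\ continuous (chi : X -> R[i]^o), (forall x, `|chi x| = 1) &
      {morph chi : x y / x + y >-> x * y}].

(* The character group, written additively, with the compact-open topology. *)
Record dual : Type := Dual {
  dual_fun :> X -> R[i];
  dualP : is_character dual_fun }.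

HB.instance Definition _ := gen_eqMixin dual.
HB.instance Definition _ := gen_choiceMixin dual.

Lemma dual_ext (y z : dual) : dual_fun y = dual_fun z -> y = z.
Proof. by case: y z => [f fP] [g gP] /= fg; subst g; congr Dual. Qed.

HB.instance Definition _ := Topological.copy dual
  (initial_topology (dual_fun : dual -> {compact-open, X -> R[i]^o})).

Let dual_neq0 (y : dual) x : y x != 0.
Proof. by case: (dualP y) => _ y1 _; rewrite -normr_eq0 y1 oner_neq0. Qed.

Let dual_zero_subproof : is_character (fun=> 1).
Proof.
split=> [|x|x y]; [exact: cst_continuous|exact: normr1|by rewrite mulr1].
Qed.
Definition dual_zero := Dual dual_zero_subproof.

Let dual_add_subproof (y z : dual) : is_character (fun x => y x * z x).
Proof.
have [yc y1 yD] := dualP y; have [zc z1 zD] := dualP z; split.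
- by move=> x; exact: (@cvgM R[i] _ _ _ y z _ _ (yc x) (zc x)).
- by move=> x; rewrite normrM y1 z1 mulr1.
- by move=> s t; rewrite yD zD mulrACA.
Qed.
Definition dual_add y z := Dual (dual_add_subproof y z).

Let dual_opp_subproof (y : dual) : is_character (fun x => (y x)^-1).
Proof.
have [yc y1 yD] := dualP y; split.
- by move=> x; exact: (@cvgV R[i] _ _ _ y _ (dual_neq0 y x) (yc x)).
- by move=> x; rewrite normfV y1 invr1.
- by move=> s t; rewrite yD invfM.
Qed.
Definition dual_opp y := Dual (dual_opp_subproof y).

Let dual_addA : associative dual_add.
Proof. by move=> y z w; apply: dual_ext; apply/funext => x /=; rewrite mulrA. Qed.

Let dual_addC : commutative dual_add.
Proof. by move=> y z; apply: dual_ext; apply/funext => x /=; rewrite mulrC. Qed.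

Let dual_add0 : left_id dual_zero dual_add.
Proof. by move=> y; apply: dual_ext; apply/funext => x /=; rewrite mul1r. Qed.

Let dual_addN : left_inverse dual_zero dual_opp dual_add.
Proof.
by move=> y; apply: dual_ext; apply/funext => x /=; rewrite mulVf.
Qed.

HB.instance Definition _ :=
  GRing.isZmodule.Build dual dual_addA dual_addC dual_add0 dual_addN.

End Dual.

Section Distributions.
Variables (R : realType) (X : topologicalZmodType).
Implicit Types mu gamma omega m : probability (borel X) R.

Definition charfun mu (y : dual R X) : R[i] :=
  ((\int[mu]_(x in setT) complex.Re (y x))%R +i*
   (\int[mu]_(x in setT) complex.Im (y x))%R)%C.

Definition gaussian_distribution gamma : Prop :=
  exists (x : X) (phi : dual R X -> R),
    [/\ continuous phi,
        forall y, 0 <= phi y,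
        forall u v, phi (u + v) + phi (u - v) = 2 * (phi u + phi v) &
        forall y, charfun gamma y = y x * (expR (- phi y))%:C%C].

Definition is_subgroup (K : set X) : Prop :=
  K 0 /\ (forall x y, K x -> K y -> K (x - y)).

(* The Haar distribution m_K, viewed as a distribution on X supported by K. *)
Definition haar_distribution (K : set X) m : Prop :=
  m K = 1%E /\
  (forall k, K k -> forall E : set (borel X), measurable E ->
     m [set z | E ((z : X) + k)] = m E).

(* The shifts of Haar distributions: the law of z + x for z distributed
   according to m_K. *)
Definition idempotent_distribution omega : Prop :=
  exists (K : set X) (m : probability (borel X) R) (x : X),
    [/\ compact K, is_subgroup K, haar_distribution K m &
        forall E : set (borel X), measurable E ->
          omega E = m [set z | E ((z : X) + x)]].

Definition convolution gamma omega : set (borel X) -> \bar R :=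
  fun E => (gamma \x omega)%E [set z | E ((z.1 : X) + (z.2 : X))].

(* Gamma(X) * I(X) *)
Definition gaussian_idempotent mu : Prop :=
  exists gamma omega : probability (borel X) R,
    [/\ gaussian_distribution gamma, idempotent_distribution omega &
        forall E, measurable E -> mu E = convolution gamma omega E].

Section RandomVariables.
Context {d : measure_display} {Omega : measurableType d}.
Variable P : probability Omega R.

Definition independent_RV (xi1 xi2 : Omega -> borel X) : Prop :=
  forall A B : set (borel X), measurable A -> measurable B ->
    P (xi1 @^-1` A `&` xi2 @^-1` B) = (P (xi1 @^-1` A) * P (xi2 @^-1` B))%E.

(* The conditional distribution of L2 given L1 is symmetric, i.e. (L1, L2) and
   (L1, - L2) are identically distributed. *)
Definition cond_symmetric (L1 L2 : Omega -> X) : Prop :=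
  forall E : set (borel X * borel X), measurable E ->
    P [set w | E (L1 w, L2 w)] = P [set w | E (L1 w, - L2 w)].

End RandomVariables.
End Distributions.

(* Main.v *)
(* For characteristic functions f, g the symmetry of the conditional law reads
     f (u + p v) g (u + q v) = f (u - p v) g (u - q v)   for all characters u, v.

   If p q <> -3, this equation is solved by mixtures (m_E + m_D) / 2 of two Haar
   laws with D < E, whose characteristic functions are (1_E + 1_D) / 2 for suitable
   subgroups of the localization of the cyclic group generated by one character;
   these take the value 1/2 at some y and 1 at a multiple of y, which is impossible
   on the support of the transform of a convolution of a Gaussian and an idempotent
   law.

   If p q = -3, we may take p = 1 and q = -3, and the character group is uniquely
   2-divisible. Let C be the subgroup of the y such that |f| and |g| tend to 1 along
   y / 2^n. Iterating f (2 y) = f (y) g (3 y) and g (2 y) = f (y) g (-y) shows that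
   3 y belongs to C whenever f y or g y is nonzero; conversely, nonvanishing of f and g
   at small multiples of a point propagates to all its multiples, so that f and g do
   not vanish on C.
   If g is supported by C, taking three differences in the equation shows that g
   is the product of a character and of a Gaussian exponential on C. Otherwise,
   as the character group has rank one, both f and g are supported exactly by
   {y | 3 y in C}, and the same holds there for f. *)

Require Import Defs.
From HB Require Import structures.
From mathcomp Require Import all_boot all_order all_algebra.
From mathcomp Require Import complex zify ring lra.
From mathcomp Require Import all_classical all_reals all_analysis.
From mathcomp Require Import measurable_realfun.

Set Implicit Arguments.
Unset Strict Implicit.
Unset Printing Implicit Defensive.

Import Order.TTheory GRing.Theory Num.Theory.
Import numFieldNormedType.Exports.

Local Open Scope classical_set_scope.
Local Open Scope ring_scope.

(** Two facts special to the solenoid carry the proof. The characters form an increasing union of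
    cyclic groups, generated by [level_char n], so that any two of them are multiples of a third;
    and [rate] embeds them into the reals. Compactness of X turns a character of a subgroup of the
    dual into evaluation at a point. Hence the Haar law of an annihilator arises as the law of a
    point with uniform mixed-radix digits, and a Gaussian law as the image of the normal law under a
    one-parameter subgroup. Rank one also forces a quadratic exponent to be [c * rate y ^+ 2], and
    lets C have at most three cosets in {y | 3 y in C}.

    For p q = -3 the obstacle is the differencing for g: one of its three steps must be a multiple
    of 3, whereas C is only known to be closed under halving. As 4^n = 1 mod 3, x is x / 4^n plus a
    multiple of 3 of x / 4^n, and the error disappears because |g (x / 4^n)| tends to 1 on C.

    For p q <> -3 the localization is taken at p - q, or at half of it, because u + p v and u + q v
    differ by (p - q) v: when both lie in the subgroup H, closure under this division puts v, or 2
    v, back into H. *)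

Section ComplexExpectation.
Context {R : realType}.

(** Real and imaginary parts are handled separately, so that every property of a complex expectation
    reduces to two integrals of bounded real functions. *)
Definition cplx_bounded_measurable d (T : measurableType d) (h : T -> R[i]) :=
  [/\ measurable_fun setT (fun x => complex.Re (h x)),
      measurable_fun setT (fun x => complex.Im (h x)) &
      exists M : R, forall x,
        `|complex.Re (h x)| <= M /\ `|complex.Im (h x)| <= M].

Definition cplx_expectation d (T : measurableType d)
    (mu : probability T R) (h : T -> R[i]) : R[i] :=
  ((\int[mu]_x (complex.Re (h x)))%R +i* (\int[mu]_x (complex.Im (h x)))%R)%C.

Local Notation bm := cplx_bounded_measurable.
Local Notation Ec := cplx_expectation.

Lemma complexReM (z w : R[i]) : complex.Re (z * w) =
  complex.Re z * complex.Re w - complex.Im z * complex.Im w.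
Proof. by case: z w => [? ?] [? ?]. Qed.

Lemma complexImM (z w : R[i]) : complex.Im (z * w) =
  complex.Re z * complex.Im w + complex.Im z * complex.Re w.
Proof. by case: z w => [? ?] [? ?]. Qed.

Lemma complexReD (z w : R[i]) : complex.Re (z + w) =
  complex.Re z + complex.Re w.
Proof. by case: z w => [? ?] [? ?]. Qed.

Lemma complexImD (z w : R[i]) : complex.Im (z + w) =
  complex.Im z + complex.Im w.
Proof. by case: z w => [? ?] [? ?]. Qed.

Lemma complexReZ (r : R) (z : R[i]) : complex.Re (r%:C%C * z) = r * complex.Re z.
Proof. by rewrite complexReM /= mul0r subr0. Qed.

Lemma complexImZ (r : R) (z : R[i]) : complex.Im (r%:C%C * z) = r * complex.Im z.
Proof. by rewrite complexImM /= mul0r addr0. Qed.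

Lemma complexReJ (z : R[i]) : complex.Re z^* = complex.Re z.
Proof. by case: z. Qed.

Lemma complexImJ (z : R[i]) : complex.Im z^* = - complex.Im z.
Proof. by case: z. Qed.

Lemma complexP (z w : R[i]) : complex.Re z = complex.Re w ->
  complex.Im z = complex.Im w -> z = w.
Proof. by case: z w => [? ?] [? ?] /= -> ->. Qed.

Section OneSpace.
Context d (T : measurableType d).
Implicit Types (mu nu : probability T R) (h k : T -> R[i]).

Lemma bounded_measurable_integrable mu (f : T -> R) (M : R) :
  measurable_fun setT f -> (forall x, `|f x| <= M) ->
  mu.-integrable setT (EFin \o f).
Proof.
move=> mf fM; apply: (measurable_bounded_integrable (mu := mu)) => //.
  by rewrite (le_lt_trans (probability_le1 mu measurableT))// ltry.
by exists M; split; [exact: num_real|move=> y My x _; rewrite /= (le_trans (fM x))// ltW].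
Qed.

Lemma bm_intRe mu h : bm h -> mu.-integrable setT (EFin \o (fun x => complex.Re (h x))).
Proof.
by case=> mR _ [M hM]; apply: (bounded_measurable_integrable mu mR (M := M)) => x; case: (hM x).
Qed.

Lemma bm_intIm mu h : bm h -> mu.-integrable setT (EFin \o (fun x => complex.Im (h x))).
Proof.
by case=> _ mR [M hM]; apply: (bounded_measurable_integrable mu mR (M := M)) => x; case: (hM x).
Qed.

Lemma bm_cst (c : R[i]) : bm (fun _ : T => c).
Proof.
split; [exact: measurable_cst|exact: measurable_cst|].
by exists (Num.max `|complex.Re c| `|complex.Im c|) => _; rewrite !le_max !lexx orbT.
Qed.

Lemma bmD h k : bm h -> bm k -> bm (fun x => h x + k x).
Proof.
move=> [h1 h2 [M hM]] [k1 k2 [N kN]]; split.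
- by under eq_fun do rewrite complexReD; exact: measurable_funD.
- by under eq_fun do rewrite complexImD; exact: measurable_funD.
exists (M + N) => x; rewrite complexReD complexImD.
have [? ?] := hM x; have [? ?] := kN x.
by split; rewrite (le_trans (ler_normD _ _))// lerD.
Qed.

Lemma bmM h k : bm h -> bm k -> bm (fun x => h x * k x).
Proof.
move=> [h1 h2 [M hM]] [k1 k2 [N kN]]; split.
- under eq_fun do rewrite complexReM.
  by apply: measurable_funB; exact: measurable_funM.
- under eq_fun do rewrite complexImM.
  by apply: measurable_funD; exact: measurable_funM.
exists (M * N + M * N) => x; rewrite complexReM complexImM.
have [? ?] := hM x; have [? ?] := kN x.
split.
  by rewrite (le_trans (ler_normB _ _))// lerD// normrM ler_pM.
by rewrite (le_trans (ler_normD _ _))// lerD// normrM ler_pM.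
Qed.

Lemma bmJ h : bm h -> bm (fun x => (h x)^*).
Proof.
move=> [h1 h2 [M hM]]; split.
- by under eq_fun do rewrite complexReJ.
- by under eq_fun do rewrite complexImJ; exact: measurable_funN.
by exists M => x; rewrite complexReJ complexImJ normrN.
Qed.

Lemma bm_comp d' (T' : measurableType d') (phi : T' -> T) h :
  measurable_fun setT phi -> bm h -> bm (fun x => h (phi x)).
Proof.
move=> mphi [h1 h2 [M hM]]; split.
- exact: (measurableT_comp h1 mphi).
- exact: (measurableT_comp h2 mphi).
by exists M => x.
Qed.

Lemma EcD mu h k : bm h -> bm k -> Ec mu (fun x => h x + k x) = Ec mu h + Ec mu k.
Proof.
move=> bh bk; apply: complexP; rewrite ?complexReD ?complexImD /=.
  under eq_Rintegral do rewrite complexReD.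
  by rewrite RintegralD//; exact: bm_intRe.
under eq_Rintegral do rewrite complexImD.
by rewrite RintegralD//; exact: bm_intIm.
Qed.

Lemma EcZ mu (c : R[i]) h : bm h -> Ec mu (fun x => c * h x) = c * Ec mu h.
Proof.
move=> bh; have hR := bm_intRe mu bh; have hI := bm_intIm mu bh.
have Z r f : mu.-integrable setT (EFin \o f) -> mu.-integrable setT (EFin \o (fun x => r * f x)).
  by move=> fi; exact: (integrableZl _ r fi).
apply: complexP; rewrite ?complexReM ?complexImM /=.
  under eq_Rintegral do rewrite complexReM.
  by rewrite RintegralB ?RintegralZl//; exact: Z.
under eq_Rintegral do rewrite complexImM.
by rewrite RintegralD ?RintegralZl//; exact: Z.
Qed.

Lemma Ec_cst mu (c : R[i]) : Ec mu (fun=> c) = c.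
Proof.
have mu1 : fine (mu setT) = 1 by have -> : mu setT = 1%E := probability_setT mu.
by apply: complexP => /=; rewrite Rintegral_cst// mu1 mulr1.
Qed.

Lemma eq_Ec mu h k : h =1 k -> Ec mu h = Ec mu k.
Proof. by move=> /funext ->. Qed.

Lemma EcJ mu h : bm h -> Ec mu (fun x => (h x)^*) = (Ec mu h)^*.
Proof.
move=> bh; apply: complexP; rewrite /=.
  by under eq_Rintegral do rewrite complexReJ.
under eq_Rintegral do rewrite complexImJ -mulN1r.
by rewrite RintegralZl ?mulN1r//; exact: bm_intIm.
Qed.

Lemma ReEc_ge0 mu h : (forall x, 0 <= complex.Re (h x)) -> 0 <= complex.Re (Ec mu h).
Proof. by move=> h0; exact: Rintegral_ge0. Qed.

Lemma Ec_pushforward d' (T' : measurableType d') mu (nu : probability T' R)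
    (phi : T -> T') (h : T' -> R[i]) :
  measurable_fun setT phi ->
  (forall E, measurable E -> nu E = mu (phi @^-1` E)) ->
  bm h -> Ec nu h = Ec mu (fun x => h (phi x)).
Proof.
move=> mphi nuE [h1 h2 [M hM]].
have key (f : T' -> R) : measurable_fun setT f -> (forall x, `|f x| <= M) ->
    (\int[nu]_x f x = \int[mu]_x f (phi x))%R.
  move=> mf fM; rewrite /Rintegral.
  rewrite (@eq_measure_integral _ T' R setT (pushforward mu phi)) /=; last first.
    by move=> E mE _; exact: nuE.
  rewrite integral_pushforward//; first exact/measurable_EFinP.
  by apply: (bounded_measurable_integrable mu (M := M)) => //; exact: measurableT_comp.
apply: complexP => /=; rewrite key// => x; by case: (hM x).
Qed.

(** Dominated convergence with one constant as majorant under both laws: agreement of expectations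
    passes to bounded pointwise limits. *)
Lemma Ec_eq_lim mu nu (h_ : nat -> T -> R[i]) h (M : R) :
  (forall n, bm (h_ n)) -> bm h ->
  (forall n x, `|complex.Re (h_ n x)| <= M /\ `|complex.Im (h_ n x)| <= M) ->
  (forall x, complex.Re (h_ n x) @[n --> \oo] --> complex.Re (h x)) ->
  (forall x, complex.Im (h_ n x) @[n --> \oo] --> complex.Im (h x)) ->
  (forall n, Ec mu (h_ n) = Ec nu (h_ n)) -> Ec mu h = Ec nu h.
Proof.
move=> bh_ bh hM hR hI e.
have key (m : probability T R) (f_ : nat -> T -> R) (f : T -> R) :
    (forall n, measurable_fun setT (f_ n)) ->
    m.-integrable setT (EFin \o f) -> (forall n x, `|f_ n x| <= M) ->
    (forall x, f_ n x @[n --> \oo] --> f x) ->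
    (\int[m]_x f_ n x)%R @[n --> \oo] --> (\int[m]_x f x)%R.
  move=> mf_ fi fM ff.
  have mf : measurable_fun setT (EFin \o f) by exact: measurable_int fi.
  have [||||_ _ H] := @dominated_convergence _ T R m setT measurableT
    (fun n => EFin \o f_ n) (EFin \o f) (cst M%:E) _ mf.
  - by move=> n; exact/measurable_EFinP.
  - by apply: aeW => x _ /=; apply: cvg_EFin; [exact: nearW|exact: ff].
  - exact: (bounded_measurable_integrable m (f := cst M) (M := `|M|)).
  - by apply: aeW => x n _ /=; rewrite lee_fin.
  apply: fine_cvg; rewrite fineK//.
  exact: (integrable_fin_num measurableT fi).
have lim_eq (u v : R^nat) (a b : R) : u =1 v -> u @ \oo --> a -> v @ \oo --> b -> a = b.
  by move=> /funext -> ua va; exact: (cvg_unique _ ua va).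
apply: complexP => /=.
  apply: (lim_eq _ _ _ _ _ (key mu _ _ _ _ _ hR) (key nu _ _ _ _ _ hR)) => /=.
  - by move=> n; have := e n; case.
  - by move=> n; case: (bh_ n).
  - exact: bm_intRe.
  - by move=> n x; case: (hM n x).
  - by move=> n; case: (bh_ n).
  - exact: bm_intRe.
  - by move=> n x; case: (hM n x).
apply: (lim_eq _ _ _ _ _ (key mu _ _ _ _ _ hI) (key nu _ _ _ _ _ hI)) => /=.
- by move=> n; have := e n; case.
- by move=> n; case: (bh_ n).
- exact: bm_intIm.
- by move=> n x; case: (hM n x).
- by move=> n; case: (bh_ n).
- exact: bm_intIm.
- by move=> n x; case: (hM n x).
Qed.

Lemma bm_indic (D : set T) : measurable D -> bm (fun x => (\1_D x : R)%:C%C).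
Proof.
move=> mD; split => /=; [exact: measurable_indic|exact: measurable_cst|].
by exists 1 => x /=; rewrite normr0 ler01 indicE; case: (_ \in _); rewrite ?normr1 ?normr0.
Qed.

Lemma Ec_indic mu (D : set T) : measurable D ->
  Ec mu (fun x => (\1_D x)%:C%C) = (fine (mu D))%:C%C.
Proof.
move=> mD; apply: complexP => /=; last by rewrite Rintegral_cst// mul0r.
by rewrite /Rintegral integral_indic// setIT.
Qed.

End OneSpace.

(** [P] only has to agree with the product on measurable sets, so that the lemma covers product
    measures as well as joint laws of independent variables. *)
Lemma Ec_prod d1 d2 (T1 : measurableType d1) (T2 : measurableType d2)
    (mu : probability T1 R) (nu : probability T2 R)
    (P : probability (T1 * T2)%type R) (h : T1 -> R[i]) (k : T2 -> R[i]) :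
  (forall E, measurable E -> P E = (mu \x nu)%E E) -> bm h -> bm k ->
  Ec P (fun z => h z.1 * k z.2) = Ec mu h * Ec nu k.
Proof.
move=> PE bh bk.
have key (f : T1 -> R) (g : T2 -> R) (M N : R) : measurable_fun setT f -> measurable_fun setT g ->
    (forall x, `|f x| <= M) -> (forall x, `|g x| <= N) ->
    (\int[P]_z (f z.1 * g z.2) = (\int[mu]_x f x) * (\int[nu]_x g x))%R.
  move=> mf mg fM gN.
  have fi := bounded_measurable_integrable mu mf fM.
  have gi := bounded_measurable_integrable nu mg gN.
  have mfg : measurable_fun setT (fun z : T1 * T2 => f z.1 * g z.2).
    by apply: measurable_funM; apply: measurableT_comp.
  have fgb z : `|f z.1 * g z.2| <= M * N by rewrite normrM ler_pM.
  have ePE : (\int[P]_z (f z.1 * g z.2)%:E = \int[(mu \x nu)%E]_z (f z.1 * g z.2)%:E)%E.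
    by apply: eq_measure_integral => E mE _; exact: PE.
  have ifg : (mu \x nu)%E.-integrable setT (EFin \o (fun z : T1 * T2 => f z.1 * g z.2)).
    apply/integrableP; split; first exact/measurable_EFinP.
    have /integrableP[_] := bounded_measurable_integrable P mfg fgb.
    congr (_ < _)%E; apply: eq_measure_integral => E mE _; exact: PE.
  rewrite /Rintegral ePE -integral12_prod_meas1//=.
  under eq_integral => x _.
    rewrite /fubini_F /=; under eq_integral do rewrite EFinM.
    rewrite integralZl//=; over.
  rewrite /=; set c := (\int[nu]_y (g y)%:E)%E.
  have cfin : c \is a fin_num by exact: (integrable_fin_num measurableT gi).
  rewrite -(fineK cfin) integralZr// fineM// ?fineK//.
  exact: (integrable_fin_num measurableT fi).
have [h1 h2 [M hM]] := bh; have [k1 k2 [N kN]] := bk.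
have H1 x : `|complex.Re (h x)| <= M by case: (hM x).
have H2 x : `|complex.Im (h x)| <= M by case: (hM x).
have K1 x : `|complex.Re (k x)| <= N by case: (kN x).
have K2 x : `|complex.Im (k x)| <= N by case: (kN x).
have I (f : T1 -> R) (g : T2 -> R) : measurable_fun setT f -> measurable_fun setT g ->
    (forall x, `|f x| <= M) -> (forall x, `|g x| <= N) ->
    P.-integrable setT (EFin \o (fun z : T1 * T2 => f z.1 * g z.2)).
  move=> mf mg fM gN; apply: (bounded_measurable_integrable P (M := M * N)).
    by apply: measurable_funM; apply: measurableT_comp.
  by move=> z; rewrite normrM ler_pM.
apply: complexP; rewrite ?complexReM ?complexImM /=.
  rewrite [LHS](_ : _ = \int[P]_z (complex.Re (h z.1) * complex.Re (k z.2) -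
      complex.Im (h z.1) * complex.Im (k z.2))); last first.
    by apply: eq_Rintegral => z _; exact: complexReM.
  rewrite RintegralB//; [|exact: (I (fun x => complex.Re (h x)) (fun x => complex.Re (k x)))
    |exact: (I (fun x => complex.Im (h x)) (fun x => complex.Im (k x)))].
  by rewrite (key (fun x => complex.Re (h x)) (fun x => complex.Re (k x)) M N)//
    (key (fun x => complex.Im (h x)) (fun x => complex.Im (k x)) M N).
rewrite [LHS](_ : _ = \int[P]_z (complex.Re (h z.1) * complex.Im (k z.2) +
    complex.Im (h z.1) * complex.Re (k z.2))); last first.
  by apply: eq_Rintegral => z _; exact: complexImM.
rewrite RintegralD//; [|exact: (I (fun x => complex.Re (h x)) (fun x => complex.Im (k x)))
  |exact: (I (fun x => complex.Im (h x)) (fun x => complex.Re (k x)))].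
by rewrite (key (fun x => complex.Re (h x)) (fun x => complex.Im (k x)) M N)//
  (key (fun x => complex.Im (h x)) (fun x => complex.Re (k x)) M N).
Qed.

End ComplexExpectation.

Local Notation bm := cplx_bounded_measurable.
Local Notation Ec := cplx_expectation.

(** * Polynomials converging to the indicator of a half-line *)

Section ThresholdPolynomials.
Context {R : realType}.
Implicit Types x z u : R.

Lemma bernoulli_ineq u m : 0 <= u <= 1 -> 1 - m%:R * u <= (1 - u) ^+ m.
Proof.
move=> /andP[u0 u1]; elim: m => [|m IH]; first by rewrite mul0r subr0 expr0.
rewrite exprS; have u1' : 0 <= 1 - u by rewrite subr_ge0.
apply: le_trans (ler_wpM2l u1' IH).
have : 0 <= m%:R * u ^+ 2 by rewrite mulr_ge0// exprn_ge0.
by rewrite -natr1 expr2; nra.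
Qed.

(** Each of 1, z, ..., z^(n-1) is at least z^n, so that n z^n is bounded by a geometric sum. *)
Lemma natmul_expr_le z n : 0 <= z < 1 -> n%:R * z ^+ n <= (1 - z)^-1.
Proof.
move=> /andP[z0 z1]; have z1' : 0 < 1 - z by rewrite subr_gt0.
suff H : n%:R * z ^+ n * (1 - z) <= 1 - z ^+ n.
  by rewrite -[leRHS]mul1r ler_pdivlMr// (le_trans H)// gerBl exprn_ge0.
elim: n => [|n IH]; first by rewrite !mul0r subrr.
have zn : z ^+ n.+1 <= 1 by rewrite exprn_ile1// ltW.
have zn0 : 0 <= z ^+ n by rewrite exprn_ge0.
have := ler_wpM2l z0 IH; rewrite -natr1 exprS in zn *.
set w := z ^+ n in IH zn zn0 *; set m := n%:R; nra.
Qed.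

(** A polynomial in x with a sharp transition at 1/2. For x below, Bernoulli's inequality bounds the
    defect by n (2 x)^(2 n), which tends to 0; for the other x, 1 - y <= exp (- y) bounds the value
    by exp (- n). The factor n in the exponent is what makes the limit 0 at x = 1/2 itself. *)
Definition threshold_pow (x : R) (n : nat) : R :=
  (1 - x ^+ (n + n)) ^+ (4 ^ n * n).

Lemma threshold_pow_itv x n : 0 <= x <= 1 -> 0 <= threshold_pow x n <= 1.
Proof.
move=> /andP[x0 x1]; have y1 : x ^+ (n + n) <= 1 by rewrite exprn_ile1.
have y0 : 0 <= x ^+ (n + n) by rewrite exprn_ge0.
by rewrite exprn_ge0 ?subr_ge0//= exprn_ile1// ?subr_ge0// gerBl.
Qed.

Lemma threshold_pow_cvg x : 0 <= x <= 1 ->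
  threshold_pow x n @[n --> \oo] --> ((x < 2^-1)%R%:R : R).
Proof.
move=> x01; have /andP[x0 x1] := x01.
have [xh|xh] := ltP x 2^-1.
  pose z := 2 * x; have z01 : 0 <= z < 1.
    by rewrite /z mulr_ge0//= -ltr_pdivlMl// mulr1.
  have zc : (1 - z)^-1 * z ^+ n @[n --> \oo] --> (0 : R).
    rewrite -[X in _ --> X](mulr0 (1 - z)^-1); apply: cvgMr; apply: cvg_expr.
    by have /andP[z0 z1] := z01; rewrite ger0_norm.
  apply: (@squeeze_cvgr _ _ _ _ (fun n => 1 - (1 - z)^-1 * z ^+ n) (cst 1)).
  - near=> n; have /andP[_ ->] := threshold_pow_itv n x01; rewrite andbT.
    apply: le_trans (bernoulli_ineq _ _); last by rewrite exprn_ge0//= exprn_ile1.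
    rewrite lerD2l lerN2.
    have -> : (4 ^ n * n)%:R * x ^+ (n + n) = n%:R * z ^+ n * z ^+ n.
      rewrite natrM natrX (_ : 4%:R = 2 * 2 :> R); last by rewrite -natrM.
      rewrite /z !exprMn !exprD.
      by set p := 2%:R ^+ n; set q := x ^+ n; ring.
    by rewrite ler_wpM2r ?natmul_expr_le// exprn_ge0//; case/andP: z01.
  - by rewrite -[X in _ --> X](subr0 1); apply: cvgB => //; exact: cvg_cst.
  - exact: cvg_cst.
have ec : (expR (-1) : R) ^+ n @[n --> \oo] --> (0 : R).
  by apply: cvg_expr; rewrite ger0_norm ?expR_ge0// expR_lt1 oppr_lt0.
apply: (@squeeze_cvgr _ _ _ _ (cst 0) (fun n => (expR (-1) : R) ^+ n)) => //; last exact: cvg_cst.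
near=> n; have /andP[-> _]/= := threshold_pow_itv n x01.
rewrite /threshold_pow exprM lerXn2r ?nnegrE ?expR_ge0 ?exprn_ge0//.
  by rewrite subr_ge0 exprn_ile1.
have xn : 4^-1 ^+ n <= x ^+ (n + n).
  rewrite exprD -exprMn lerXn2r ?nnegrE ?mulr_ge0//; nra.
have le1 : 1 - x ^+ (n + n) <= expR (- (4^-1 ^+ n)).
  by rewrite (le_trans _ (expR_ge1Dx _))// lerD2l lerN2.
apply: (@le_trans _ _ (expR (- (4^-1 ^+ n)) ^+ (4 ^ n))).
  by rewrite lerXn2r ?nnegrE ?expR_ge0// subr_ge0 exprn_ile1.
rewrite -expRM_natl ler_expR mulrN lerN2 natrX -exprMn mulfV// expr1n//.
Unshelve. all: by end_near. Qed.

End ThresholdPolynomials.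

(** * Laws determined by the expectations of a multiplicative family *)

Section Uniqueness.
Context {R : realType} d (T : measurableType d) (mu nu : probability T R).
Variable K : set (T -> R[i]).
Hypothesis K_bm : forall k, K k -> bm k.
Hypothesis K1 : K (fun=> 1).
Hypothesis KM : forall h k, K h -> K k -> K (fun x => h x * k x).
Hypothesis KJ : forall k, K k -> K (fun x => (k x)^*).
Hypothesis K_eq : forall k, K k -> Ec mu k = Ec nu k.

(** Functions with equal expectations form only a linear space. Testing against all of [K] makes [A]
    stable under multiplication by [K], and its multipliers are closed under products, so that
    polynomials in elements of [K] become available. *)
Let A (h : T -> R[i]) := bm h /\
  forall k, K k -> Ec mu (fun x => h x * k x) = Ec nu (fun x => h x * k x).

(* The multipliers of A form an algebra containing K and closed under bounded
   limits, hence the indicator functions of the events generated by K. *)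
Let mult (m : T -> R[i]) := forall h, A h -> A (fun x => m x * h x).

Let multK k : K k -> mult k.
Proof.
move=> Kk h [bh Ah]; split; first by apply: bmM => //; exact: K_bm.
move=> k' Kk'; have := Ah _ (KM Kk Kk').
by congr (_ = _); apply: eq_Ec => x; rewrite mulrCA mulrA.
Qed.

Let mult_cst c : mult (fun=> c).
Proof.
move=> h [bh Ah]; split; first by apply: bmM => //; exact: bm_cst.
move=> k Kk.
have E m : Ec m (fun x => c * h x * k x) = c * Ec m (fun x => h x * k x).
  rewrite -EcZ; last by apply: bmM => //; exact: K_bm.
  by apply: eq_Ec => x; rewrite mulrA.
by rewrite !E Ah.
Qed.

Let multD m n : mult m -> mult n -> mult (fun x => m x + n x).
Proof.
move=> Mm Mn h Ah; have [b1 A1] := Mm _ Ah; have [b2 A2] := Mn _ Ah; split.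
  rewrite (_ : (fun x => _) = (fun x => m x * h x + n x * h x)); first exact: bmD.
  by apply/funext => x; rewrite mulrDl.
move=> k Kk.
have E l : Ec l (fun x => (m x + n x) * h x * k x) =
    Ec l (fun x => m x * h x * k x) + Ec l (fun x => n x * h x * k x).
  rewrite -EcD; [|by apply: bmM => //; exact: K_bm|by apply: bmM => //; exact: K_bm].
  by apply: eq_Ec => x; rewrite !mulrDl.
by rewrite !E A1// A2.
Qed.

Let multM m n : mult m -> mult n -> mult (fun x => m x * n x).
Proof.
move=> Mm Mn h /Mn /Mm; congr A; by apply/funext => x; rewrite mulrA.
Qed.

Let multX m n : mult m -> mult (fun x => m x ^+ n).
Proof.
move=> Mm; elim: n => [|n IH]; first exact: (mult_cst 1).
rewrite (_ : (fun x => _) = (fun x => m x * m x ^+ n)); first exact: multM.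
by apply/funext => x; rewrite exprS.
Qed.

Let mult_lim (m_ : nat -> T -> R) (m : T -> R) : measurable_fun setT m ->
  (forall n, mult (fun x => (m_ n x)%:C%C)) ->
  (forall n x, 0 <= m_ n x <= 1) ->
  (forall x, m_ n x @[n --> \oo] --> m x) ->
  mult (fun x => (m x)%:C%C).
Proof.
move=> mm Mm m01 mc h Ah; have [bh _] := Ah.
have m01' x : 0 <= m x <= 1.
  apply/andP; split.
    by apply: (cvgr_to_ge (mc x)); apply: nearW => n; case/andP: (m01 n x).
  by apply: (cvgr_to_le (mc x)); apply: nearW => n; case/andP: (m01 n x).
have bmm : bm (fun x => (m x)%:C%C).
  split => /=; [exact: mm|exact: measurable_cst|].
  by exists 1 => x /=; rewrite normr0 ler01; have /andP[? ?] := m01' x; rewrite ger0_norm.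
split; first exact: bmM.
move=> k Kk; have bhk : bm (fun x => h x * k x) by apply: bmM => //; exact: K_bm.
have [_ _ [M hM]] := bhk.
apply: (@Ec_eq_lim R d T mu nu (fun n x => (m_ n x)%:C%C * h x * k x) _ M).
- by move=> n; apply: bmM; [case: (Mm n _ Ah)|exact: K_bm].
- by apply: bmM; [exact: bmM|exact: K_bm].
- move=> n x; rewrite -mulrA complexReZ complexImZ.
  have [h1 h2] := hM x; have /andP[m0 m1] := m01 n x.
  by split; rewrite normrM (ger0_norm m0) -[leRHS]mul1r ler_pM.
- move=> x; rewrite -mulrA complexReZ.
  under eq_fun do rewrite -mulrA complexReZ.
  exact: cvgMl.
- move=> x; rewrite -mulrA complexImZ.
  under eq_fun do rewrite -mulrA complexImZ.
  exact: cvgMl.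
- by move=> n; case: (Mm n _ Ah) => _; apply.
Qed.

Let good (D : set T) := measurable D /\ mult (fun x => (\1_D x : R)%:C%C).

(** An affine image of Re k, which is a combination of k and its conjugate, takes values in [0, 1]
    and sends the level c to 1/2; the threshold polynomials in it converge to the indicator. *)
Let good_halfspace k c : K k -> good [set x | complex.Re (k x) < c].
Proof.
move=> Kk; have [mk _ [M kM]] := K_bm Kk.
have mD : measurable [set x | complex.Re (k x) < c].
  rewrite -[X in measurable X]setTI.
  rewrite (_ : [set x | _] = (fun x => complex.Re (k x)) @^-1` `]-oo, c[%classic).
    exact: mk.
  by apply/seteqP; split => x /=; rewrite in_itv.
split => //.
have M0 : 0 <= M by apply: le_trans (normr_ge0 _) (proj1 (kM point)).
(* |Re k - c| is at most M + |c|, so that this slope keeps [X] within 1/2 of 1/2; the added 1 keeps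
   the denominator positive. *)
pose s := (2 * (M + `|c| + 1))^-1.
have s0 : 0 < s by rewrite invr_gt0 mulr_gt0// ltr_wpDl// addr_ge0.
pose X x : R := 2^-1 + (complex.Re (k x) - c) * s.
have X01 x : 0 <= X x <= 1.
  have H : `|(complex.Re (k x) - c) * s| <= 2^-1.
    rewrite normrM (gtr0_norm s0) -ler_pdivlMr// /s invrK mulrA mulVf// mul1r.
    rewrite (le_trans (ler_normB _ _))// (le_trans (lerD (proj1 (kM x)) (lexx _)))//.
    by rewrite lerDl.
  by move: H; rewrite ler_norml /X => /andP[? ?]; apply/andP; split; lra.
have MX : mult (fun x => (X x)%:C%C).
  rewrite (_ : (fun x => _) = (fun x => (2^-1 - c * s)%:C%C +
      (s / 2)%:C%C * (k x + (k x)^*))).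
    apply: multD; first exact: mult_cst.
    apply: multM; first exact: mult_cst.
    by apply: multD; apply: multK => //; exact: KJ.
  apply/funext => x; apply: complexP; rewrite ?complexReD ?complexImD
    ?complexReM ?complexImM ?complexReD ?complexImD ?complexReJ ?complexImJ /X /=; by field.
apply: (mult_lim (m_ := fun n x => threshold_pow (X x) n)
  (m := \1_[set x | complex.Re (k x) < c])).
- exact: measurable_indic.
- move=> n; rewrite /threshold_pow.
  rewrite (_ : (fun x => _) = (fun x => (1 + (-1) * (X x)%:C%C ^+ (n + n)) ^+ (4 ^ n * n))).
    apply: multX; apply: multD; first exact: mult_cst.
    by apply: multM; [exact: mult_cst|exact: multX].
  by apply/funext => x; rewrite mulN1r rmorphXn rmorphB rmorph1 rmorphXn.
- by move=> n x; exact: threshold_pow_itv.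
- move=> x; rewrite indicE (_ : (x \in _) = (X x < 2^-1)); first exact: threshold_pow_cvg.
  by rewrite /X gtrDl pmulr_llt0// subr_lt0; apply/idP/idP => [/set_mem//|?]; exact/mem_set.
Qed.

Let goodC D : good D -> good (~` D).
Proof.
move=> [mD MD]; split; first exact: measurableC.
rewrite (_ : (fun x => _) = (fun x => 1 + (-1) * (\1_D x)%:C%C)).
  apply: multD; first exact: (mult_cst 1).
  by apply: multM => //; exact: mult_cst.
apply/funext => x; rewrite !indicE in_setC mulN1r.
by case: (_ \in _); rewrite /= ?subr0 ?subrr.
Qed.

Let goodI D E : good D -> good E -> good (D `&` E).
Proof.
move=> [mD MD] [mE ME]; split; first exact: measurableI.
rewrite (_ : (fun x => _) = (fun x => (\1_D x)%:C%C * (\1_E x)%:C%C)); first exact: multM.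
apply/funext => x; rewrite !indicE in_setI -rmorphM.
by do 2 case: (_ \in _); rewrite /= ?mulr0 ?mulr1.
Qed.

Let goodT : good setT.
Proof.
split; first exact: measurableT.
rewrite (_ : (fun x => _) = (fun x => 1)); first exact: (mult_cst 1).
by apply/funext => x; rewrite indicT.
Qed.

Let goodU D E : good D -> good E -> good (D `|` E).
Proof.
by move=> /goodC GD /goodC GE; rewrite -[_ `|` _]setCK setCU; apply/goodC/goodI.
Qed.

Let good_bigcup (F : (set T)^nat) : (forall n, good (F n)) -> good (\bigcup_n F n).
Proof.
move=> GF; pose U n := \big[setU/set0]_(i < n) F i.
have GU n : good (U n).
  rewrite /U; elim: n => [|n IH]; first by rewrite big_ord0 -setCT; exact: goodC.
  by rewrite big_ord_recr /=; exact: goodU.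
have mF : measurable (\bigcup_n F n) by apply: bigcup_measurable => n _; case: (GF n).
split => //.
apply: (@mult_lim (fun n x => \1_(U n) x)).
- exact: measurable_indic.
- by move=> n; case: (GU n).
- by move=> n x; rewrite indicE; case: (_ \in _); rewrite /= ?lexx ?ler01.
- move=> x; rewrite indicE; have [xF|xF] := boolP (x \in \bigcup_n F n).
    have [n _ Fn] := set_mem xF.
    apply: cvg_near_cst; exists n.+1 => // m /= nm; apply/eqP.
    rewrite indicE mem_set//= /U -bigcup_mkord; exists n => //.
  apply: cvg_near_cst; apply: nearW => n; apply/eqP.
  rewrite indicE memNset// /U -bigcup_mkord => -[i _ Fi].
  by move/negP: xF; apply; apply/mem_set; exists i.
Qed.

Lemma cplx_expectation_unique :
  measurable `<=` <<s [set D | exists2 k, K k & exists c : R,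
    D = [set x | complex.Re (k x) < c]] >> ->
  forall E, measurable E -> mu E = nu E.
Proof.
move=> gen E mE.
have : good E.
  have := gen _ mE; move: E {mE}; apply: smallest_sub; last first.
    by move=> D [k Kk [c ->]]; exact: good_halfspace.
  split => //.
  - by rewrite -setCT; exact: goodC.
  - by move=> D GD; rewrite setTD; exact: goodC.
move=> [_ ME].
(* The indicator of E multiplies the constant 1, which is in [A]; the product is then tested against
   1 in [K]. *)
have A1 : A (fun=> 1).
  by split; [exact: bm_cst|move=> k Kk; under eq_Ec do rewrite mul1r; under [RHS]eq_Ec do rewrite mul1r; exact: K_eq].
have [_ /(_ _ K1)] := ME _ A1.
under eq_Ec do rewrite !mulr1; under [RHS]eq_Ec do rewrite !mulr1.
rewrite !Ec_indic// => -[].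
have fin (m : probability T R) : m E \is a fin_num by exact: fin_num_measure.
by move=> e; rewrite -[LHS]fineK// e fineK.
Qed.

End Uniqueness.

(** * The circle group *)

Section Cis.
Context {R : realType}.
Implicit Types (t : R) (z w : R[i]).

Lemma complexIm_norm_le z : `|complex.Im z|%:C%C <= `|z|.
Proof.
rewrite normc_def lecR -(sqrtr_sqr (complex.Im z)) ler_sqrt ?lerDr ?sqr_ge0//.
by rewrite addr_ge0// sqr_ge0.
Qed.

Lemma norm1_complexE z : `|z| = 1 <->
  complex.Re z ^+ 2 + complex.Im z ^+ 2 = 1.
Proof.
rewrite normc_def; set s := _ + _; split => [[] /(congr1 (fun x => x ^+ 2))|->].
  by rewrite sqr_sqrtr ?expr1n// addr_ge0// sqr_ge0.
by rewrite sqrtr1.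
Qed.

Lemma norm1_conjV z : `|z| = 1 -> z^-1 = z^*.
Proof.
by move=> z1; rewrite invC_norm z1 expr1n invr1 mul1r.
Qed.

Lemma norm1_ReIm z : `|z| = 1 -> `|complex.Re z| <= 1 /\ `|complex.Im z| <= 1.
Proof.
by move=> z1; have := normc_ge_Re z; have := complexIm_norm_le z; rewrite z1 !lecR.
Qed.

Lemma complex_ge0_Re (x : R[i]) : 0 < x -> x = (complex.Re x)%:C%C /\ 0 < complex.Re x.
Proof.
by case: x => a b; rewrite ltcE /= => /andP[/eqP -> ->].
Qed.

Lemma continuous_complexP (X : topologicalType) (f : X -> R[i]) :
  continuous (f : X -> R[i]^o) <->
  continuous (fun x => complex.Re (f x)) /\ continuous (fun x => complex.Im (f x)).
Proof.
split=> [cf|[cR cI]].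
  split=> x; apply/cvgrPdist_lt => e e0.
    have /cvgrPdist_lt/(_ e%:C%C) := cf x; rewrite ltcR => /(_ e0).
    apply: filterS => y /=; rewrite -ltcR; apply: le_lt_trans.
    by have := normc_ge_Re (f x - f y); case: (f x) (f y) => [? ?] [? ?].
  have /cvgrPdist_lt/(_ e%:C%C) := cf x; rewrite ltcR => /(_ e0).
  apply: filterS => y /=; rewrite -ltcR; apply: le_lt_trans.
  by have := complexIm_norm_le (f x - f y); case: (f x) (f y) => [? ?] [? ?].
move=> x; apply/cvgrPdist_lt => e /complex_ge0_Re[-> e0].
set r := complex.Re e in e0 *; have r2 : 0 < r / 2 by rewrite divr_gt0.
have /cvgrPdist_lt/(_ _ r2) HR := cR x; have /cvgrPdist_lt/(_ _ r2) HI := cI x.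
near=> y.
have yR : `|complex.Re (f x) - complex.Re (f y)| < r / 2 by near: y.
have yI : `|complex.Im (f x) - complex.Im (f y)| < r / 2 by near: y.
move: yR yI; case: (f x) (f y) => [a b] [c d] /=.
set u := a - c; set v := b - d => uR vR.
rewrite -/r normc_def ltcR /= -/u -/v -(ger0_norm (ltW e0)) -sqrtr_sqr ltr_sqrt ?exprn_gt0//.
have : `|u| ^+ 2 < (r / 2) ^+ 2 by rewrite ltrXn2r.
have : `|v| ^+ 2 < (r / 2) ^+ 2 by rewrite ltrXn2r.
rewrite !real_normK ?num_real//; have : 0 < r ^+ 2 by rewrite exprn_gt0.
rewrite exprMn; lra.
Unshelve. all: by end_near. Qed.

Definition cis t : R[i] := (cos (2 * pi * t) +i* sin (2 * pi * t))%C.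

Lemma cisD : {morph cis : s t / s + t >-> s * t}.
Proof.
move=> s t; apply: complexP; rewrite ?complexReM ?complexImM /= mulrDr.
  by rewrite cosD.
by rewrite sinD addrC.
Qed.

Lemma cis0 : cis 0 = 1.
Proof. by rewrite /cis mulr0 cos0 sin0. Qed.

Lemma norm_cis t : `|cis t| = 1.
Proof. by apply/norm1_complexE => /=; rewrite cos2Dsin2. Qed.

Lemma cis_neq0 t : cis t != 0.
Proof. by rewrite -normr_eq0 norm_cis oner_neq0. Qed.

Lemma cisN t : cis (- t) = (cis t)^-1.
Proof.
by apply: (mulfI (cis_neq0 t)); rewrite -cisD subrr cis0 mulfV// cis_neq0.
Qed.

Lemma cisMn t n : cis (t *+ n) = cis t ^+ n.
Proof.
elim: n => [|n IH]; first by rewrite mulr0n cis0 expr0.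
by rewrite mulrS cisD IH exprS.
Qed.

Lemma cis1 : cis 1 = 1.
Proof.
by rewrite /cis mulr1 mulr_natl cos2pi -(add0r (pi *+ 2)) sinD2pi sin0.
Qed.

Lemma cisMz t (m : int) : cis (t *~ m) = cis t ^ m.
Proof.
case: m => n; first by rewrite -pmulrn cisMn exprnP.
by rewrite NegzE mulrNz cisN -pmulrn cisMn.
Qed.

Lemma cis_int (m : int) : cis m%:~R = 1.
Proof. by rewrite cisMz cis1 exp1rz. Qed.

Lemma cisDint t (m : int) : cis (t + m%:~R) = cis t.
Proof. by rewrite cisD cis_int mulr1. Qed.

Lemma cis_reduce t : exists m : int, exists s, [/\ t = s + m%:~R, `|s| <= 2^-1 & cis t = cis s].
Proof.
exists (Num.floor (t + 2^-1)), (t - (Num.floor (t + 2^-1))%:~R); rewrite subrK; split => //.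
  have := floor_itv (t + 2^-1); set m := (Num.floor _)%:~R => /andP[h1 h2].
  rewrite ler_norml; apply/andP; split; last by move: h2; rewrite intrD -/m; lra.
  by lra.
by rewrite -[in LHS](subrK (Num.floor (t + 2^-1))%:~R t) cisDint.
Qed.

Let cos_normr (x : R) : cos `|x| = cos x.
Proof. by case: (ger0P x) => _; rewrite ?cosN. Qed.

Let pi2_itv s : `|s| <= 2^-1 -> `|2 * pi * s| \in (`[0, pi] : interval R).
Proof.
move=> s2; rewrite in_itv /= normr_ge0 /= !normrM gtr0_norm// (gtr0_norm (pi_gt0 R)).
by have := pi_gt0 R; nra.
Qed.

(** The cosine decreases on [0, pi], so that comparing cosines compares distances to the nearest
    integer. Cutting e at 1/2 keeps the angles in that range. *)
Lemma cis_near1 (e : R) : 0 < e -> exists2 d : R, 0 < d &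
  forall t, 1 - complex.Re (cis t) < d -> exists m : int, `|t - m%:~R| < e.
Proof.
move=> e0; pose e' := Num.min e 2^-1.
have e'0 : 0 < e' by rewrite lt_min e0 invr_gt0 ltr0n.
have e'2 : `|e'| <= 2^-1 by rewrite gtr0_norm// ge_min lexx orbT.
exists (1 - cos (2 * pi * e')).
  rewrite subr_gt0 -[X in _ < X]cos0 -(cos_normr (_ * e')) ltr_cos ?pi2_itv//.
    by rewrite !normrM !mulr_gt0 ?normr_gt0 ?gt_eqF// pi_gt0.
  by rewrite in_itv /= lexx pi_ge0.
move=> t; have [m [s [-> s2 ->]]] := cis_reduce t.
rewrite /= ltrD2l ltrN2 -(cos_normr (_ * s)) -(cos_normr (_ * e')).
rewrite ltr_cos ?pi2_itv// !normrM ltr_pM2l; last first.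
  by rewrite mulr_gt0 ?normr_gt0 ?gt_eqF// pi_gt0.
rewrite (gtr0_norm e'0) => se; exists m; rewrite addrK (lt_le_trans se)//.
by rewrite ge_min lexx.
Qed.

Lemma cis_eq1 t : cis t = 1 -> exists m : int, t = m%:~R.
Proof.
have [m [s [-> s2 ->]]] := cis_reduce t => -[c1 _].
exists m; suff -> : s = 0 by rewrite add0r.
have : `|2 * pi * s| = 0.
  apply: (@cos_inj R); rewrite ?pi2_itv// ?in_itv /= ?lexx ?pi_ge0//.
  by rewrite cos_normr c1 cos0.
move/eqP; rewrite normr_eq0 !mulf_eq0 pnatr_eq0/= => /orP[|/eqP//].
by rewrite gt_eqF// pi_gt0.
Qed.

Lemma cis_surj z : `|z| = 1 -> exists t, z = cis t.
Proof.
case: z => a b /norm1_complexE /= ab1.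
have pi0 : 2 * pi != 0 :> R by rewrite mulf_neq0// gt_eqF// pi_gt0.
have a1 : -1 <= a <= 1.
  rewrite -ler_norml -(ler_sqr (normr_ge0 _))// ?nnegrE// expr1n real_normK ?num_real//.
  by rewrite -ab1 lerDl sqr_ge0.
have [th1 ca] := acos_def a1.
have sb : sin (acos a) ^+ 2 = b ^+ 2.
  by rewrite sin2cos2 ca -ab1 addrC addKr.
have [/eqP sb'|sb'] := eqVneq (sin (acos a)) b.
  exists (acos a / (2 * pi)); rewrite /cis mulrCA mulfV// mulr1 ca.
  by move/eqP: sb' => ->.
exists (- (acos a / (2 * pi))); rewrite /cis mulrN mulrCA mulfV// mulr1 cosN sinN ca.
move/eqP: sb; rewrite eqf_sqr (negbTE sb')/= => /eqP ->; by rewrite opprK.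
Qed.

Lemma continuous_cos2pi (c : R) : continuous (fun t => cos (c * t)).
Proof.
move=> t; apply: (@continuous_comp _ _ _ (fun t => c * t) cos); last exact: continuous_cos.
by apply: cvgMr; exact: cvg_id.
Qed.

Lemma continuous_cis : continuous (cis : R -> R[i]^o).
Proof.
apply/continuous_complexP; split=> /= t.
  exact: continuous_cos2pi.
apply: (@continuous_comp _ _ _ (fun t => 2 * pi * t) sin); last exact: continuous_sin.
by apply: cvgMr; exact: cvg_id.
Qed.

(* Doubling the argument at least doubles [1 - Re z] as long as [Re z > 0]. *)
Lemma no_small_subgroup z : `|z| = 1 ->
  (forall k, 0 < complex.Re (z ^+ (2 ^ k))) -> z = 1.
Proof.
move=> z1 zk.
have nz k : `|z ^+ (2 ^ k)| = 1 by rewrite normrX z1 expr1n.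
have step k : 2 ^+ k * (1 - complex.Re z) <= 1 - complex.Re (z ^+ (2 ^ k)).
  elim: k => [|k IH]; first by rewrite expr0 mul1r expn0 expr1.
  have := zk k; rewrite expnSr exprM expr2; set w := z ^+ (2 ^ k) in IH *.
  rewrite complexReM => w0; have /norm1_complexE := nz k; rewrite -/w.
  have [w1 _] := norm1_ReIm (nz k); rewrite -/w in w1.
  have {w1} : complex.Re w <= 1 by apply: le_trans (ler_norm _) w1.
  rewrite [2 ^+ k.+1]exprS -mulrA; move: IH w0; set u := complex.Re w; set v := complex.Im w.
  by set s := 2 ^+ k * _; nra.
have Re1 : complex.Re z = 1.
  apply/eqP; rewrite eq_le; apply/andP; split.
    by apply: le_trans (ler_norm _) _; case: (norm1_ReIm z1).
  rewrite leNgt; apply/negP => zlt; pose d := 1 - complex.Re z.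
  have d0 : 0 < d by rewrite subr_gt0.
  pose n := Num.bound d^-1.
  have : d^-1 < n%:R.
    by apply: archi_boundP; rewrite invr_ge0 ltW.
  move=> dn; have : d^-1 < 2 ^+ n.
    apply: (lt_trans dn); rewrite -natrX ltr_nat; exact: ltn_expl.
  rewrite -[X in X < _ -> _]mul1r ltr_pdivrMr// => H.
  have := step n; rewrite -/d; have := zk n; lra.
apply: complexP => //=; apply/eqP; rewrite -sqrf_eq0.
by have /norm1_complexE := z1; rewrite Re1 expr1n => /(canRL (addKr _)) ->; rewrite addNr.
Qed.

End Cis.

Section DyadicRoots.
Context {R : realType}.
Implicit Types t : R.

Lemma cis_Re_gt0 t : `|t| <= 2^-1 -> 0 < complex.Re (cis t) -> `|t| < 4^-1.
Proof.
move=> t2 /= c0; have pi0 := pi_gt0 R.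
have c0' : 0 < cos (2 * pi * `|t|).
  by move: c0; case: (ger0P t) => // _; rewrite mulrN cosN.
rewrite ltNge; apply/negP => t4; move: c0'; apply/negP; rewrite -leNgt -(@cos_pihalf R).
rewrite leNgt ltr_cos ?in_itv /=; first by rewrite -leNgt; nra.
all: by apply/andP; split; nra.
Qed.

(** Of two opposite square roots at most one has positive real part, so that the first root in the
    right half-plane determines all later ones. This replaces a logarithm when characters of the
    line are identified. *)
Lemma dyadic_roots (G : nat -> R[i]) K : (forall j, `|G j| = 1) -> G 0 = 1 ->
  (forall j, G j = G j.+1 ^+ 2) ->
  (forall j, (K <= j)%N -> 0 < complex.Re (G j)) ->
  exists m : int, forall j, (K <= j)%N -> G j = cis (m%:~R / 2 ^+ j).
Proof.
move=> G1 G0 GS Gpos.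
have arg j : (K <= j)%N -> exists2 t, G j = cis t & `|t| < 4^-1.
  move=> Kj; have [t Et] := cis_surj (G1 j); have [k [s [_ s2 Es]]] := cis_reduce t.
  exists s; first by rewrite Et.
  by apply: cis_Re_gt0 => //; rewrite -Es -Et Gpos.
have Gpow j : G j ^+ (2 ^ j) = 1.
  elim: j => [|j IH]; first by rewrite expn0 expr1.
  by rewrite expnS exprM -GS.
have p2 j : 2 ^+ j != 0 :> R by rewrite expf_neq0.
have [t Et t4] := arg K (leqnn K).
have [m Em] : exists m : int, t *+ (2 ^ K) = m%:~R.
  by apply: cis_eq1; rewrite cisMn -Et.
have {Em} Em : t = m%:~R / 2 ^+ K.
  by rewrite -Em -[t *+ _]mulr_natr natrX mulfK.
exists m; suff H i : G (K + i)%N = cis (m%:~R / 2 ^+ (K + i)) /\ `|m%:~R / 2 ^+ (K + i) : R| < 4^-1.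
  by move=> j Kj; have [] := H (j - K)%N; rewrite subnKC.
elim: i => [|i [IH1 IH2]]; first by rewrite addn0 -Em.
rewrite addnS; have [s Es s4] := arg (K + i).+1 (leqW (leq_addr _ _)).
(* Twice the new argument and the old argument agree modulo 1. The former is below 1/2 and the
   latter below 1/4 in modulus, so the integer by which they differ is 0. *)
have [k Ek] : exists k : int, s *+ 2 - m%:~R / 2 ^+ (K + i) = k%:~R.
  apply: cis_eq1; rewrite cisD cisN cisMn -Es -GS -IH1 mulfV// -normr_eq0 G1.
  exact: oner_neq0.
have k0 : k = 0.
  have : `|k%:~R : R| < 1.
    rewrite -Ek (le_lt_trans (ler_normB _ _))// normrMn.
    by move: s4 IH2; set u := `|s|; set v := `| _ |; rewrite -mulr_natr; lra.
  by rewrite -intr_norm -[1]/(1%:~R) ltr_int; lia.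
have Es' : m%:~R / 2 ^+ (K + i).+1 = s.
  move: Ek; rewrite k0 => /eqP; rewrite subr_eq0 => /eqP Ek.
  by rewrite exprSr invfM mulrA -Ek -[s *+ 2]mulr_natr mulfK.
by rewrite Es' -Es.
Qed.

End DyadicRoots.

Section DualGroup.
Context {R : realType} {X : topologicalZmodType}.
Implicit Types (y z : dual R X) (x : X).

Lemma dual_norm y x : `|y x| = 1. Proof. by have [_ ->] := dualP y. Qed.

Lemma dual_neq0 y x : y x != 0.
Proof. by rewrite -normr_eq0 dual_norm oner_neq0. Qed.

Lemma dual_morphD y : {morph y : x x' / x + x' >-> x * x'}.
Proof. by have [_ _] := dualP y. Qed.

Lemma dual_morph0 y : y 0 = 1.
Proof. by apply: (mulfI (dual_neq0 y 0)); rewrite -dual_morphD addr0 mulr1. Qed.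

Lemma dual_morphN y x : y (- x) = (y x)^-1.
Proof.
by apply: (mulfI (dual_neq0 y x)); rewrite -dual_morphD subrr dual_morph0 mulfV// dual_neq0.
Qed.

Lemma dual_morphMn y x n : y (x *+ n) = y x ^+ n.
Proof.
by elim: n => [|n IH]; rewrite ?mulr0n ?dual_morph0// mulrS dual_morphD IH exprS.
Qed.

Lemma dual_morphMz y x (m : int) : y (x *~ m) = y x ^ m.
Proof.
case: m => n; first by rewrite -pmulrn dual_morphMn.
by rewrite NegzE mulrNz dual_morphN -pmulrn dual_morphMn.
Qed.

Lemma dual0E x : (0 : dual R X) x = 1. Proof. by []. Qed.

Lemma dualDE y z x : (y + z) x = y x * z x. Proof. by []. Qed.

Lemma dualNE y x : (- y) x = (y x)^-1. Proof. by []. Qed.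

Lemma dualMnE y n x : (y *+ n) x = y x ^+ n.
Proof. by elim: n => [|n IH]; rewrite ?mulr0n// mulrS dualDE IH exprS. Qed.

Lemma dualMzE y (m : int) x : (y *~ m) x = y x ^ m.
Proof.
case: m => n; first by rewrite -pmulrn dualMnE.
by rewrite NegzE mulrNz dualNE -pmulrn dualMnE.
Qed.

Lemma dual_eqP y z : (forall x, y x = z x) -> y = z.
Proof. by move=> yz; apply/dual_ext/funext. Qed.

Lemma dual_continuous y : continuous (fun x => complex.Re (y x)) /\
  continuous (fun x => complex.Im (y x)).
Proof. by apply/continuous_complexP; have [] := dualP y. Qed.

Lemma dual_Re_gt0_near0 y : \forall x \near (0 : X), 0 < complex.Re (y x).
Proof.
have [cR _] := dual_continuous y.
have c0 : complex.Re (y x) @[x --> (0 : X)] --> (1 : R).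
  by rewrite -[X in _ --> X]/(complex.Re (1 : R[i])) -(dual_morph0 y); exact: cR.
by apply: (cvgr_gt _ c0); exact: ltr01.
Qed.

End DualGroup.

(** * Characters and topology of the solenoid *)

Section SolenoidCharacters.
Context {R : realType} {a : nat -> nat} {ha : forall n, (1 < a n)%N}.
Local Notation Delta := (adic ha).
Local Notation X := (solenoid R ha).
Local Notation cover := (Defs.cover R ha).
Local Notation pi_ := (@solenoid_pi R a ha).
Local Notation base := (@adic_base a).
Local Notation trunc := (@adic_trunc a ha).
Local Notation u := (@adic_unit a ha : Delta).

Lemma adic_trunc_eq_digits (d e : Delta) n : trunc d n = trunc e n ->
  forall k, (k < n)%N -> d k = e k.
Proof.
elim: n => // n IH; rewrite !adic_truncS => E k.
have b0 := adic_base_gt0 (ha := ha) n.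
have T : trunc d n = trunc e n.
  have := congr1 (modn^~ (base n)) E.
  by rewrite /= ![(trunc _ n + _)%N]addnC !modnMDl !modn_small ?adic_trunc_lt.
rewrite ltnS leq_eqVlt => /orP[/eqP ->|]; last exact: IH.
apply/val_inj; move: E; rewrite T => /addnI /eqP.
by rewrite eqn_pmul2r// => /eqP.
Qed.

Lemma adic_digits_eq_trunc (d e : Delta) n :
  (forall k, (k < n)%N -> d k = e k) -> trunc d n = trunc e n.
Proof. by move=> de; apply: eq_bigr => k _; rewrite /digit de. Qed.

Lemma adic_nbhs (d : Delta) (V : set Delta) : nbhs d V ->
  exists n, forall e, (forall k, (k < n)%N -> e k = d k) -> V e.
Proof.
pose F := filter_from [set: nat] (fun n => [set e : Delta | forall k, (k < n)%N -> e k = d k]).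
have FF : Filter F.
  apply: filter_from_filter; first by exists 0%N.
  move=> i j _ _; exists (maxn i j) => // e /= He; split=> k kn; apply: He.
    by rewrite (leq_trans kn)// leq_maxl.
  by rewrite (leq_trans kn)// leq_maxr.
have Fd : F --> d.
  apply/cvg_sup => n U [W [[S _ <-] St] SU].
  by exists n.+1 => // e /= He; apply: SU => /=; rewrite He.
by move=> /Fd [n _ H]; exists n.
Qed.

Lemma solenoid_pi0 : pi_ 0 = 0.
Proof. by rewrite -(subrr (0 : cover)) solenoid_piB subrr. Qed.

Lemma solenoid_piN z : pi_ (- z) = - pi_ z.
Proof. by rewrite -sub0r solenoid_piB solenoid_pi0 sub0r. Qed.

Lemma solenoid_piD : {morph pi_ : z w / z + w}.
Proof. by move=> z w; rewrite -[w in LHS]opprK solenoid_piB solenoid_piN opprK. Qed.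

Lemma solenoid_piMn z n : pi_ (z *+ n) = pi_ z *+ n.
Proof.
by elim: n => [|n IH]; rewrite ?mulr0n ?solenoid_pi0// !mulrS solenoid_piD IH.
Qed.

Lemma solenoid_piMz z (m : int) : pi_ (z *~ m) = pi_ z *~ m.
Proof.
case: m => n; first by rewrite -!pmulrn solenoid_piMn.
by rewrite !NegzE !mulrNz solenoid_piN -!pmulrn solenoid_piMn.
Qed.

Lemma solenoid_pi_surj (x : X) : exists z, pi_ z = x.
Proof. by exists (repr x); exact: reprK. Qed.

Lemma cover_pairMz (t : R) (d : Delta) (m : int) :
  ((t, d) : cover) *~ m = (t *~ m, d *~ m).
Proof.
have Mn n : ((t, d) : cover) *+ n = (t *+ n, d *+ n).
  by elim: n => [|n IH]; rewrite ?mulr0n// !mulrS IH.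
case: m => n; first by rewrite -!pmulrn Mn.
by rewrite !NegzE !mulrNz -!pmulrn Mn.
Qed.

Lemma solenoid_pi_winding (j : int) : pi_ (j%:~R, u *~ j) = 0.
Proof.
have := @solenoid_piB R a ha (j%:~R, u *~ j) 0; rewrite subr0 solenoid_pi0 subr0 => _.
rewrite -solenoid_pi0; apply/eqP; rewrite /solenoid_pi -Quotient.idealrBE subr0.
by apply/asboolP; exists j.
Qed.

Lemma solenoid_pi_shift (j : int) (t : R) (d : Delta) :
  pi_ (t - j%:~R, d - u *~ j) = pi_ (t, d).
Proof.
have := @solenoid_piB R a ha (t, d) (j%:~R, u *~ j).
by rewrite solenoid_pi_winding subr0.
Qed.

Lemma solenoid_pi_split (t : R) (d : Delta) : pi_ (t, d) = pi_ (t, 0) + pi_ (0, d).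
Proof.
rewrite -solenoid_piD; congr (pi_ _); rewrite /GRing.add /=.
by congr pair; rewrite ?addr0 ?add0r.
Qed.

(** Triviality need only be checked at the generator [(1, u)] of B. Continuity descends because a
    set of the solenoid is open exactly when its preimage is. *)
Lemma solenoid_char_lift (c : cover -> R[i]) :
  continuous (c : cover -> R[i]^o) -> (forall z, `|c z| = 1) ->
  {morph c : z w / z + w >-> z * w} -> c (1, u) = 1 ->
  exists y : dual R X, forall z, y (pi_ z) = c z.
Proof.
move=> cc c1 cD cu.
have cn0 z : c z != 0 by rewrite -normr_eq0 c1 oner_neq0.
have c0 : c 0 = 1 by apply: (mulfI (cn0 0)); rewrite -cD addr0 mulr1.
have cN z : c (- z) = (c z)^-1.
  by apply: (mulfI (cn0 z)); rewrite -cD subrr c0 mulfV.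
have cMn z n : c (z *+ n) = c z ^+ n.
  by elim: n => [|n IH]; rewrite ?mulr0n// mulrS cD IH exprS.
have cw (w : cover) : w \in @winding R a ha -> c w = 1.
  move=> /asboolP[j ->]; rewrite -cover_pairMz.
  case: j => n; first by rewrite -pmulrn cMn cu expr1n.
  by rewrite NegzE mulrNz -pmulrn cN cMn cu expr1n invr1.
pose f (x : X) := c (repr x).
have fE z : f (pi_ z) = c z.
  have : pi_ (repr (pi_ z)) = pi_ z by exact: reprK.
  move=> /eqP; rewrite /solenoid_pi -Quotient.idealrBE => /cw.
  by rewrite cD cN => /(congr1 (fun v => v * c z)); rewrite mulfVK// mul1r.
suff fP : is_character f by exists (Dual fP).
split.
- apply/continuousP => U oU.
  have -> : open (f @^-1` U) = open (pi_ @^-1` (f @^-1` U)) by [].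
  rewrite (_ : _ @^-1` _ = c @^-1` U); last first.
    by apply/seteqP; split => z /=; rewrite fE.
  by move/continuousP : cc; apply.
- by move=> x; exact: c1.
- move=> x x'; have [z <-] := solenoid_pi_surj x; have [w <-] := solenoid_pi_surj x'.
  by rewrite -solenoid_piD !fE cD.
Qed.

(** The phase of the character of index 1 / (a_0 ... a_(n-1)) in H_a, of index 1 for n = 0. Addition
    with carry changes the truncation by a multiple of the base, hence the phase by an integer. *)
Definition level_phase n (z : cover) : R := (z.1 - (trunc z.2 n)%:R) / (base n)%:R.

Lemma adic_baseR_gt0 n : 0 < (base n)%:R :> R.
Proof. by rewrite ltr0n (adic_base_gt0 (ha := ha)). Qed.

Lemma adic_baseR_neq0 n : (base n)%:R != 0 :> R.
Proof. by rewrite gt_eqF// adic_baseR_gt0. Qed.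

Let phaseD n z w : cis (level_phase n (z + w)) = cis (level_phase n z) * cis (level_phase n w).
Proof.
rewrite -cisD; have -> : level_phase n (z + w) = level_phase n z + level_phase n w +
    ((trunc z.2 n + trunc w.2 n) %/ base n)%:Z%:~R.
  rewrite -pmulrn /level_phase /= -mulrDl -[X in _ = _ + X](mulfK (adic_baseR_neq0 n)) -mulrDl.
  congr (_ / _); have := divn_eq (trunc z.2 n + trunc w.2 n) (base n).
  rewrite -(adic_truncD z.2 w.2) => /(congr1 (fun k => k%:R : R)).
  rewrite natrD [in X in _ = X -> _]natrD natrM.
  rewrite (_ : adic_add z.2 w.2 = z.2 + w.2)//.
  by set A := (trunc z.2 n)%:R; set B := (trunc w.2 n)%:R; lra.
by rewrite cisDint.
Qed.

Let phase_winding n : cis (level_phase n (1, u)) = 1.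
Proof.
case: n => [|n]; rewrite /level_phase /=.
  by rewrite /adic_trunc /adic_base !big_ord0 subr0 divr1 cis1.
by rewrite adic_trunc_unit subrr mul0r cis0.
Qed.

Let phase_continuous n : continuous ((fun z => cis (level_phase n z)) : cover -> R[i]^o).
Proof.
move=> z; apply: (@continuous_comp _ _ _ (level_phase n) (cis : R -> R[i]^o)); last exact: continuous_cis.
apply: cvgMl; apply: cvgB.
  exact: (@cvg_fst _ _ (nbhs z.1) (nbhs z.2)).
apply: cvg_near_cst.
exists (setT, [set e | forall k, (k < n)%N -> e k = z.2 k]) => /=.
  by split; [exact: filterT|exact: near_adicn].
by move=> [s e] [_ /= He]; rewrite /= (adic_digits_eq_trunc He).
Qed.

Lemma level_char_subproof n :
  {y : dual R X | forall z, y (pi_ z) = cis (level_phase n z)}.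
Proof.
apply: cid; apply: solenoid_char_lift.
- exact: phase_continuous.
- by move=> z; exact: norm_cis.
- by move=> z w; exact: phaseD.
- exact: phase_winding.
Qed.

Definition level_char n : dual R X := sval (level_char_subproof n).

Lemma level_charE n z : level_char n (pi_ z) = cis (level_phase n z).
Proof. exact: (svalP (level_char_subproof n)). Qed.

(** Multiplying the phase of level n + 1 by a_n gives the phase of level n up to the n-th digit, an
    integer. Hence the cyclic groups generated by the levels increase. *)
Lemma level_charS n : level_char n = level_char n.+1 *+ a n.
Proof.
apply: dual_eqP => x; have [z <-] := solenoid_pi_surj x.
rewrite dualMnE !level_charE -cisMn.
have -> : level_phase n.+1 z *+ a n = level_phase n z + (- (digit z.2 n)%:Z)%:~R.
  rewrite /level_phase adic_truncS adic_baseS !natrD !natrM -mulr_natr mulrNz -pmulrn.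
  have a0 : (a n)%:R != 0 :> R by rewrite pnatr_eq0 -lt0n (ltnW (ha n)).
  have b0 := adic_baseR_neq0 n.
  by field; rewrite b0 a0.
by rewrite cisDint.
Qed.

(** The truncation of [u *~ j] is not computed: (0, d) and (- j, d - j u) have the same image, so
    [level_char n] makes the truncation of d - j u a multiple of the base, and it is smaller than
    the base. *)
Lemma trunc_shift_eq0 (d : Delta) (j : int) n k :
  (trunc d n)%:R = j%:~R + k%:~R * (base n)%:R :> R ->
  trunc (d - u *~ j) n = 0%N.
Proof.
move=> E; have := level_charE n (0 - j%:~R, d - u *~ j).
rewrite solenoid_pi_shift level_charE => /eqP.
have b0 := adic_baseR_neq0 n.
set e := d - u *~ j; rewrite -subr_eq0 => /eqP H.
have : cis (level_phase n (0, d) - level_phase n (0 - j%:~R, e)) = 1.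
  by rewrite cisD cisN (subr0_eq H) mulfV// cis_neq0.
move=> /cis_eq1[m]; rewrite /level_phase /= E.
have -> : (0 - (j%:~R + k%:~R * (base n)%:R)) / (base n)%:R -
   (0 - j%:~R - (trunc e n)%:R) / (base n)%:R = (trunc e n)%:R / (base n)%:R - k%:~R :> R.
  by field.
move/eqP; rewrite subr_eq -intrD => /eqP H2.
have : (trunc e n)%:R = ((m + k) * (base n)%:Z)%:~R :> R.
  by rewrite intrM -H2 -pmulrn divfK.
rewrite pmulrn => /eqP; rewrite eqr_int => /eqP H3.
have := adic_trunc_lt e n; move: H3; set T := trunc e n; set B := base n.
move: (m + k) => i; have : (i <= 0) || (1 <= i) by lia.
by case/orP => ?; nia.
Qed.

(** A single character controls both coordinates: when it is near 1, some representative has n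
    vanishing digits and a small real coordinate. *)
Lemma solenoid_nbhs_level (U : set X) (x0 : X) : open U -> U x0 ->
  exists n, exists2 e : R, 0 < e &
    forall w, 1 - complex.Re (level_char n w) < e -> U (x0 + w).
Proof.
move=> oU Ux0; have [[t d] tdx0] := solenoid_pi_surj x0.
have : nbhs ((t, d) : cover) (pi_ @^-1` U).
  by apply: solenoid_pi_continuous; rewrite tdx0; apply: open_nbhs_nbhs.
move=> [[P Q] /= [/nbhs_ballP[e /= e0 tP] /adic_nbhs[n dQ]] PQU].
have [e' e'0 He'] := @cis_near1 R (e / (base n)%:R) (divr_gt0 e0 (adic_baseR_gt0 n)).
exists n, e' => // w; have [[s f] <-] := solenoid_pi_surj w.
rewrite level_charE => /He'[k]; rewrite /level_phase /= => Hk.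
(* Subtracting this element of the winding subgroup clears the first n digits and brings the real
   coordinate within e of 0 at the same time. *)
pose j : int := (trunc f n)%:Z + k * (base n)%:Z.
have f0 : trunc (f - u *~ j) n = 0%N.
  apply: (trunc_shift_eq0 (k := - k)).
  by rewrite /j intrD intrM -!pmulrn mulrNz mulNr addrK.
rewrite -(solenoid_pi_shift j s f) -tdx0 -solenoid_piD.
apply: (PQU (t + (s - j%:~R), d + (f - u *~ j))); split => /=.
  apply: tP; rewrite /ball /= opprD addrA subrr add0r normrN.
  rewrite /j intrD intrM -!pmulrn; move: Hk.
  rewrite -(ltr_pM2r (adic_baseR_gt0 n)) divfK ?adic_baseR_neq0//.
  rewrite -[X in _ * X < _ -> _](gtr0_norm (adic_baseR_gt0 n)) -normrM mulrBl divfK ?adic_baseR_neq0//.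
  by rewrite opprD addrA.
apply: dQ; apply: adic_trunc_eq_digits.
rewrite (_ : d + _ = adic_add d (f - u *~ j))// adic_truncD f0 addn0.
by rewrite modn_small// adic_trunc_lt.
Qed.

Lemma level_char_pi0 n (d : Delta) (m : int) :
  trunc d n = 0%N -> (level_char n *~ m) (pi_ (0, d)) = 1.
Proof.
by move=> d0; rewrite dualMzE level_charE /level_phase /= d0 subrr mul0r cis0 exp1rz.
Qed.

Let split_level n (t : R) (d : Delta) :
  exists s e, [/\ pi_ (t, d) = pi_ (s, 0) + pi_ (0, e) & trunc e n = 0%N].
Proof.
exists (t - (trunc d n)%:Z%:~R), (d - u *~ (trunc d n)%:Z); split.
  by rewrite -solenoid_pi_split solenoid_pi_shift.
by apply: (trunc_shift_eq0 (k := 0)); rewrite mul0r addr0 -pmulrn.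
Qed.

Let pi_realMz (t : R) (m : int) : pi_ (t *~ m, 0) = pi_ (t, 0) *~ m.
Proof. by rewrite -solenoid_piMz cover_pairMz mul0rz. Qed.

Let pi_realMn (t : R) m : pi_ (t *+ m, 0) = pi_ (t, 0) *+ m.
Proof. by rewrite !pmulrn pi_realMz. Qed.

Let pi_realD (s t : R) : pi_ (s + t, 0) = pi_ (s, 0) + pi_ (t, 0).
Proof. by rewrite -solenoid_piD; congr (pi_ _); rewrite /GRing.add /=; congr pair; rewrite addr0. Qed.

(** Near 0 the real part of y is positive, in particular on the subgroup of adic elements with n
    vanishing digits, where y is therefore trivial. Its values at dyadic fractions of [base n] on
    the line form a system for [dyadic_roots], which yields m; the rest is to show that y - m
    [level_char n] vanishes. *)
Lemma dual_classification (y : dual R X) : exists n (m : int), y = level_char n *~ m.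
Proof.
have split0 : forall y : dual R X, exists n (e : R), [/\ 0 < e,
    forall t, `|t| < e -> 0 < complex.Re (y (pi_ (t, 0))) &
    forall d, trunc d n = 0%N -> 0 < complex.Re (y (pi_ (0, d)))].
  move=> {}y; have : nbhs ((0, 0) : cover) (pi_ @^-1` [set x | 0 < complex.Re (y x)]).
    by apply: solenoid_pi_continuous; rewrite solenoid_pi0; exact: (@dual_Re_gt0_near0 R X y).
  move=> [[P Q] /= [/nbhs_ballP[e /= e0 tP] /adic_nbhs[n dQ]] PQU].
  exists n, e; split => // [t te|d d0].
    apply: (PQU (t, 0)); split => /=; first by apply: tP; rewrite /ball /= sub0r normrN.
    exact: dQ.
  apply: (PQU (0, d)); split => /=; first by apply: tP; exact: ballxx.
  by apply/dQ/adic_trunc_eq_digits; rewrite d0 adic_trunc0.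
have [n [e [e0 ye yd]]] := split0 y.
have yd1 d : trunc d n = 0%N -> y (pi_ (0, d)) = 1.
  move=> d0; apply: no_small_subgroup; first exact: dual_norm.
  move=> k; rewrite -dual_morphMn -solenoid_piMn pmulrn cover_pairMz mul0rz -pmulrn.
  apply: yd; elim: (2 ^ k)%N => [|m IH]; first by rewrite mulr0n adic_trunc0.
  rewrite mulrS (_ : d + _ = adic_add d (d *+ m))// adic_truncD d0 IH.
  by rewrite addn0 mod0n.
pose G j := y (pi_ ((base n)%:R / 2 ^+ j, 0)).
have [K HK] : exists K, forall j, (K <= j)%N -> (base n)%:R / 2 ^+ j < e.
  exists (Num.bound ((base n)%:R / e)) => j Kj.
  rewrite ltr_pdivrMr ?exprn_gt0// mulrC -ltr_pdivrMr//.
  have : (base n)%:R / e < (Num.bound ((base n)%:R / e : R))%:R :> R.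
    by apply: archi_boundP; rewrite divr_ge0// ltW.
  move/lt_le_trans; apply; rewrite -natrX ler_nat (leq_trans Kj)//.
  by rewrite ltnW// ltn_expl.
(* (base, 0) and (0, - base u) have the same image, and the latter has n vanishing digits. *)
have baseW : y (pi_ ((base n)%:R, 0)) = 1.
  rewrite -(solenoid_pi_shift (base n)%:Z) -pmulrn subrr; apply: yd1.
  apply: (trunc_shift_eq0 (k := -1)).
  by rewrite adic_trunc0 -pmulrn mulN1r subrr.
have [||||m Hm] := @dyadic_roots R G K.
- by move=> j; exact: dual_norm.
- by rewrite /G expr0 divr1.
- move=> j; rewrite /G -dual_morphMn -pi_realMn.
  congr (y (pi_ (_, _))); rewrite exprS -mulr_natr; field.
  by rewrite expf_neq0.
- move=> j Kj; apply: ye; rewrite ger0_norm ?HK// divr_ge0// exprn_ge0//.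
exists n, m; apply/eqP; rewrite -subr_eq0; apply/eqP.
set y' := y - _; have y'G j : (K <= j)%N -> y' (pi_ ((base n)%:R / 2 ^+ j, 0)) = 1.
  move=> Kj; rewrite /y' dualDE dualNE -/(G j) Hm// dualMzE level_charE -cisMz.
  rewrite /level_phase /= adic_trunc0 subr0 -mulrA mulrCA mulfV ?adic_baseR_neq0// mulr1.
  by rewrite -[2 ^- j *~ m]mulrzr [2 ^- j * _]mulrC mulfV// cis_neq0.
have y'd d : trunc d n = 0%N -> y' (pi_ (0, d)) = 1.
  by move=> d0; rewrite /y' dualDE dualNE level_char_pi0// yd1// mul1r invr1.
have [n' [e' [e'0 y'e _]]] := split0 y'.
(* Up to a multiple of a fine dyadic step v, where y' is 1, each s is a remainder smaller than e',
   where y' has positive real part; thus no power of the value at t leaves the right half-plane. *)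
have y't t : y' (pi_ (t, 0)) = 1.
  apply: no_small_subgroup; first exact: dual_norm.
  move=> k; rewrite -dual_morphMn pmulrn -pi_realMz; set s := t *~ _.
  have [j Kj He'] : exists2 j, (K <= j)%N & (base n)%:R / 2 ^+ j < e'.
    exists (K + Num.bound ((base n)%:R / e'))%N; first exact: leq_addr.
    rewrite ltr_pdivrMr ?exprn_gt0// mulrC -ltr_pdivrMr//.
    have : (base n)%:R / e' < (Num.bound ((base n)%:R / e' : R))%:R :> R.
      by apply: archi_boundP; rewrite divr_ge0// ltW.
    move/lt_le_trans; apply; rewrite -natrX ler_nat.
    by rewrite (leq_trans (leq_addl K _))// ltnW// ltn_expl.
  set v : R := (base n)%:R / 2 ^+ j in He'.
  have v0 : 0 < v by rewrite divr_gt0 ?adic_baseR_gt0// exprn_gt0.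
  have -> : s = v *~ Num.floor (s / v) + (s - v *~ Num.floor (s / v)) by rewrite addrC subrK.
  rewrite pi_realD dual_morphD pi_realMz dual_morphMz y'G// exp1rz mul1r.
  apply: y'e; have := floor_itv (s / v); rewrite intrD => /andP[].
  rewrite ler_pdivlMr// ltr_pdivrMr// mulrDl mul1r mulrC mulrzr => h1 h2.
  by rewrite ger0_norm ?subr_ge0// (lt_trans _ He')// ltrBlDr addrC.
apply: dual_eqP => x; have [[t d] <-] := solenoid_pi_surj x.
have [s [f [-> f0]]] := split_level n t d.
by rewrite dual_morphD y't y'd// mulr1.
Qed.

(** Level 0 makes the real coordinate an integer j; after a shift by j all truncations of the adic
    coordinate vanish. *)
Lemma level_char_separates (x : X) : (forall n, level_char n x = 1) -> x = 0.
Proof.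
move=> x1; have [[t d] tdx] := solenoid_pi_surj x.
have E n : exists k : int, t - (trunc d n)%:R = k%:~R * (base n)%:R.
  have := x1 n; rewrite -tdx level_charE => /cis_eq1[k] /=.
  by rewrite /level_phase /= => Ek; exists k; rewrite -Ek divfK// adic_baseR_neq0.
have [j Ej] := E 0%N; rewrite /adic_trunc /adic_base !big_ord0 subr0 mulr1 in Ej.
rewrite -tdx -(solenoid_pi_shift j) Ej subrr -solenoid_pi0; congr (pi_ (_, _)).
apply: adic_trunc_inj => n; rewrite adic_trunc0.
have [k Ek] := E n; apply: (trunc_shift_eq0 (k := - k)).
by rewrite -Ej mulrNz mulNr -Ek opprB addrC subrK.
Qed.

Lemma solenoid_compact : compact [set: X].
Proof.
have cD : compact [set: Delta].
  have := @tychonoff nat (fun n => discrete_topology 'I_(a n)) (fun n => setT) (fun n => _).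
  rewrite (_ : [set f | _] = setT); last by apply/seteqP; split.
  by apply => n; apply: finite_compact; exact: finite_finset.
have cK : compact (`[0, 1]%classic `*` [set: Delta] : set cover).
  by apply: compact_setX => //; exact: segment_compact.
rewrite (_ : setT = pi_ @` (`[0, 1]%classic `*` [set: Delta])).
  apply: continuous_compact => //; apply: continuous_subspaceT; exact: solenoid_pi_continuous.
apply/seteqP; split => // x _; have [[t d] <-] := solenoid_pi_surj x.
exists (t - (Num.floor t)%:~R, d - u *~ Num.floor t); last exact: solenoid_pi_shift.
split => //=; rewrite in_itv /=; have /andP[h1 h2] := floor_itv t.
by rewrite subr_ge0 h1 /= lerBlDr addrC -[1]/(1%:~R) -intrD ltW.
Qed.

End SolenoidCharacters.

Lemma compact_bigcap_decreasing (X : topologicalType) (F : nat -> set X) :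
  compact [set: X] -> (forall n, closed (F n)) -> (forall n, F n.+1 `<=` F n) ->
  (forall n, F n !=set0) -> \bigcap_n F n !=set0.
Proof.
move=> cX cF decF F0.
have decF' m n : (m <= n)%N -> F n `<=` F m.
  elim: n => [|n IH]; first by rewrite leqn0 => /eqP ->.
  rewrite leq_eqVlt => /orP[/eqP -> //|]; rewrite ltnS => /IH.
  by apply: subset_trans; exact: decF.
pose G := filter_from [set: nat] F.
have FG : Filter G.
  apply: filter_from_filter; first by exists 0%N.
  move=> i j _ _; exists (maxn i j) => //.
  by move=> x Fx; split; apply: (decF' _ (maxn i j)) => //; rewrite ?leq_maxl ?leq_maxr.
have PG : ProperFilter G by apply: filter_from_proper => n _; exact: F0.
have [x [_ Gx]] := cX G PG filterT.
exists x => n _; rewrite (iffLR (closure_id _) (cF n)).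
move: Gx; rewrite clusterE; apply; by exists n.
Qed.

Section Subgroup.
Context {V : zmodType}.
Implicit Types S : set V.

Definition zmod_subgroup S := S 0 /\ (forall x y, S x -> S y -> S (x - y)).

Lemma zmod_subgroupN S x : zmod_subgroup S -> S x -> S (- x).
Proof. by move=> [S0 SB] Sx; rewrite -sub0r; exact: SB. Qed.

Lemma zmod_subgroupD S x y : zmod_subgroup S -> S x -> S y -> S (x + y).
Proof.
by move=> SS Sx Sy; rewrite -[y]opprK; apply: (proj2 SS) => //; exact: zmod_subgroupN.
Qed.

Lemma zmod_subgroupMn S x n : zmod_subgroup S -> S x -> S (x *+ n).
Proof.
move=> SS Sx; elim: n => [|n IH]; first by rewrite mulr0n; case: SS.
by rewrite mulrS; exact: zmod_subgroupD.
Qed.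

Lemma zmod_subgroupMz S x (m : int) : zmod_subgroup S -> S x -> S (x *~ m).
Proof.
move=> SS Sx; case: m => n; first by rewrite -pmulrn; exact: zmod_subgroupMn.
by rewrite NegzE mulrNz; apply: zmod_subgroupN => //; rewrite -pmulrn; exact: zmod_subgroupMn.
Qed.

(** The m with [S (x *~ m)] form a subgroup of the integers, and [e] is its generator; [e = 0] when
    no nonzero multiple of x lies in S. *)
Lemma zmod_subgroup_cyclic S x : zmod_subgroup S ->
  exists e : nat, S (x *+ e) /\ forall m : int, S (x *~ m) -> exists k : int, m = e%:Z * k.
Proof.
move=> SS; pose P n := `[< (0 < n)%N /\ S (x *+ n) >].
have abs m : S (x *~ m) -> S (x *+ `|m|%N).
  move=> Sm; rewrite pmulrn; have [->|->] : (`|m|%N%:Z = m) \/ (`|m|%N%:Z = - m) by lia.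
    exact: Sm.
  by rewrite mulrNz; exact: zmod_subgroupN.
have [exP|noP] := pselect (exists n, P n); last first.
  exists 0%N; split; first by rewrite mulr0n; case: SS.
  move=> m Sm; exists 0; rewrite mulr0; apply/eqP; apply: contrapT => /negP m0.
  by apply: noP; exists `|m|%N; apply/asboolP; split; [rewrite absz_gt0|exact: abs].
case: (ex_minnP exP) => e /asboolP[e0 Se] emin; exists e; split => // m Sm.
exists (m %/ e)%Z; rewrite mulrC {1}(divz_eq m e).
suff -> : (m %% e)%Z = 0 by rewrite addr0.
apply/eqP; apply: contrapT => /negP r0.
have re : (m %% e)%Z < e by apply: ltz_pmod.
have rge : 0 <= (m %% e)%Z by apply: modz_ge0; rewrite -lt0n.
have : P `|(m %% e)%Z|%N.
  apply/asboolP; split; first by rewrite absz_gt0.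
  apply: abs; have -> : (m %% e)%Z = m - e%:Z * (m %/ e)%Z.
    by rewrite {2}(divz_eq m e) mulrC addrAC subrr add0r.
  rewrite mulrzBr mulrzA; apply: (proj2 SS) => //; exact: zmod_subgroupMz.
move/emin; move: re rge r0; set r := (m %% e)%Z; lia.
Qed.

End Subgroup.

(** * Borel sets, extension of characters, uniqueness of transforms *)

Section BorelSolenoid.
Context {R : realType}.

Lemma borel_open_measurable (X : topologicalZmodType) (U : set X) :
  open U -> measurable (U : set (borel X)).
Proof. by move=> oU; apply: sub_sigma_algebra. Qed.

Lemma borel_closed_measurable (X : topologicalZmodType) (U : set X) :
  closed U -> measurable (U : set (borel X)).
Proof.
move=> cU; rewrite -(setCK U); apply: (@measurableC _ (borel X)).
by apply: borel_open_measurable; exact: closed_openC.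
Qed.

Lemma borel_continuous_measurable (X : topologicalZmodType) (f : X -> R) :
  continuous f -> measurable_fun setT (f : borel X -> R).
Proof.
move=> cf; apply: (measurability _ (RGenOInfty.measurableE R)).
move=> /= _ [_ [c ->] <-]; rewrite setTI.
apply: borel_open_measurable; move/continuousP : cf; apply.
exact: interval_open.
Qed.

Lemma dual_bm (X : topologicalZmodType) (y : dual R X) : bm (y : borel X -> R[i]).
Proof.
have [cR cI] := dual_continuous y; split.
- exact: borel_continuous_measurable.
- exact: borel_continuous_measurable.
by exists 1 => x; apply: norm1_ReIm; exact: dual_norm.
Qed.

Lemma charfunE (X : topologicalZmodType) (mu : probability (borel X) R) (y : dual R X) :
  charfun mu y = Ec mu y.
Proof. by []. Qed.

Context {a : nat -> nat} {ha : forall n, (1 < a n)%N}.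
Local Notation X := (solenoid R ha).
Local Notation Y := (dual R X).

(** The cyclic groups of the levels increase and exhaust the dual. This is how rank one is used
    throughout. *)
Lemma dual_common_level (y z : Y) : exists n (k m : int),
  y = level_char n *~ k /\ z = level_char n *~ m.
Proof.
have up (n i : nat) (k : int) : exists k' : int,
    level_char n *~ k = level_char (n + i)%N *~ k' :> Y.
  elim: i => [|i [k' ->]]; first by exists k; rewrite addn0.
  by exists ((a (n + i)%N)%:Z * k'); rewrite addnS level_charS pmulrn mulrzA.
have [n [k ->]] := dual_classification y; have [m [l ->]] := dual_classification z.
have [k' ->] := up n m k; have [l' ->] := up m n l.
by exists (n + m)%N, k', l'; rewrite addnC.
Qed.

Lemma dual_eq_closed (y : Y) (c : R[i]) : closed [set x | y x = c].
Proof.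
have [cR cI] := dual_continuous y.
have -> : [set x | y x = c] = (fun x => complex.Re (y x)) @^-1` [set complex.Re c] `&`
    (fun x => complex.Im (y x)) @^-1` [set complex.Im c].
  apply/seteqP; split => x /=; first by move=> ->.
  by case=> e1 e2; exact: complexP.
by apply: closedI; apply: preimage_closed; [move=> x _|exact: closed_eq|move=> x _|exact: closed_eq].
Qed.

(** A piece of Pontryagin duality. The points realizing chi on the multiples of [level_char n] in S
    form a closed set that decreases with n; it is nonempty because S meets a cyclic group in a
    cyclic group. Compactness gives a common point. *)
Lemma dual_extension (S : set Y) (chi : Y -> R[i]) : zmod_subgroup S ->
  (forall y, S y -> `|chi y| = 1) ->
  (forall y z, S y -> S z -> chi (y + z) = chi y * chi z) ->
  exists x : X, forall y, S y -> y x = chi y.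
Proof.
move=> SS chi1 chiD.
have chi0 y : S y -> chi y != 0 by move=> /chi1 e; rewrite -normr_eq0 e oner_neq0.
have S0 := proj1 SS.
have chi00 : chi 0 = 1 by apply: (mulfI (chi0 _ S0)); rewrite -chiD// addr0 mulr1.
have chiMn y n : S y -> chi (y *+ n) = chi y ^+ n.
  move=> Sy; elim: n => [|n IH]; first by rewrite mulr0n.
  by rewrite mulrS chiD// ?IH ?exprS//; exact: zmod_subgroupMn.
have chiMz y (m : int) : S y -> chi (y *~ m) = chi y ^ m.
  move=> Sy; case: m => n; first by rewrite -pmulrn chiMn.
  rewrite NegzE mulrNz -pmulrn; have Syn := zmod_subgroupMn n.+1 SS Sy.
  apply: (mulfI (chi0 _ Syn)); rewrite -chiD//; last exact: zmod_subgroupN.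
  by rewrite subrr chi00 chiMn// mulfV// expf_neq0// chi0.
pose F n := [set x : X | forall m : int, S (level_char n *~ m) ->
  (level_char n *~ m) x = chi (level_char n *~ m)].
have [x Fx] : \bigcap_n F n !=set0.
  apply: compact_bigcap_decreasing; first exact: solenoid_compact.
  - move=> n; rewrite (_ : F n = \bigcap_(m in [set m : int | S (level_char n *~ m)])
        [set x | (level_char n *~ m) x = chi (level_char n *~ m)]).
      by apply: closed_bigI => m _; exact: dual_eq_closed.
    by apply/seteqP; split => x H m; exact: H.
  - move=> n x Fx m; rewrite level_charS pmulrn -mulrzA; exact: Fx.
  - move=> n; have [e [Se He]] := zmod_subgroup_cyclic (level_char n) SS.
    have [t Et] := cis_surj (chi1 _ Se).
    have [e0|e0] := eqVneq e 0%N.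
      exists 0 => m /He[k ->]; rewrite e0 mul0r mulr0z chi00; exact: dual0E.
    (* On the real line [level_char n] divides by the base before applying [cis]; this point thus
       gives an e-th root of the value cis t prescribed at the generator. *)
    have xE : (level_char n : Y) (@solenoid_pi R a ha ((@adic_base a n)%:R * (t / e%:R), 0)) = cis (t / e%:R).
      rewrite level_charE /level_phase /= adic_trunc0 subr0 [_ * (t / _)]mulrC mulfK//.
      exact: adic_baseR_neq0.
    exists (@solenoid_pi R a ha ((@adic_base a n)%:R * (t / e%:R), 0)) => m /[dup] Sm /He[k mk].
    have Ek : level_char n *~ m = (level_char n *+ e) *~ k :> Y by rewrite mk mulrzA.
    rewrite Ek dualMzE (chiMz _ _ Se); congr (_ ^ _).
    rewrite Et dualMnE xE -cisMn; congr cis.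
    by rewrite -[_ *+ e]mulr_natr divfK// pnatr_eq0.
by exists x => y; have [n [m ->]] := dual_classification y; exact: Fx.
Qed.

Lemma normr_level_diff (y : Y) (x z : X) :
  (complex.Re (y x) - complex.Re (y z)) ^+ 2 + (complex.Im (y x) - complex.Im (y z)) ^+ 2 =
  2 * (1 - complex.Re (y (x - z))).
Proof.
rewrite dual_morphD dual_morphN norm1_conjV ?dual_norm//.
rewrite complexReM complexReJ complexImJ.
have /norm1_complexE := dual_norm y x; have /norm1_complexE := dual_norm y z.
set a1 := complex.Re _; set b1 := complex.Im _; set a2 := complex.Re _; set b2 := complex.Im _.
by move=> h1 h2; nra.
Qed.

(** A countable base: a level, an accuracy 1 / (j + 1) and a rational centre for the value of the
    character. One level at a time is enough by [solenoid_nbhs_level]. *)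
Definition level_cell (k : (nat * nat) * (rat * rat)) : set X :=
  [set x | `|complex.Re ((level_char k.1.1 : Y) x) - ratr k.2.1| < k.1.2.+1%:R^-1 /\
           `|complex.Im ((level_char k.1.1 : Y) x) - ratr k.2.2| < k.1.2.+1%:R^-1].

Lemma open_level_cells (U : set X) : open U ->
  U = \bigcup_k (if `[< level_cell k `<=` U >] then level_cell k else set0).
Proof.
move=> oU; apply/seteqP; split; last first.
  by move=> x [k _]; case: asboolP => // kU /kU.
move=> x Ux; have [n [e e0 He]] := solenoid_nbhs_level oU Ux.
(* Chosen so that 4 d^2 <= e. Two points of a cell of accuracy d have values differing by less than
   2 d in each coordinate, so that 2 (1 - Re) < 8 d^2 <= 2 e for their difference. *)
pose j := Num.bound (2 / Num.min e 1); pose d : R := j.+1%:R^-1.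
have d0 : 0 < d by rewrite invr_gt0.
have m0 : 0 < Num.min e 1 by rewrite lt_min e0 ltr01.
have de : 4 * d ^+ 2 <= e.
  have d2 : d < Num.min e 1 / 2.
    rewrite -[_ / 2]invrK ltf_pV2 ?posrE ?invr_gt0 ?divr_gt0// invf_div.
    apply: lt_trans (_ : j%:R < _); last by rewrite ltr_nat.
    by apply: archi_boundP; rewrite divr_ge0// ltW.
  have : Num.min e 1 <= e by rewrite ge_min lexx.
  have : Num.min e 1 <= 1 by rewrite ge_min lexx orbT.
  by move: d2 m0 d0; set m := Num.min e 1; nra.
have rat_near (c : R) : exists q : rat, `|c - ratr q| < d.
  have /rat_in_itvoo[q] : c - d < c + d by lra.
  rewrite in_itv /= => /andP[h1 h2]; exists q.
  by rewrite ltr_distlC; apply/andP; split; lra.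
have [q1 Hq1] := rat_near (complex.Re ((level_char n : Y) x)).
have [q2 Hq2] := rat_near (complex.Im ((level_char n : Y) x)).
exists ((n, j), (q1, q2)) => //; case: asboolP => [_|]; first by split.
case=> z [/= z1 z2]; rewrite -(subrK x z) addrC.
apply: He; rewrite -(ltr_pM2l (ltr0n _ 2)).
rewrite -normr_level_diff.
have h1 : `|complex.Re ((level_char n : Y) z) - complex.Re ((level_char n : Y) x)| < 2 * d.
  by move: z1 Hq1; rewrite -/d !ltr_distl => /andP[? ?] /andP[? ?]; apply/andP; split; lra.
have h2 : `|complex.Im ((level_char n : Y) z) - complex.Im ((level_char n : Y) x)| < 2 * d.
  by move: z2 Hq2; rewrite -/d !ltr_distl => /andP[? ?] /andP[? ?]; apply/andP; split; lra.
move: h1 h2; set u := _ - _; set v := _ - complex.Im _ => h1 h2.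
have : `|u| ^+ 2 < (2 * d) ^+ 2 by rewrite ltrXn2r.
have : `|v| ^+ 2 < (2 * d) ^+ 2 by rewrite ltrXn2r.
by rewrite !real_normK ?num_real//; move: de; nra.
Qed.

(** Open sets are countable unions of cells, whose preimages are described by the level
    characters. *)
Lemma measurable_to_solenoid d (T : measurableType d) (phi : T -> borel X) :
  (forall n, measurable_fun setT (fun t => complex.Re ((level_char n : Y) (phi t))) /\
     measurable_fun setT (fun t => complex.Im ((level_char n : Y) (phi t)))) ->
  measurable_fun setT phi.
Proof.
move=> mphi; apply: (@measurability _ _ T (borel X) setT phi (@open X : set (set (borel X)))) => //.
move=> _ [U oU <-]; rewrite setTI (open_level_cells oU) preimage_bigcup.
apply: countable_bigcupT_measurable => // k; case: asboolP => _; last by rewrite preimage_set0.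
have [mR mI] := mphi k.1.1.
have ball_meas (f : T -> R) (c r : R) : measurable_fun setT f ->
    measurable [set t | `|f t - c| < r].
  move=> mf; have := mf measurableT `]c - r, c + r[%classic (measurable_itv _).
  rewrite setTI; congr measurable; apply/seteqP; split => t /=; rewrite in_itv /= ltr_distl//.
exact: (measurableI _ _ (ball_meas _ _ _ mR) (ball_meas _ _ _ mI)).
Qed.

Lemma bm_measurable_to_solenoid d (T : measurableType d) (phi : T -> borel X) :
  (forall n, bm (fun t => (level_char n : Y) (phi t))) -> measurable_fun setT phi.
Proof. by move=> H; apply: measurable_to_solenoid => n; have [] := H n. Qed.

Lemma bm_dual_comp d (T : measurableType d) (phi : T -> borel X) (y : Y) :
  measurable_fun setT phi -> bm (fun t => y (phi t)).
Proof. by move=> mphi; apply: (bm_comp mphi); exact: dual_bm. Qed.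

Lemma measurable_solenoidD d (T : measurableType d) (f g : T -> borel X) :
  measurable_fun setT f -> measurable_fun setT g ->
  measurable_fun setT ((fun t => (f t : X) + (g t : X)) : T -> borel X).
Proof.
move=> mf mg; apply: bm_measurable_to_solenoid => n.
rewrite (_ : (fun t => _) = (fun t => (level_char n : Y) (f t) * (level_char n : Y) (g t))).
  by apply: bmM; exact: bm_dual_comp.
by apply/funext => t; rewrite dual_morphD.
Qed.

Lemma measurable_solenoidMz d (T : measurableType d) (f : T -> borel X) (m : int) :
  measurable_fun setT f ->
  measurable_fun setT ((fun t => (f t : X) *~ m) : T -> borel X).
Proof.
move=> mf; apply: bm_measurable_to_solenoid => n.
rewrite (_ : (fun t => _) = (fun t => (level_char n *~ m : Y) (f t))).
  exact: bm_dual_comp.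
by apply/funext => t; rewrite dual_morphMz dualMzE.
Qed.

Lemma measurable_solenoidN d (T : measurableType d) (f : T -> borel X) :
  measurable_fun setT f ->
  measurable_fun setT ((fun t => - (f t : X)) : T -> borel X).
Proof. exact: (@measurable_solenoidMz _ _ _ (-1)). Qed.

Section Unique.
Let halfspaces (T : Type) (K : set (T -> R[i])) :=
  [set D | exists2 k, K k & exists c : R, D = [set x | complex.Re (k x) < c]].

(** The imaginary part of k is the real part of - i k, which belongs to K as well. *)
Let halfspace_measurable (T : pointedType) (K : set (T -> R[i])) (k : T -> R[i]) :
  (forall c k, K k -> K (fun x => c * k x)) -> K k ->
  measurable_fun setT ((fun x => complex.Re (k x)) : g_sigma_algebraType (halfspaces K) -> R) /\
  measurable_fun setT ((fun x => complex.Im (k x)) : g_sigma_algebraType (halfspaces K) -> R).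
Proof.
move=> KZ Kk.
have HR k' : K k' -> measurable_fun setT
    ((fun x => complex.Re (k' x)) : g_sigma_algebraType (halfspaces K) -> R).
  move=> Kk'; apply: (measurability _ (RGenInftyO.measurableE R)).
  move=> /= _ [_ [c ->] <-]; rewrite setTI; apply: sub_sigma_algebra.
  exists k' => //; exists c.
  by apply/seteqP; split => x /=; rewrite in_itv.
split; first exact: HR.
have := HR _ (KZ (- 'i)%C _ Kk).
congr measurable_fun; apply/funext => x; rewrite complexReM /=.
by ring.
Qed.

Lemma charfun_unique (mu nu : probability (borel X) R) :
  (forall y : Y, charfun mu y = charfun nu y) ->
  forall E, measurable E -> mu E = nu E.
Proof.
(* Scalar multiples of the characters are included so that half-spaces also detect imaginary
   parts. *)
move=> munu; pose K : set (borel X -> R[i]) :=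
  [set k | exists c (y : Y), k = (fun x => c * y x)].
have KZ c k : K k -> K (fun x => c * k x).
  by move=> [c' [y ->]]; exists (c * c'), y; apply/funext => x; rewrite mulrA.
apply: (cplx_expectation_unique (K := K)).
- by move=> _ [c [y ->]]; apply: bmM; [exact: bm_cst|exact: dual_bm].
- by exists 1, 0; apply/funext => x; rewrite mul1r.
- move=> _ _ [c [y ->]] [c' [y' ->]]; exists (c * c'), (y + y'); apply/funext => x.
  by rewrite dualDE mulrACA.
- move=> _ [c [y ->]]; exists c^*, (- y); apply/funext => x.
  by rewrite rmorphM dualNE norm1_conjV// dual_norm.
- move=> _ [c [y ->]]; rewrite !EcZ; [|exact: dual_bm|exact: dual_bm].
  by congr (_ * _); exact: munu.
move=> E mE; have mid : measurable_fun setT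
    (id : g_sigma_algebraType (halfspaces K) -> borel X).
  apply: measurable_to_solenoid => n; apply: halfspace_measurable => //.
  by exists 1, (level_char n); apply/funext => x; rewrite mul1r.
by have := mid measurableT E mE; rewrite setTI.
Qed.

Lemma joint_charfun_unique (mu nu : probability (borel X * borel X)%type R) :
  (forall y z : Y, Ec mu (fun x => y x.1 * z x.2) = Ec nu (fun x => y x.1 * z x.2)) ->
  forall E, measurable E -> mu E = nu E.
Proof.
move=> munu; pose K : set (borel X * borel X -> R[i]) :=
  [set k | exists c (y z : Y), k = (fun x => c * (y x.1 * z x.2))].
have KZ c k : K k -> K (fun x => c * k x).
  by move=> [c' [y [z ->]]]; exists (c * c'), y, z; apply/funext => x; rewrite mulrA.
have byz (y z : Y) : bm (fun x : borel X * borel X => y x.1 * z x.2).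
  exact: (bmM (bm_dual_comp y measurable_fst) (bm_dual_comp z measurable_snd)).
apply: (cplx_expectation_unique (K := K)).
- by move=> _ [c [y [z ->]]]; apply: bmM => //; exact: bm_cst.
- by exists 1, 0, 0; apply/funext => x; rewrite !mul1r.
- move=> _ _ [c [y [z ->]]] [c' [y' [z' ->]]]; exists (c * c'), (y + y'), (z + z').
  by apply/funext => x; rewrite !dualDE; ring.
- move=> _ [c [y [z ->]]]; exists c^*, (- y), (- z); apply/funext => x.
  by rewrite !rmorphM !dualNE !norm1_conjV// dual_norm.
- by move=> _ [c [y [z ->]]]; rewrite !EcZ// munu.
move=> E mE; have mid : measurable_fun setT
    ((fun x => (x.1, x.2)) : g_sigma_algebraType (halfspaces K) -> (borel X * borel X)%type).
  apply: measurable_fun_pair; apply: measurable_to_solenoid => n;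
    apply: halfspace_measurable => //.
    by exists 1, (level_char n), 0; apply/funext => x; rewrite mul1r mulr1.
  by exists 1, 0, (level_char n); apply/funext => x; rewrite !mul1r.
have := mid measurableT E mE; rewrite setTI (_ : _ @^-1` E = E)//.
by apply/seteqP; split => -[].
Qed.

End Unique.
End BorelSolenoid.

Lemma exists_law {R : realType} d d' (T : measurableType d) (T' : measurableType d')
    (P : probability T R) (phi : T -> T') : measurable_fun setT phi ->
  exists nu : probability T' R, forall E, measurable E -> nu E = P (phi @^-1` E).
Proof.
move=> mphi; pose f : {mfun T >-> T'} := HB.pack phi (isMeasurableFun.Build _ _ _ _ phi mphi).
by exists (distribution P f).
Qed.

(** * Uniform digits on the unit interval *)

Section UniformDigits.
Context {R : realType}.

Lemma bm_sum d (T : measurableType d) (n : nat) (h : nat -> T -> R[i]) :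
  (forall i, (i < n)%N -> bm (h i)) -> bm (fun x => \sum_(i < n) h i x).
Proof.
elim: n => [|n IH] hb.
  by under eq_fun do rewrite big_ord0; exact: bm_cst.
under eq_fun do rewrite big_ord_recr /=.
by apply: bmD; [apply: IH => i ni; apply: hb; exact: ltnW|exact: hb].
Qed.

Lemma Ec_sum d (T : measurableType d) (P : probability T R) (n : nat) (h : nat -> T -> R[i]) :
  (forall i, (i < n)%N -> bm (h i)) ->
  Ec P (fun x => \sum_(i < n) h i x) = \sum_(i < n) Ec P (h i).
Proof.
elim: n => [|n IH] hb.
  by rewrite big_ord0; under eq_Ec do rewrite big_ord0; rewrite Ec_cst.
rewrite big_ord_recr /=; under eq_Ec do rewrite big_ord_recr /=.
rewrite EcD; [|by apply: bm_sum => i ni; apply: hb; exact: ltnW|exact: hb].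
by rewrite IH// => i ni; apply: hb; exact: ltnW.
Qed.

Definition uniform01 : probability (measurableTypeR R) R := uniform_prob (@ltr01 R).

Let U := uniform01.

Let U_itv (c e : R) : 0 <= c -> c <= e -> e <= 1 -> U `[c, e[%classic = (e - c)%:E.
Proof.
move=> c0 ce e1.
transitivity (\int[lebesgue_measure]_(x in `[c, e[) (uniform_pdf 0 1 x)%:E)%E; first by [].
rewrite (eq_integral (fun=> 1%E)); last first.
  move=> x; rewrite inE /= in_itv /= => /andP[cx xe].
  by rewrite /uniform_pdf (le_trans c0 cx) (le_trans (ltW xe) e1) subr0 invr1.
rewrite integral_cst//= mul1e lebesgue_measure_itv /= lte_fin.
move: ce; rewrite le_eqVlt => /predU1P[->|->//]; by rewrite ltxx subrr.
Qed.

(** The default 0 outside [0, 1), a null set for the uniform law, keeps the value below B for B > 0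
    and makes [uniform_digit_div] valid at every x. *)
Definition uniform_digit (B : nat) (x : R) : nat :=
  if 0 <= x < 1 then Num.truncn (B%:R * x) else 0%N.

Lemma uniform_digit_div (B b : nat) x : (0 < b)%N ->
  (uniform_digit (B * b) x %/ b)%N = uniform_digit B x.
Proof.
move=> b0; rewrite /uniform_digit; case: ifPn => [/andP[x0 x1]|_]; last by rewrite div0n.
have bR : 0 < b%:R :> R by rewrite ltr0n.
have Bx0 : 0 <= B%:R * x by rewrite mulr_ge0.
have BBx0 : 0 <= (B * b)%:R * x by rewrite mulr_ge0.
symmetry; apply: truncn_def.
have /andP[h1 h2] := truncn_itv BBx0; set t := Num.truncn _ in h1 h2 *.
have E := divn_eq t b; have rb : (t %% b < b)%N by rewrite ltn_pmod.
move: h1 h2; rewrite natrM => h1 h2; apply/andP; split.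
  rewrite -(ler_pM2r bR) -natrM; apply: le_trans (_ : t%:R <= _).
    by rewrite ler_nat {2}E leq_addr.
  by rewrite (le_trans h1)// mulrAC.
rewrite -(ltr_pM2r bR) -natrM; apply: lt_le_trans (_ : t.+1%:R <= _).
  by rewrite mulrAC.
by rewrite ler_nat; nia.
Qed.

Let I (B j : nat) : set R := `[j%:R / B%:R, j.+1%:R / B%:R[%classic.
Let out : set R := ~` `[0, 1[%classic.

Let digit_sum (F : nat -> R[i]) B x : (0 < B)%N -> F (uniform_digit B x) =
  \sum_(j < B) F j * (\1_(I B j) x)%:C%C + F 0%N * (\1_out x)%:C%C.
Proof.
move=> B0; have BR : 0 < B%:R :> R by rewrite ltr0n.
have Ij j : (x \in I B j) = (j%:R <= B%:R * x < j.+1%:R).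
  rewrite /I mem_setE in_itv /= ler_pdivrMr// ltr_pdivlMr//.
  by rewrite [x * _]mulrC.
rewrite /uniform_digit; case: ifPn => [/andP[x0 x1]|x01].
  have Bx0 : 0 <= B%:R * x by rewrite mulr_ge0.
  have tB : (Num.truncn (B%:R * x) < B)%N by rewrite truncn_lt_nat// gtr_pMr.
  rewrite (_ : \1_out x = 0); last first.
    by rewrite indicE /out in_setC mem_setE in_itv /= x0 x1.
  rewrite mulr0 addr0 (bigD1 (Ordinal tB))//= indicE Ij.
  rewrite truncn_itv// mulr1 big1 ?addr0// => i /eqP itB.
  rewrite indicE Ij -truncn_eq//; case: eqP => [e|]; last by rewrite mulr0.
  by exfalso; apply: itB; apply/val_inj => /=.
have outx : x \in out by rewrite /out in_setC mem_setE in_itv.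
rewrite [X in X%:C%C](_ : \1_out x = 1) ?indicE ?outx// mulr1 big1 ?add0r// => j _.
rewrite indicE Ij; case: andP => [[h1 h2]|]; last by rewrite mulr0.
exfalso; move/negP : x01; apply; apply/andP; split.
  by rewrite -(pmulr_rge0 _ BR) (le_trans _ h1).
rewrite -(ltr_pM2l BR) mulr1 (lt_le_trans h2)// ler_nat.
by case: j {h1 h2}.
Qed.

Lemma bm_uniform_digit (F : nat -> R[i]) B : (0 < B)%N ->
  bm (fun x : measurableTypeR R => F (uniform_digit B x)).
Proof.
move=> B0; under eq_fun do rewrite digit_sum//.
apply: bmD; last by apply: bmM; [exact: bm_cst|apply: bm_indic; exact: measurableC].
apply: (@bm_sum _ _ _ (fun j (x : measurableTypeR R) => F j * (\1_(I B j) x)%:C%C)) => j _.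
by apply: bmM; [exact: bm_cst|apply: bm_indic; exact: measurable_itv].
Qed.

Lemma Ec_uniform_digit (F : nat -> R[i]) B : (0 < B)%N ->
  Ec U (fun x => F (uniform_digit B x)) = B%:R^-1 * \sum_(j < B) F j.
Proof.
move=> B0; have BR : 0 < B%:R :> R by rewrite ltr0n.
have mo : measurable out by exact: measurableC.
under eq_Ec do rewrite digit_sum//.
have bI j : bm (fun x : measurableTypeR R => F j * (\1_(I B j) x)%:C%C) by apply: bmM; [exact: bm_cst|apply: bm_indic; exact: measurable_itv].
rewrite EcD; [|exact: (@bm_sum _ _ _ (fun j (x : measurableTypeR R) => F j * (\1_(I B j) x)%:C%C))|by apply: bmM; [exact: bm_cst|exact: bm_indic]].
have Uout : (U out = 0)%E.
  have h1 := U_itv (lexx 0) ler01 (lexx 1); rewrite subr0 in h1.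
  have h : U out = (1 - U `[0%R, 1%R[%classic)%E by apply: probability_setC.
  by rewrite h h1 subee.
have EUout : Ec U (fun x => (\1_out x)%:C%C) = 0.
  rewrite Ec_indic//; exact: (congr1 (fun e => (fine e)%:C%C : R[i]) Uout).
rewrite EcZ; last exact: bm_indic.
rewrite EUout mulr0 addr0.
have -> : Ec U (fun x => \sum_(j < B) F j * (\1_(I B j) x)%:C%C) =
    \sum_(j < B) Ec U (fun x => F j * (\1_(I B j) x)%:C%C).
  by apply: (@Ec_sum _ _ _ _ (fun j (x : measurableTypeR R) => F j * (\1_(I B j) x)%:C%C)) => i _; exact: bI.
rewrite mulr_sumr; apply: eq_bigr => j _.
have UI : U (I B j) = (B%:R^-1)%:E.
  rewrite U_itv; first by rewrite -mulrBl -natrB// subSnn mul1r.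
  - by rewrite divr_ge0.
  - by rewrite ler_pM2r ?invr_gt0// ler_nat.
  - by rewrite ler_pdivrMr// mul1r ler_nat.
have EUI : Ec U (fun x => (\1_(I B j) x)%:C%C) = B%:R^-1.
  rewrite Ec_indic; last exact: measurable_itv.
  have := congr1 (fun e => (fine e)%:C%C : R[i]) UI; rewrite [X in _ = X -> _]fmorphV rmorph_nat.
  exact.
by rewrite EcZ ?EUI 1?mulrC//; apply: bm_indic; exact: measurable_itv.
Qed.

End UniformDigits.

Lemma subrACA (V : zmodType) (a b c d : V) : (a - b) - (c - d) = (a - c) - (b - d).
Proof. by rewrite !opprB [d - c]addrC addrACA [- b + d]addrC. Qed.

(** * Haar laws of annihilators *)

Section AnnihilatorHaar.
Context {R : realType} {a : nat -> nat} {ha : forall n, (1 < a n)%N}.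
Local Notation X := (solenoid R ha).
Local Notation Y := (dual R X).
Local Notation lc := (level_char : nat -> Y).

Definition annihilator (S : set Y) : set X := [set x | forall y, S y -> y x = 1].

Lemma annihilator_closed (S : set Y) : closed (annihilator S).
Proof.
rewrite (_ : annihilator S = \bigcap_(y in S) [set x | y x = 1]).
  by apply: closed_bigI => y _; exact: dual_eq_closed.
by apply/seteqP; split.
Qed.

(** On the group generated by T and z, the character trivial on T and equal to cis (1/b) at z is
    well defined, m being determined modulo b by y = t + m z; [dual_extension] realizes it at a
    point. *)
Lemma annihilator_step (T : set Y) (z : Y) (b : nat) : zmod_subgroup T -> (0 < b)%N ->
  (forall m : int, T (z *~ m) -> exists k : int, m = b%:Z * k) ->
  exists2 x : X, annihilator T x & z x = cis b%:R^-1.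
Proof.
move=> ST b0 Hb; have bR : b%:R != 0 :> R by rewrite pnatr_eq0 -lt0n.
pose T' := [set y | exists m : int, T (y - z *~ m)].
(* A choice of m for y in [T']; the default 0 matters only outside [T']. *)
pose idx (y : Y) : int := xget 0 [set m | T (y - z *~ m)].
pose chi (y : Y) : R[i] := cis ((idx y)%:~R / b%:R).
have chiE y m : T (y - z *~ m) -> chi y = cis (m%:~R / b%:R).
  move=> Ty; have Ti : T (y - z *~ idx y) by exact: (xgetPex 0 (ex_intro (fun m => T (y - z *~ m)) m Ty)).
  have [k Ek] : exists k : int, idx y - m = b%:Z * k.
    apply: Hb; rewrite mulrzBr; have := proj2 ST _ _ Ty Ti.
    by rewrite opprB addrC addrA subrK.
  rewrite /chi; have -> : (idx y)%:~R / b%:R = m%:~R / b%:R + k%:~R :> R.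
    rewrite -(subrK m (idx y)) Ek intrD intrM -pmulrn; field.
    exact: bR.
  by rewrite cisDint.
have ST' : zmod_subgroup T'.
  split; first by exists 0; rewrite mulr0z subr0; case: ST.
  move=> y y' [m Tm] [m' Tm']; exists (m - m'); rewrite mulrzBr.
  by rewrite subrACA; exact: (proj2 ST).
have [x Hx] : exists x : X, forall y, T' y -> y x = chi y.
  apply: dual_extension => //; first by move=> y _; exact: norm_cis.
  move=> y y' [m Tm] [m' Tm']; rewrite (chiE _ _ Tm) (chiE _ _ Tm') (chiE _ (m + m')).
    by rewrite intrD mulrDl cisD.
  by rewrite mulrzDr opprD addrACA; exact: zmod_subgroupD.
exists x.
  move=> t Tt; have T0 : T (t - z *~ 0) by rewrite mulr0z subr0.
  by rewrite Hx; [rewrite (chiE _ _ T0) mul0r cis0|exists 0].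
have T1 : T (z - z *~ 1) by rewrite subrr; case: ST.
by rewrite Hx; [rewrite (chiE _ _ T1) mul1r|exists 1].
Qed.

Lemma big_digits (V : nmodType) (B b : nat) (F : nat -> V) :
  \sum_(j < B * b) F j = \sum_(i < B) \sum_(d < b) F (i * b + d)%N.
Proof.
elim: B => [|B IH]; first by rewrite mul0n !big_ord0.
rewrite big_ord_recr /= -IH -(big_mkord xpredT F) -(big_mkord xpredT F) mulSnr.
rewrite (@big_cat_nat _ _ _ (B * b))//= ?leq_addr//; congr (_ + _).
by rewrite -[X in \sum_(X <= _ < _) _](add0n (B * b)%N) big_addn addKn big_mkord;
  apply: eq_bigr => d _; rewrite addnC.
Qed.

Section Construction.
Variables (S : set Y) (y0 : Y).
Hypotheses (SS : zmod_subgroup S) (Sy0 : S y0) (y0_neq0 : y0 != 0).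

(* The order of [lc n] modulo [tower n] is the radix of the n-th digit of a uniform
   variable; this digit selects the value of [lc n] at a random point of the
   annihilator of S. *)
Fixpoint tower (n : nat) : set Y :=
  if n is n'.+1 then [set y | exists m : int, tower n' (y - lc n' *~ m)] else S.

Lemma tower_subgroup n : zmod_subgroup (tower n).
Proof.
elim: n => [//|n IH]; split; first by exists 0; rewrite mulr0z subr0; case: IH.
move=> y y' [m Tm] [m' Tm']; exists (m - m'); rewrite mulrzBr.
by rewrite subrACA; exact: (proj2 IH).
Qed.

Lemma towerS n : tower n `<=` tower n.+1.
Proof. by move=> y Ty; exists 0; rewrite mulr0z subr0. Qed.

Lemma tower_le m n : (m <= n)%N -> tower m `<=` tower n.
Proof.
elim: n => [|n IH]; first by rewrite leqn0 => /eqP ->.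
rewrite leq_eqVlt => /orP[/eqP -> //|]; rewrite ltnS => /IH.
by move=> h y /h; exact: towerS.
Qed.

Lemma tower_exhausts y : exists n, tower n y.
Proof.
have [n [m ->]] := dual_classification y; exists n.+1, m; rewrite subrr.
by case: (tower_subgroup n).
Qed.

(** The order is finite because [lc n] and the nonzero element [y0] of S are multiples of a common
    character. *)
Lemma tower_order n : exists b : nat, [/\ (0 < b)%N, tower n (lc n *+ b) &
  forall m : int, tower n (lc n *~ m) -> exists k : int, m = b%:Z * k].
Proof.
have [b [Tb Hb]] := zmod_subgroup_cyclic (lc n) (tower_subgroup n).
exists b; split => //; rewrite lt0n; apply/eqP => b0.
have [l [i [j [Ei Ej]]]] := dual_common_level (lc n) y0.
have [k] : exists k : int, j = b%:Z * k.
  apply: Hb; apply: (tower_le (leq0n n)).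
  by rewrite Ei -mulrzA mulrC mulrzA -Ej; exact: zmod_subgroupMz.
rewrite b0 mul0r => j0; move: y0_neq0; by rewrite Ej j0 mulr0z eqxx.
Qed.

Let b n : nat := sval (cid (tower_order n)).

Let b_gt0 n : (0 < b n)%N. Proof. by rewrite /b; case: cid => /= ? []. Qed.

Let b_tower n : tower n (lc n *+ b n). Proof. by rewrite /b; case: cid => /= ? []. Qed.

Let b_order n (m : int) : tower n (lc n *~ m) -> exists k : int, m = (b n)%:Z * k.
Proof. by move: m; rewrite /b; case: cid => /= ? []. Qed.

Let x_ex n : exists2 x : X, annihilator (tower n) x & lc n x = cis (b n)%:R^-1.
Proof.
exact: annihilator_step (tower_subgroup n) (b_gt0 n) (@b_order n).
Qed.

Let x_ n : X := sval (cid2 (x_ex n)).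

Let x_ann n : annihilator (tower n) (x_ n).
Proof. by rewrite /x_; case: cid2. Qed.

Let x_gen n : lc n (x_ n) = cis (b n)%:R^-1.
Proof. by rewrite /x_; case: cid2. Qed.

Let B n : nat := \prod_(k < n) b k.

Let BS n : B n.+1 = (B n * b n)%N. Proof. by rewrite /B big_ord_recr. Qed.

Let B_gt0 n : (0 < B n)%N. Proof. by apply: prodn_gt0 => k; exact: b_gt0. Qed.

(** The last digit of j carries the newest point, so that dividing j by the last radix forgets one
    level, in agreement with [uniform_digit_div]. *)
Fixpoint digit_point (n j : nat) : X :=
  if n is n'.+1 then digit_point n' (j %/ b n') + x_ n' *+ (j %% b n') else 0.

(** The sum over the last digit is geometric in y (x_n). This value is 1 when y is already in
    [tower n]; otherwise it is a b-th root of unity different from 1, and the sum vanishes. *)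
Let avg_tower n y : tower n y ->
  (B n)%:R^-1 * \sum_(j < B n) y (digit_point n j) = (`[< S y >])%:R.
Proof.
elim: n y => [|n IH] y Ty.
  rewrite /B big_ord0 big_ord1 /= dual_morph0 mulr1 invr1.
  by move: Ty => /= Sy; rewrite (asboolT Sy).
have dig (i : nat) (d : 'I_(b n)) : y (digit_point n.+1 (i * b n + d)) =
    y (digit_point n i) * y (x_ n) ^+ d.
  by rewrite /= divnMDl// modnMDl modn_small// divn_small// addn0 dual_morphD dual_morphMn.
rewrite BS (big_digits _ _ (fun j => y (digit_point n.+1 j))); under eq_bigr => i _ do under eq_bigr => d _ do rewrite dig.
under eq_bigr => i _ do rewrite -mulr_sumr; rewrite -mulr_suml.
have bC : (b n)%:R != 0 :> R[i] by rewrite pnatr_eq0 -lt0n.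
have [Tny|Tny] := pselect (tower n y).
  rewrite (x_ann Tny); have -> : \sum_(i < b n) 1 ^+ i = (b n)%:R :> R[i].
    by under eq_bigr do rewrite expr1n; rewrite sumr_const card_ord.
  rewrite -(IH _ Tny) natrM invfM -!mulrA; congr (_ * _).
  by rewrite mulrCA mulVf// mulr1.
rewrite (asboolF (_ : ~ S y)); last first.
  by move=> Sy; apply: Tny; exact: (tower_le (leq0n n)).
have [m Tm] := Ty.
have yx : y (x_ n) = cis (m%:~R / (b n)%:R).
  rewrite -{1}(subrK (lc n *~ m) y) dualDE (x_ann Tm) mul1r dualMzE x_gen -cisMz.
  by rewrite -[_^-1 *~ m]mulrzr mulrC.
have geo : (y (x_ n) - 1) * \sum_(i < b n) y (x_ n) ^+ i = 0.
  rewrite -subrX1 yx -cisMn -[_ *+ b n]mulr_natr divfK ?cis_int ?subrr//.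
  by rewrite pnatr_eq0 -lt0n.
move/eqP : geo; rewrite mulf_eq0 => /orP[|/eqP ->]; last by rewrite !mulr0.
rewrite subr_eq0 yx => /eqP/cis_eq1[k Ek]; exfalso; apply: Tny.
have bR : (b n)%:R != 0 :> R by rewrite pnatr_eq0 -lt0n.
have mk : m = k * (b n)%:Z.
  apply/eqP; rewrite -(@eqr_int R) intrM -Ek -pmulrn divfK//.
rewrite -(subrK (lc n *~ m) y); apply: zmod_subgroupD (tower_subgroup n) Tm _.
rewrite mk mulrC mulrzA; apply: zmod_subgroupMz (tower_subgroup n) _.
by rewrite -pmulrn; exact: b_tower.
Qed.

Let point n (t : R) : X := digit_point n (uniform_digit (B n) t).

Let pointS n t y : tower n y -> y (point n.+1 t) = y (point n t).
Proof.
move=> Ty; rewrite /point /= BS uniform_digit_div// dual_morphD dual_morphMn.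
by rewrite (x_ann Ty) expr1n mulr1.
Qed.

Let point_le m n t y : (m <= n)%N -> tower m y -> y (point n t) = y (point m t).
Proof.
move=> mn Ty; elim: n mn => [|n IH]; first by rewrite leqn0 => /eqP ->.
rewrite leq_eqVlt => /orP[/eqP -> //|]; rewrite ltnS => mn.
by rewrite pointS ?IH//; exact: tower_le Ty.
Qed.

(** For fixed y the values stop changing once y enters the tower. The limits are a character of the
    whole dual, hence evaluation at a point. *)
Let limit_ex t : exists x : X, forall n y, tower n y -> y x = y (point n t).
Proof.
pose N (y : Y) := xget 0%N [set n | tower n y].
have NE y : tower (N y) y.
  by have [n Tn] := tower_exhausts y; exact: (xgetPex 0%N (ex_intro (fun n => tower n y) n Tn)).
have E n y : tower n y -> y (point (N y) t) = y (point n t).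
  by move=> Ty; have [nN|/ltnW Nn] := leqP n (N y); [exact: point_le|rewrite (point_le _ Nn (NE y))].
have [||x Hx] := @dual_extension R a ha setT (fun y => y (point (N y) t)) (conj I (fun _ _ _ _ => I)).
- by move=> y _; exact: dual_norm.
- move=> y z _ _; set n := maxn (N y) (N z).
  have Ty : tower n y by apply: tower_le (NE y); exact: leq_maxl.
  have Tz : tower n z by apply: tower_le (NE z); exact: leq_maxr.
  by rewrite (E n) ?(E n y) ?(E n z)//; exact: zmod_subgroupD (tower_subgroup n) Ty Tz.
by exists x => n y Ty; rewrite Hx// (E n).
Qed.

(** The law of the limit point for uniform t. Each y sees finitely many digits, whence the average
    of [avg_tower]; elements of S sit in [tower 0], where the point is 0, so that the limit point
    always annihilates S. *)
Lemma annihilator_haar_subproof : exists m : probability (borel X) R,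
  (forall y : Y, charfun m y = (`[< S y >])%:R) /\ m (annihilator S) = 1%E.
Proof.
pose phi (t : measurableTypeR R) : borel X := sval (cid (limit_ex t)).
have phiE n y t : tower n y -> y (phi t : X) = y (point n t).
  by rewrite /phi; case: cid => /= x Hx; exact: Hx.
have bphi n y : tower n y -> bm (fun t : measurableTypeR R => y (phi t : X)).
  move=> Ty; under eq_fun do rewrite (phiE n)//.
  exact: (bm_uniform_digit (fun j => y (digit_point n j)) (B_gt0 n)).
have mphi : measurable_fun setT phi.
  apply: bm_measurable_to_solenoid => n.
  by have [m Tm] := tower_exhausts (lc n); exact: (bphi m).
have [m Hm] := exists_law (@uniform01 R) mphi.
exists m; split.
  move=> y; rewrite charfunE (Ec_pushforward mphi Hm (dual_bm y)).
  have [n Ty] := tower_exhausts y; rewrite -(avg_tower Ty).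
  under eq_Ec do rewrite (phiE n)//.
  by rewrite (Ec_uniform_digit (fun j => y (digit_point n j)) (B_gt0 n)).
have mA : measurable (annihilator S : set (borel X)).
  apply: (borel_closed_measurable (X := X)); exact: annihilator_closed.
rewrite (Hm _ mA).
rewrite (_ : phi @^-1` _ = setT); first exact: probability_setT.
by apply/seteqP; split => // t _ y Sy; rewrite (phiE 0%N)//= dual_morph0.
Qed.

End Construction.

Lemma annihilator_haar (S : set Y) : zmod_subgroup S -> (exists2 y, S y & y != 0) ->
  exists m : probability (borel X) R,
  (forall y : Y, charfun m y = (`[< S y >])%:R) /\ m (annihilator S) = 1%E.
Proof. by move=> SS [y Sy y0]; exact: annihilator_haar_subproof Sy y0. Qed.

End AnnihilatorHaar.

(** * The transform of the normal law *)

Section NormalCharacteristicFunction.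
Context {R : realType}.
Local Notation mu := (@lebesgue_measure R).
Local Notation w := (@normal_pdf R 0 1).

Let wE t : w t = normal_peak 1 * expR (- (t ^+ 2 / 2)).
Proof.
rewrite /normal_pdf oner_eq0 /normal_fun subr0 expr1n; congr (_ * expR _).
by rewrite mulNr.
Qed.

Let w_ge0 t : 0 <= w t. Proof. exact: normal_pdf_ge0. Qed.

Let w_derive t : is_derive t (1 : R) w (- t * w t).
Proof.
have -> : w = (fun t => normal_peak 1 * expR (- (t ^+ 2 / 2))) by apply/funext => x; rewrite wE.
have d1 : is_derive t (1 : R) (fun t : R => - (t ^+ 2 / 2)) (- t).
  by apply: is_derive_eq; rewrite /GRing.scale /=; field.
have d2 := @is_derive1_comp R expR (fun t : R => - (t ^+ 2 / 2)) t _ _ (is_derive_expR _) d1.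
have d3 := @is_deriveZ R R R _ (normal_peak 1) t 1 _ d2.
by apply: (is_derive_eq d3); rewrite /GRing.scale /=; ring.
Qed.

Let measurable_w : measurable_fun setT w. Proof. exact: measurable_normal_pdf. Qed.

Let w_integrable : mu.-integrable setT (EFin \o w).
Proof. exact: integrable_normal_pdf. Qed.

(** |t| <= 1 + t^2 / 4 <= exp (t^2 / 4), which leaves a multiple of the normal density of variance
    2. *)
Let norm_mul_w_integrable : mu.-integrable setT (EFin \o (fun t => `|t| * w t)).
Proof.
pose s : R := Num.sqrt 2; have s0 : s != 0 by rewrite gt_eqF// sqrtr_gt0.
have s2 : s ^+ 2 = 2 by rewrite sqr_sqrtr.
pose c := normal_peak 1 / normal_peak s.
have wi : mu.-integrable setT (fun t => (c * normal_pdf 0 s t)%:E).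
  by under eq_fun do rewrite EFinM; apply: integrableZl => //; exact: integrable_normal_pdf.
apply: (le_integrable _ _ _ wi) => //.
  by apply/measurable_EFinP; apply: measurable_funM => //; exact: measurableT_comp.
move=> t _ /=; rewrite lee_fin normrM normr_id (ger0_norm (w_ge0 t)).
rewrite (le_trans _ (ler_norm _))// wE /normal_pdf (negbTE s0) /normal_fun s2 subr0.
rewrite /c mulrA divfK ?gt_eqF ?normal_peak_gt0// mulrCA ler_wpM2l ?normal_peak_ge0//.
apply: (@le_trans _ _ (expR (t ^+ 2 / 4) * expR (- (t ^+ 2 / 2)))).
  rewrite ler_wpM2r ?expR_ge0// (le_trans _ (expR_ge1Dx _))//.
  rewrite -real_normK ?num_real//; have : 0 <= (`|t| / 2 - 1) ^+ 2 by rewrite sqr_ge0.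
  by rewrite sqrrB1 expr_div_n -[_ / 2 *+ 2]mulr_natr; set v := `|t|; lra.
rewrite -expRD ler_expR -(mulr_natr 2); lra.
Qed.

Section Derivative.
Variable th : R.

(** The phase [th] treats both parts at once: th = 0 gives the cosine integral and th = - pi / 2 the
    sine integral. *)
Let f (s t : R) : R := cos (s * t + th) * w t.

Let trig_derive (g g' : R -> R) (b x t : R) :
  (forall z : R, is_derive z 1 g (g' z)) ->
  is_derive t 1 (fun t => g (x * t + b)) (x * g' (x * t + b)).
Proof.
move=> gd; have d1 : is_derive t 1 (fun t : R => x * t + b) x.
  by apply: is_derive_eq; rewrite /GRing.scale /=; ring.
have := @is_derive1_comp R g (fun t : R => x * t + b) t _ _ (gd _) d1; rewrite mulrC; exact.
Qed.

Let sin_derive (x t : R) : is_derive t 1 (fun t => sin (x * t + th)) (x * cos (x * t + th)).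
Proof. by apply: (@trig_derive sin cos th x t) => z; exact: is_derive_sin. Qed.

Let cos_param_derive (s t : R) : is_derive s 1 (f ^~ t) (- (t * sin (s * t + th) * w t)).
Proof.
have d1 : is_derive s 1 (fun s => cos (s * t + th)) (t * - sin (s * t + th)).
  under eq_fun do rewrite [_ * t]mulrC; rewrite [s * t]mulrC.
  by apply: (@trig_derive cos (fun z => - sin z) th t s) => z; exact: is_derive_cos.
have -> : f ^~ t = (fun s => w t * cos (s * t + th)) by apply/funext => x; rewrite /f mulrC.
have d2 := @is_deriveZ R R R _ (w t) s 1 _ d1.
by apply: (is_derive_eq d2); rewrite /GRing.scale /=; ring.
Qed.

Let measurable_trig (g : R -> R) (s : R) : continuous g ->
  measurable_fun setT (fun t : R => g (s * t + th)).
Proof.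
move=> cg; apply: continuous_measurable_fun => t.
apply: (@continuous_comp _ _ _ (fun t : R => s * t + th) g); last exact: cg.
by apply: cvgD; [apply: cvgMr; exact: cvg_id|exact: cvg_cst].
Qed.

Let f_integrable s : mu.-integrable setT (EFin \o f s).
Proof.
apply: (le_integrable _ _ _ w_integrable) => //.
  apply/measurable_EFinP; apply: measurable_funM => //.
  by apply: measurable_trig; exact: continuous_cos.
move=> t _ /=; rewrite lee_fin normrM ler_piMl// ler_norml cos_le1 cos_geN1//.
Qed.

Let tsin_integrable s : mu.-integrable setT (EFin \o (fun t => t * sin (s * t + th) * w t)).
Proof.
apply: (le_integrable _ _ _ norm_mul_w_integrable) => //.
  apply/measurable_EFinP; apply: measurable_funM => //.
  by apply: measurable_funM => //; apply: measurable_trig; exact: continuous_sin.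
move=> t _ /=; rewrite lee_fin !normrM normr_id ler_wpM2r// ler_piMr//.
by rewrite ler_norml sin_le1 sin_geN1.
Qed.

Let phi (s : R) : R := (\int[mu]_t f s t)%R.

Let phi_derive (s : R) : is_derive s (1 : R) phi (- (\int[mu]_t (t * sin (s * t + th) * w t))%R).
Proof.
have Is : (`]s - 1, s + 1[%classic : set R) s by rewrite /= in_itv /=; apply/andP; split; lra.
have d1 x t : derivable (f ^~ t) x 1 by have := cos_param_derive x t; case.
have p1 x t : partial1of2 f x t = - (t * sin (x * t + th) * w t).
  by rewrite partial1of2E; have [_ ->] := cos_param_derive x t.
have Gub x t : (`]s - 1, s + 1[%classic : set R) x -> setT t -> `|partial1of2 f x t| <= `|t| * w t.
  move=> _ _; rewrite p1 normrN !normrM (ger0_norm (w_ge0 t)) ler_wpM2r// ler_piMr//.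
  by rewrite ler_norml sin_le1 sin_geN1.
have G0 t : 0 <= `|t| * w t by rewrite mulr_ge0.
have intf x : (`]s - 1, s + 1[%classic : set R) x -> mu.-integrable setT (EFin \o f x).
  by move=> _; exact: f_integrable.
apply: DeriveDef.
  exact: (derivable_under_integral measurableT Is intf (fun x y _ _ => d1 x y) G0
    norm_mul_w_integrable Gub).
rewrite -derive1E (differentiation_under_integral measurableT Is intf (fun x y _ _ => d1 x y) G0
    norm_mul_w_integrable Gub).
under eq_Rintegral do rewrite p1 -mulN1r.
by rewrite RintegralZl ?mulN1r//; exact: tsin_integrable.
Qed.

Let F s (t : R) : R := sin (s * t + th) * w t.
Let h s (t : R) : R := s * f s t - t * sin (s * t + th) * w t.

Let F_derive (s t : R) : is_derive t (1 : R) (F s) (h s t).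
Proof.
have d := @is_deriveM R R (fun t => sin (s * t + th)) w t 1 _ _ (sin_derive s t) (w_derive t).
by apply: (is_derive_eq d); rewrite /h /f /GRing.scale /=; ring.
Qed.

Let h_continuous s : continuous (h s).
Proof.
have lin : continuous (fun t : R => s * t + th).
  by move=> t; apply: cvgD; [apply: cvgMr; exact: cvg_id|exact: cvg_cst].
have cw : continuous w by apply: continuous_normal_pdf; exact: oner_neq0.
move=> t; apply: cvgB.
  apply: cvgMr; apply: cvgM; last exact: cw.
  by apply: (@continuous_comp _ _ _ (fun t : R => s * t + th) cos); [exact: lin|exact: continuous_cos].
apply: cvgM; last exact: cw.
apply: cvgM; first exact: cvg_id.
by apply: (@continuous_comp _ _ _ (fun t : R => s * t + th) sin); [exact: lin|exact: continuous_sin].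
Qed.

Let h_integrable s : mu.-integrable setT (EFin \o h s).
Proof.
rewrite /comp /h; under eq_fun do rewrite EFinB EFinM.
apply: integrableB => //; last exact: tsin_integrable.
by apply: integrableZl => //; exact: f_integrable.
Qed.

Let F_le_w s t : `|F s t| <= w t.
Proof.
by rewrite normrM (ger0_norm (w_ge0 t)) ler_piMl// ler_norml sin_le1 sin_geN1.
Qed.

Let w_cvg0 : w n.+1%:R @[n --> \oo] --> (0 : R).
Proof.
have ec : (normal_peak 1 * (expR (- 2^-1) : R) ^+ n.+1) @[n --> \oo] --> (0 : R).
  rewrite -[X in _ --> X](mulr0 (normal_peak 1)); apply: cvgMr.
  rewrite (_ : (fun n => _) = (fun n => geometric 1 (expR (- 2^-1)) (n + 1)%N)).
    have e1 : expR (- 2^-1) < 1 :> R by rewrite expR_lt1 oppr_lt0 invr_gt0.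
    have := @cvg_geometric R 1 (expR (- 2^-1)).
    rewrite ger0_norm ?expR_ge0// => /(_ e1).
    by rewrite cvg_shiftn.
  by apply/funext => n; rewrite /geometric /= mul1r addn1.
apply: (@squeeze_cvgr _ _ _ _ (cst 0) _ _ _ _ _ ec); last exact: cvg_cst.
apply: nearW => n; rewrite w_ge0 /= wE ler_wpM2l ?normal_peak_ge0//.
rewrite -expRM_natl ler_expR mulrN lerN2.
have : 1 <= n.+1%:R :> R by rewrite ler1n.
by rewrite expr2; set v := n.+1%:R => v1; nra.
Qed.

Let int_h_itv s n : (\int[mu]_(t in `[(- n.+1%:R)%R, n.+1%:R]) h s t = F s n.+1%:R - F s (- n.+1%:R))%R.
Proof.
have F_cont t : {for t, continuous (F s)}.
  by apply/differentiable_continuous/derivable1_diffP; have [] := F_derive s t.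
rewrite /Rintegral (@continuous_FTC2 _ (h s) (F s))//.
- have n0 : 0 < n.+1%:R :> R by rewrite ltr0n.
  by lra.
- by apply: continuous_subspaceT; exact: h_continuous.
- split=> [t _||]; first by have [] := F_derive s t.
    exact: (cvg_at_right_filter (F_cont _)).
  exact: (cvg_at_left_filter (F_cont _)).
- by move=> t _; rewrite derive1E; have [_ ->] := F_derive s t.
Qed.

(** [h s] is the derivative of [F s], which tends to 0 at both ends of the growing intervals. *)
Let int_h s : (\int[mu]_t h s t = 0)%R.
Proof.
pose D n : set R := `[(- n.+1%:R)%R, n.+1%:R]%classic.
have mh : measurable_fun setT (EFin \o h s) by exact: measurable_int (h_integrable s).
have mh' : measurable_fun setT (h s) by exact/measurable_EFinP.
have [|||||_ _ H] := @dominated_convergence _ _ R mu setT measurableT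
  (fun n => EFin \o (h s \_ (D n))) (EFin \o h s) (fun t => `|(h s t)%:E|%E).
- move=> n; apply/measurable_EFinP; rewrite /D.
  by apply/(measurable_restrictT _ _).1 => //; exact: measurable_funTS.
- by [].
- apply: aeW => t _; apply: cvg_near_cst.
  exists (Num.bound `|t|) => // n /= tn; rewrite /= patchE mem_set// /D /= in_itv /=.
  rewrite -ler_norml (le_trans (ltW (archi_boundP (normr_ge0 t))))// ler_nat.
  by rewrite (leq_trans tn).
- exact: integrable_abse (h_integrable s).
- apply: aeW => t n _ /=; rewrite lee_fin patchE; case: ifPn => // _.
  by rewrite normr0.
have lim0 : (F s n.+1%:R - F s (- n.+1%:R)) @[n --> \oo] --> (0 : R).
  apply: norm_cvg0; apply: (@squeeze_cvgr _ _ _ _ (cst 0) (fun n => w n.+1%:R + w n.+1%:R)).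
  - apply: nearW => n; rewrite normr_ge0 /= (le_trans (ler_normB _ _))// lerD//.
    by rewrite (le_trans (F_le_w _ _))// !wE sqrrN.
  - exact: cvg_cst.
  - by rewrite -[X in _ --> X]addr0; exact: (cvgD w_cvg0 w_cvg0).
have E n : (\int[mu]_t (EFin \o (h s \_ (D n))) t)%E = (F s n.+1%:R - F s (- n.+1%:R))%:E.
  rewrite -int_h_itv /Rintegral fineK; last first.
    apply: integrable_fin_num => //; exact: integrableS (h_integrable s).
  rewrite [RHS]integral_mkcond; apply: eq_integral => t _.
  by rewrite /= restrict_EFin.
move: H; rewrite (_ : [sequence _]_n = (fun n => (F s n.+1%:R - F s (- n.+1%:R))%:E)); last first.
  by apply/funext => n /=; rewrite -E.
have hfin : (\int[mu]_x (EFin \o h s) x)%E \is a fin_num.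
  exact: (integrable_fin_num measurableT (h_integrable s)).
rewrite -(fineK hfin) => /fine_cvg H.
exact: (cvg_unique _ H lim0).
Qed.

Let sf_integrable s : mu.-integrable setT (EFin \o (fun t => s * f s t)).
Proof.
rewrite /comp; under eq_fun do rewrite EFinM.
by apply: integrableZl => //; exact: f_integrable.
Qed.

(** Integration by parts: the integral of [h s] vanishes, which turns the differentiated integral
    into - s phi. *)
Let phi_ode (s : R) : is_derive s (1 : R) phi (- s * phi s).
Proof.
apply: (is_derive_eq (phi_derive s)).
have := int_h s; rewrite /h (RintegralB measurableT (sf_integrable s) (tsin_integrable s)).
rewrite (RintegralZl _ measurableT (f_integrable s)).
by rewrite -/(phi s) => /eqP; rewrite subr_eq0 => /eqP <-; rewrite mulNr.
Qed.

Lemma normal_cos_integral s : (\int[mu]_t (cos (s * t + th) * w t) = cos th * expR (- (s ^+ 2 / 2)))%R.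
Proof.
have phi0 : phi 0 = cos th.
  rewrite /phi /f; under eq_Rintegral do rewrite mul0r add0r.
  rewrite RintegralZl// (_ : \int[mu]_t w t = 1) ?mulr1//.
  by rewrite /Rintegral integral_normal_pdf.
pose G (x : R) := phi x * expR (x ^+ 2 / 2).
have G' x : is_derive x (1 : R) G 0.
  have d1 : is_derive x (1 : R) (fun x : R => x ^+ 2 / 2) x.
    by apply: is_derive_eq; rewrite /GRing.scale /=; field.
  have d2 := @is_derive1_comp R expR (fun x : R => x ^+ 2 / 2) x _ _ (is_derive_expR _) d1.
  have d3 := @is_deriveM R R phi (expR \o (fun x : R => x ^+ 2 / 2)) x 1 _ _ (phi_ode x) d2.
  by apply: (is_derive_eq d3); rewrite /GRing.scale /=; ring.
have := is_derive_0_is_cst s 0 G'; rewrite /G phi0 expr0n /= mul0r expR0 mulr1 => <-.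
by rewrite -mulrA -expRD subrr expR0 mulr1.
Qed.

End Derivative.

Let integral_normal_prob (g : R -> R) (M : R) : measurable_fun setT g -> (forall t, `|g t| <= M) ->
  (\int[normal_prob 0 1 : probability (measurableTypeR R) R]_t g t = \int[mu]_t (g t * w t))%R.
Proof.
move=> mg gM; have dom := @normal_prob_dominates R 0 1.
have gi : (normal_prob 0 1 : probability (measurableTypeR R) R).-integrable setT (EFin \o g).
  exact: (@bounded_measurable_integrable R _ (measurableTypeR R) (normal_prob 0 1) g M mg gM).
rewrite /Rintegral -(Radon_Nikodym_change_of_variables dom)//; congr fine.
apply: ae_eq_integral => //.
- apply: emeasurable_funM; first exact/measurable_EFinP.
  by apply: (measurable_int mu); exact: Radon_Nikodym_integrable.
- by apply/measurable_EFinP; apply: measurable_funM.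
- under [X in ae_eq _ _ _ X]eq_fun do rewrite EFinM.
  apply: ae_eqe_mul2l => /=.
  rewrite Radon_NikodymE//=; case: cid => /= k [k1 k2 k3].
  apply: integral_ae_eq => //=.
  + exact/measurable_EFinP.
  + by move=> E E01 mE; rewrite -k3.
Qed.

Lemma Ec_normal (s : R) :
  Ec (normal_prob 0 1 : probability (measurableTypeR R) R) (fun t => cis (s * t)) =
  (expR (- ((2 * pi * s) ^+ 2 / 2)))%:C%C.
Proof.
have mtrig (g : R -> R) : continuous g -> measurable_fun setT (fun t : R => g (2 * pi * (s * t))).
  move=> cg; apply: continuous_measurable_fun => t.
  apply: (@continuous_comp _ _ _ (fun t : R => 2 * pi * (s * t)) g); last exact: cg.
  by apply: cvgMr; apply: cvgMr; exact: cvg_id.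
apply: complexP => /=.
  rewrite (integral_normal_prob (M := 1)); last 2 first.
  - by apply: mtrig; exact: continuous_cos.
  - by move=> t; rewrite ler_norml cos_le1 cos_geN1.
  have := normal_cos_integral 0 (2 * pi * s); rewrite cos0 mul1r => <-.
  by apply: eq_Rintegral => t _; rewrite addr0 !mulrA.
rewrite (integral_normal_prob (M := 1)); last 2 first.
- by apply: mtrig; exact: continuous_sin.
- by move=> t; rewrite ler_norml sin_le1 sin_geN1.
transitivity (\int[mu]_t (cos (2 * pi * s * t + - (pi / 2)) * w t))%R.
  by apply: eq_Rintegral => t _; rewrite cosBpihalf !mulrA.
by rewrite normal_cos_integral cosN cos_pihalf mul0r.
Qed.

End NormalCharacteristicFunction.

(** * The dual as a group of reals, and transforms of laws *)

Section Rate.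
Context {R : realType} {a : nat -> nat} {ha : forall n, (1 < a n)%N}.
Local Notation X := (solenoid R ha).
Local Notation Y := (dual R X).
Local Notation pi_ := (@solenoid_pi R a ha).
Implicit Types y z : Y.

(** X being compact, neighbours z of y are uniformly within 1 of y. Then z - y takes all its values
    in the right half-plane, powers included, hence is trivial. *)
Lemma dual_discrete y : \forall z \near y, z = y.
Proof.
have cy : continuous (y : X -> R[i]^o) by case: (dualP y).
have c1 : ((z : Y) : {compact-open, X -> R[i]^o}) @[z --> y] --> (y : {compact-open, X -> R[i]^o}).
  exact: initial_continuous.
have /(_ _) c2 := (@compact_open_fam_compactP X R[i]^o y ((fun z : Y => (z : X -> R[i]^o)) @ nbhs y) cy _).1 c1.
pose E := [set ab : R[i]^o * R[i]^o | ball ab.1 1 ab.2].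
have entE : entourage E by apply: (@entourage_ball _ _ (PosNum ltr01)).
have := c2 _ (fam_nbhs (y : {family compact, X -> R[i]^o}) entE (solenoid_compact (ha := ha) (R := R))).
rewrite /fmap /=; apply: filterS => z yz.
apply: dual_eqP => x.
suff : (z - y) x = 1.
  rewrite dualDE dualNE => /(congr1 (fun w => w * y x)).
  by rewrite mul1r mulfVK ?dual_neq0.
apply: no_small_subgroup; first exact: dual_norm.
move=> k; rewrite -dual_morphMn; set w := x *+ _.
have := yz w I; rewrite /E -ball_normE /=.
have -> : `|y w - z w| = `|1 - (z - y) w|.
  rewrite dualDE dualNE -[in RHS](divff (dual_neq0 y w)) -mulrBl normrM normfV.
  by rewrite dual_norm invr1 mulr1.
move=> h; have := le_lt_trans (normc_ge_Re (1 - (z - y) w)) h.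
rewrite ltcR raddfB /= => /ltr_normlP[]; lra.
Qed.

Lemma rate_subproof y : exists r : R, forall t, y (pi_ (t, 0)) = cis (r * t).
Proof.
have [n [m ->]] := dual_classification y.
exists (m%:~R / (adic_base (a := a) n)%:R) => t.
rewrite dualMzE level_charE -cisMz /level_phase /= [adic_trunc _ _](@adic_trunc0 a ha) subr0.
by rewrite -mulrzl; congr cis; rewrite mulrAC mulrA.
Qed.

(** The index of the character in H_a, seen in the reals: it is read off from the restriction to the
    one-parameter subgroup t |-> pi (t, 0). Its injectivity, [rate_eq0], expresses that this
    restriction loses nothing. *)
Definition rate y : R := sval (cid (rate_subproof y)).

Lemma rateE y t : y (pi_ (t, 0)) = cis (rate y * t).
Proof. by rewrite /rate; case: cid. Qed.

Lemma cis_linear_inj (r s : R) : (forall t, cis (r * t) = cis (s * t)) -> r = s.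
Proof.
move=> rs; apply/eqP; rewrite -subr_eq0; apply/eqP.
have H t : cis ((r - s) * t) = 1.
  by rewrite mulrBl cisD cisN rs divff// cis_neq0.
apply/eqP/negP => /negP d0.
have [m] := cis_eq1 (H (2^-1 / (r - s))).
rewrite mulrCA divff// mulr1 => h.
have : (2 : R) * 2^-1 = (2 * m)%:~R by rewrite h intrM.
rewrite divff// => /esym/eqP; rewrite -[X in _ == X]/(1%:~R) eqr_int; lia.
Qed.

Lemma rateD : {morph rate : y z / y + z}.
Proof.
move=> y z; apply: cis_linear_inj => t.
by rewrite -rateE dualDE !rateE mulrDl cisD.
Qed.

Lemma rate0 : rate 0 = 0.
Proof. by apply: (addrI (rate 0)); rewrite -rateD !addr0. Qed.

Lemma rateN y : rate (- y) = - rate y.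
Proof. by apply: (addrI (rate y)); rewrite -rateD !subrr rate0. Qed.

Lemma rateMn y n : rate (y *+ n) = rate y *+ n.
Proof. by elim: n => [|n IH]; rewrite ?mulr0n ?rate0// !mulrS rateD IH. Qed.

Lemma rateMz y (m : int) : rate (y *~ m) = rate y *~ m.
Proof. by case: m => n; rewrite ?NegzE ?mulrNz ?rateN -?pmulrn rateMn. Qed.

Lemma rate_eq0 y : (rate y == 0) = (y == 0).
Proof.
apply/eqP/eqP => [|->]; last exact: rate0.
have [n [m ->]] := dual_classification y.
rewrite rateMz.
have -> : rate (level_char n) = (adic_base (a := a) n)%:R^-1.
  apply: cis_linear_inj => t; rewrite -rateE level_charE /level_phase /=.
  by rewrite [adic_trunc _ _](@adic_trunc0 a ha) subr0 mulrC.
move=> /eqP; rewrite -[(_)^-1 *~ m]mulrzr mulf_eq0 invr_eq0 (negbTE (adic_baseR_neq0 (ha := ha) n)) /=.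
by rewrite intr_eq0 => /eqP ->; rewrite mulr0z.
Qed.

Lemma dual_torsion_free y (m : int) : y *~ m = 0 -> m != 0 -> y = 0.
Proof.
move=> /eqP; rewrite -rate_eq0 rateMz -mulrzr mulf_eq0 intr_eq0 => /orP[|/eqP->]; last by rewrite eqxx.
by rewrite rate_eq0 => /eqP.
Qed.

Lemma dual_commensurable y z : y != 0 -> z != 0 ->
  exists k m : int, [/\ k != 0, m != 0 & y *~ k = z *~ m].
Proof.
have [n [k [m [-> ->]]]] := dual_common_level y z.
move=> y0 z0; exists m, k; split.
- by apply: contraNneq z0 => ->.
- by apply: contraNneq y0 => ->.
- by rewrite -!mulrzA mulrC.
Qed.

Lemma continuous_dual (phi : Y -> R) : continuous phi.
Proof.
move=> y U nU; have F : Filter (nbhs y) by exact: nbhs_filter.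
apply: (@filterS _ _ F [set z | z = y]); last exact: dual_discrete.
by move=> _ ->; exact: (nbhs_singleton nU).
Qed.

Lemma gaussian_law (x : X) (c : R) : 0 <= c ->
  exists gamma : probability (borel X) R,
    forall y, charfun gamma y = y x * (expR (- (c * rate y ^+ 2)))%:C%C.
Proof.
(* Solves (2 pi s r)^2 / 2 = c r^2, the exponent supplied by [Ec_normal]. *)
move=> c0; pose s := Num.sqrt (2 * c) / (2 * pi).
pose phi (t : measurableTypeR R) : borel X := pi_ (s * t, 0) + x.
have yphi y t : y (phi t) = y x * cis (rate y * s * t).
  by rewrite /phi dual_morphD rateE mulrC mulrA.
have bmc (r : R) : bm (fun t : measurableTypeR R => cis (r * t)).
  split.
  - have [h _] := (continuous_complexP (@cis R)).1 continuous_cis.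
    by apply: (measurableT_comp (continuous_measurable_fun h)); exact: mulrl_measurable.
  - have [_ h] := (continuous_complexP (@cis R)).1 continuous_cis.
    by apply: (measurableT_comp (continuous_measurable_fun h)); exact: mulrl_measurable.
  - by exists 1 => t; apply: norm1_ReIm; exact: norm_cis.
have mphi : measurable_fun setT phi.
  apply: bm_measurable_to_solenoid => n.
  rewrite (_ : (fun t => _) = (fun t => (level_char n : Y) x * cis (rate (level_char n) * s * t))); last first.
    by apply/funext => t; rewrite yphi.
  exact: bmM (bm_cst _ _) (bmc _).
have [nu nuE] := exists_law (normal_prob 0 1 : probability (measurableTypeR R) R) mphi.
exists nu => y.
rewrite charfunE (Ec_pushforward mphi nuE); last exact: dual_bm.
rewrite (eq_Ec _ (yphi y)) EcZ// Ec_normal; congr (_ * (expR (- _))%:C%C).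
have -> : 2 * pi * (rate y * s) = rate y * Num.sqrt (2 * c).
  rewrite mulrCA /s; congr (_ * _); rewrite mulrC mulfVK//.
  by rewrite mulf_neq0// gt_eqF// pi_gt0.
rewrite exprMn sqr_sqrtr ?mulr_ge0//; lra.
Qed.

Lemma convolution_law (gamma omega : probability (borel X) R) :
  exists2 nu : probability (borel X) R,
    (forall E, measurable E -> nu E = convolution gamma omega E) &
    forall y, charfun nu y = charfun gamma y * charfun omega y.
Proof.
pose P : probability (borel X * borel X)%type R := (gamma \x omega)%E.
pose phi (z : borel X * borel X) : borel X := (z.1 : X) + (z.2 : X).
have mphi : measurable_fun setT phi.
  have m1 : measurable_fun setT (fst : borel X * borel X -> borel X) by exact: measurable_fst.
  have m2 : measurable_fun setT (snd : borel X * borel X -> borel X) by exact: measurable_snd.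
  exact: measurable_solenoidD m1 m2.
have [nu nuE] := exists_law P mphi.
exists nu => // y.
rewrite charfunE (Ec_pushforward mphi nuE); last exact: dual_bm.
have E (z : borel X * borel X) : y (phi z) = y z.1 * y z.2 by exact: dual_morphD.
rewrite (eq_Ec P E) !charfunE.
apply: (@Ec_prod R _ _ (borel X) (borel X) gamma omega P) => //; exact: dual_bm.
Qed.

Lemma charfun_shift (m nu : probability (borel X) R) (x : X) :
  (forall E : set (borel X), measurable E -> nu E = m [set z | E ((z : X) + x)]) ->
  forall y, charfun nu y = y x * charfun m y.
Proof.
move=> nuE y; pose phi (z : borel X) : borel X := (z : X) + x.
have mphi : measurable_fun setT phi.
  apply: measurable_solenoidD; [exact: measurable_id|exact: measurable_cst].
rewrite charfunE (Ec_pushforward mphi nuE); last exact: dual_bm.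
rewrite charfunE -EcZ; last exact: dual_bm.
by apply: eq_Ec => z; rewrite /phi dual_morphD mulrC.
Qed.

Lemma exists_shift (m : probability (borel X) R) (x : X) :
  exists nu : probability (borel X) R,
  forall E : set (borel X), measurable E -> nu E = m [set z | E ((z : X) + x)].
Proof.
pose phi (z : borel X) : borel X := (z : X) + x.
have mphi : measurable_fun setT phi.
  apply: measurable_solenoidD; [exact: measurable_id|exact: measurable_cst].
by have [nu nuE] := exists_law m mphi; exists nu.
Qed.

Lemma eq_probability_Ec d (T : measurableType d) (mu nu : probability T R) (h : T -> R[i]) :
  (forall E, measurable E -> mu E = nu E) -> bm h -> Ec mu h = Ec nu h.
Proof.
move=> munu bh.
exact: (@Ec_pushforward R d T d T nu mu (fun x => x) h (@measurable_id _ T setT) munu bh).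
Qed.

Lemma eq_charfun (mu nu : probability (borel X) R) (y : Y) :
  (forall E, measurable E -> mu E = nu E) -> charfun mu y = charfun nu y.
Proof.
by move=> munu; rewrite !charfunE; apply: eq_probability_Ec => //; exact: dual_bm.
Qed.

Lemma gaussian_idempotent_charfun (mu : probability (borel X) R) (S : set Y)
    (x : X) (c : R) : zmod_subgroup S -> 0 <= c ->
  (forall y, charfun mu y =
     y x * (expR (- (c * rate y ^+ 2)))%:C%C * (`[< S y >])%:R) ->
  gaussian_idempotent mu.
Proof.
move=> SS c0 muE.
have [m [mE mA]] : exists m : probability (borel X) R,
    (forall y : Y, charfun m y = (`[< S y >])%:R) /\ m (annihilator S) = 1%E.
  have [S0|S0] := pselect (exists2 y, S y & y != 0); first exact: annihilator_haar.
  have S0E y : S y -> y = 0.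
    by move=> Sy; apply: contra_notP S0 => /eqP y0; exists y.
  (* When S is zero, [mu] itself has the transform wanted for m: 1 at 0 and 0 elsewhere. *)
  exists mu; split=> [y|].
    rewrite muE; case: asboolP => [/S0E ->|_]; last by rewrite mulr0.
    by rewrite rate0 expr0n /= mulr0 oppr0 expR0 !mulr1.
  rewrite (_ : annihilator S = setT) ?probability_setT//.
  by apply/seteqP; split => // z _ y /S0E ->.
have [gamma gammaE] := gaussian_law x c0.
have [nu nuE nuC] := convolution_law gamma m.
exists gamma, m; split.
- exists x, (fun y => c * rate y ^+ 2); split => //.
  + exact: continuous_dual.
  + by move=> y; rewrite mulr_ge0// sqr_ge0.
  + by move=> u v; rewrite !rateD rateN; ring.
- exists (annihilator S), m, 0; split.
  + apply: (subclosed_compact _ (solenoid_compact (ha := ha) (R := R))) => //.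
    exact: annihilator_closed.
  + split=> [y Sy|z w zS wS y Sy]; first by rewrite dual_morph0.
    by rewrite dual_morphD dual_morphN zS// wS// invr1 mulr1.
  (* Translation by k multiplies the transform by y k, which is 1 on S, the only place where the
     transform is nonzero; uniqueness gives invariance. *)
  + split => // k kS E mE'.
    have [m' m'E] := exists_shift m k.
    rewrite -m'E//; apply: charfun_unique => // y.
    rewrite (charfun_shift m'E) mE; case: asboolP => [Sy|_]; last by rewrite mulr0.
    by rewrite kS// mul1r.
  + by move=> E mE'; under eq_set do rewrite addr0.
- move=> E mE'; rewrite -nuE//; apply: charfun_unique => // y.
  by rewrite nuC gammaE mE.
Qed.

Lemma solenoid_hausdorff : hausdorff_space X.
Proof.
move=> p q pq; apply/eqP; rewrite -subr_eq0; apply/eqP.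
apply: level_char_separates => n; set y : Y := level_char n.
have eq_lim (f : X -> R) : continuous f -> f p = f q.
  move=> cf; apply: (@Rhausdorff R) => A B nA nB.
  have [x [Ax Bx]] := pq _ _ (cf p _ nA) (cf q _ nB).
  by exists (f x).
have [cR cI] := dual_continuous y.
have -> : y (p - q) = y p / y q by rewrite dual_morphD dual_morphN.
by rewrite (complexP (eq_lim _ cR) (eq_lim _ cI)) divff// dual_neq0.
Qed.

(** Invariance under k in K gives (y k - 1) times the transform equal to 0: it vanishes unless y is
    trivial on K. *)
Lemma haar_charfun (K : set X) (m : probability (borel X) R) (y : Y) :
  compact K -> haar_distribution K m -> charfun m y = 0 \/ charfun m y = 1.
Proof.
move=> cK [mK mI].
have [[k Kk yk]|yK] := pselect (exists2 k, K k & y k != 1).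
  left; have [nu nuE] := exists_shift m k.
  have : charfun nu y = charfun m y.
      by apply: eq_charfun => E mE; rewrite nuE// mI.
  rewrite (charfun_shift nuE) => /eqP.
  rewrite -[X in _ == X]mul1r -subr_eq0 -mulrBl mulf_eq0 subr_eq0 (negbTE yk) /=.
  by move/eqP.
have {}yK k : K k -> y k = 1.
  by move=> Kk; apply: contra_notP yK => /eqP yk; exists k.
have mK' : measurable (K : set (borel X)).
  by apply: borel_closed_measurable; exact: compact_closed solenoid_hausdorff cK.
have mKC : m (~` K) = 0%E by rewrite probability_setC// mK subee.
right; have [h1 h2 _] := dual_bm y.
have R1 (f : X -> R) (c : R) : measurable_fun setT (f : borel X -> R) ->
    (forall x, K x -> f x = c) -> (\int[m]_(x in setT) f x)%R = c.
  move=> mf fc.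
  rewrite /Rintegral (@ae_eq_integral _ _ _ m setT (EFin \o cst c))//.
  - by rewrite /comp /= integral_cst// [X in (_ * X)%E]probability_setT mule1.
  - exact/measurable_EFinP.
  - exact/measurable_EFinP.
  - exists (~` K); split => //; first exact: measurableC.
    by move=> x /= H Kx; apply: H => _; rewrite /= fc.
rewrite /charfun (R1 _ 1 h1) ?(R1 _ 0 h2)// => x /yK -> //.
Qed.

(** The obstruction for the counterexamples. Shifts have modulus 1 and the Haar factor is 0 or 1, so
    that only phi remains visible in the modulus. *)
Lemma gaussian_idempotent_norm (mu : probability (borel X) R) :
  gaussian_idempotent mu -> exists phi : Y -> R,
    (forall u v, phi (u + v) + phi (u - v) = 2 * (phi u + phi v)) /\
    forall y, charfun mu y = 0 \/ `|charfun mu y| = (expR (- phi y))%:C%C.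
Proof.
move=> [gamma [omega [[x [phi [_ _ phiD gammaE]]] [K [m [x' [cK _ hK omE]]]] muE]]].
exists phi; split => // y.
have [nu nuE nuC] := convolution_law gamma omega.
have -> : charfun mu y = charfun nu y.
  by apply: eq_charfun => E mE; rewrite muE// -nuE.
rewrite nuC (charfun_shift omE) gammaE.
have [->|->] := haar_charfun y cK hK; first by left; rewrite !mulr0.
right; rewrite !normrM !dual_norm normr1 mulr1 mul1r mulr1.
by rewrite ger0_norm// ler0c expR_ge0.
Qed.

Lemma bm_dual_prod (u v : Y) : bm (fun x : borel X * borel X => u x.1 * v x.2).
Proof.
have mf : measurable_fun setT (fst : borel X * borel X -> borel X) by exact: measurable_fst.
have ms : measurable_fun setT (snd : borel X * borel X -> borel X) by exact: measurable_snd.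
exact: bmM (bm_dual_comp u mf) (bm_dual_comp v ms).
Qed.

Section IndependentForms.
Context d (Omega : measurableType d) (P : probability Omega R).
Variables xi1 xi2 : {RV P >-> borel X}.

Lemma independent_charfun : independent_RV P xi1 xi2 -> forall y z : Y,
  Ec P (fun w => y (xi1 w) * z (xi2 w)) =
  charfun (distribution P xi1) y * charfun (distribution P xi2) z.
Proof.
move=> ind y z.
pose phi w : (borel X * borel X)%type := (xi1 w, xi2 w).
have mphi : measurable_fun setT phi by exact: measurable_fun_pair.
have [Q QE] := exists_law P mphi.
have QP E : measurable E -> Q E = (distribution P xi1 \x distribution P xi2)%E E.
  move=> mE; symmetry.
  apply: (@product_measure_unique _ _ _ _ _ (distribution P xi1) (distribution P xi2) Q) mE => A B mA mB.
  transitivity (P (phi @^-1` (A `*` B))); last exact: ind.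
  by apply: QE; exact: measurableX.
rewrite !charfunE -(Ec_prod QP); [|exact: dual_bm|exact: dual_bm].
by rewrite (Ec_pushforward mphi QE (bm_dual_prod y z)).
Qed.

Let forms_char (u v : Y) (p q : int) (x1 x2 : X) :
  u (x1 + x2) * v (x1 *~ p + x2 *~ q) = (u + v *~ p) x1 * (u + v *~ q) x2.
Proof.
by rewrite !dualDE !dualMzE !dual_morphD !dual_morphMz mulrACA.
Qed.

Let forms_charN (u v : Y) (p q : int) (x1 x2 : X) :
  u (x1 + x2) * v (- (x1 *~ p + x2 *~ q)) = (u - v *~ p) x1 * (u - v *~ q) x2.
Proof. by rewrite -!mulNrz -forms_char dualNE dual_morphN. Qed.

(** The character (u, v) at (L1, L2) transposes to u + p v at the first variable and u + q v at the
    second; the converse direction is uniqueness of joint transforms. *)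
Lemma cond_symmetric_charfun (p q : int) : independent_RV P xi1 xi2 ->
  cond_symmetric P
    (fun w => (xi1 w : X) + (xi2 w : X))
    (fun w => (xi1 w : X) *~ p + (xi2 w : X) *~ q) <->
  forall u v : Y,
    charfun (distribution P xi1) (u + v *~ p) * charfun (distribution P xi2) (u + v *~ q) =
    charfun (distribution P xi1) (u - v *~ p) * charfun (distribution P xi2) (u - v *~ q).
Proof.
move=> ind.
pose L1 w : borel X := (xi1 w : X) + (xi2 w : X).
pose L2 w : borel X := (xi1 w : X) *~ p + (xi2 w : X) *~ q.
have m1 : measurable_fun setT L1 by apply: measurable_solenoidD.
have m2 : measurable_fun setT L2.
  by apply: measurable_solenoidD; apply: measurable_solenoidMz.
pose phi w : (borel X * borel X)%type := (L1 w, L2 w).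
pose psi w : (borel X * borel X)%type := (L1 w, - (L2 w : X)).
have mphi : measurable_fun setT phi by exact: measurable_fun_pair.
have mpsi : measurable_fun setT psi.
  by apply: measurable_fun_pair => //; apply: measurable_solenoidN.
have [Q QE] := exists_law P mphi.
have [Q' QE'] := exists_law P mpsi.
have EQ (u v : Y) : Ec Q (fun x => u x.1 * v x.2) =
    charfun (distribution P xi1) (u + v *~ p) * charfun (distribution P xi2) (u + v *~ q).
  rewrite (Ec_pushforward mphi QE (bm_dual_prod u v)) -independent_charfun//.
  by apply: eq_Ec => w; exact: forms_char.
have EQ' (u v : Y) : Ec Q' (fun x => u x.1 * v x.2) =
    charfun (distribution P xi1) (u - v *~ p) * charfun (distribution P xi2) (u - v *~ q).
  rewrite (Ec_pushforward mpsi QE' (bm_dual_prod u v)) -independent_charfun//.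
  by apply: eq_Ec => w; exact: forms_charN.
split=> [sym u v|H E mE].
  rewrite -EQ -EQ'; apply: (eq_probability_Ec _ (bm_dual_prod u v)) => E mE.
  by rewrite QE// QE'//; exact: sym.
transitivity (Q E); first by rewrite QE.
transitivity (Q' E); last by rewrite QE'.
apply: joint_charfun_unique mE => u v; rewrite EQ EQ'; exact: H.
Qed.

End IndependentForms.

Lemma independent_realization (mu1 mu2 : probability (borel X) R) :
  exists (P : probability (borel X * borel X)%type R)
    (xi1 xi2 : {RV P >-> borel X}),
  [/\ independent_RV P xi1 xi2,
      forall E, measurable E -> distribution P xi1 E = mu1 E &
      forall E, measurable E -> distribution P xi2 E = mu2 E].
Proof.
pose P : probability (borel X * borel X)%type R := (mu1 \x mu2)%E.
have m1 : measurable_fun setT (fst : borel X * borel X -> borel X) by exact: measurable_fst.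
have m2 : measurable_fun setT (snd : borel X * borel X -> borel X) by exact: measurable_snd.
pose xi1 : {RV P >-> borel X} := HB.pack (fst : borel X * borel X -> borel X) (isMeasurableFun.Build _ _ _ _ _ m1).
pose xi2 : {RV P >-> borel X} := HB.pack (snd : borel X * borel X -> borel X) (isMeasurableFun.Build _ _ _ _ _ m2).
have E1 E : measurable E -> P (xi1 @^-1` E) = mu1 E.
  move=> mE; rewrite (_ : xi1 @^-1` E = E `*` setT); last first.
    by apply/seteqP; split => -[u v] //= [].
  by rewrite /P /= product_measure1E// [X in (_ * X)%E]probability_setT mule1.
have E2 E : measurable E -> P (xi2 @^-1` E) = mu2 E.
  move=> mE; rewrite (_ : xi2 @^-1` E = setT `*` E); last first.
    by apply/seteqP; split => -[u v] //= [].
  by rewrite /P /= product_measure1E// [X in (X * _)%E]probability_setT mul1e.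
exists P, xi1, xi2; split => // A B mA mB.
by rewrite E1// E2// -product_measure1E.
Qed.

End Rate.

Lemma parallelogramMn (R : realType) (V : zmodType) (phi : V -> R) :
  (forall u v, phi (u + v) + phi (u - v) = 2 * (phi u + phi v)) ->
  forall u n, phi (u *+ n) = n%:R ^+ 2 * phi u.
Proof.
move=> phiD u.
have phi0 : phi 0 = 0 by have := phiD 0 0; rewrite subr0 addr0; lra.
(* The parallelogram law at (n + 1) u and u is a recurrence of order two, so two consecutive values
   are carried along. *)
suff H n : phi (u *+ n) = n%:R ^+ 2 * phi u /\ phi (u *+ n.+1) = n.+1%:R ^+ 2 * phi u.
  by move=> n; case: (H n).
elim: n => [|n [IH1 IH2]]; first by rewrite mulr0n phi0 mulr1n; split; ring.
split => //; have := phiD (u *+ n.+1) u.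
rewrite -mulrSr [u *+ n.+1]mulrSr addrK -mulrSr IH1 IH2 => h.
have -> : phi (u *+ n.+2) = 2 * (n.+1%:R ^+ 2 * phi u + phi u) - n%:R ^+ 2 * phi u.
  by rewrite -h addrK.
by rewrite -[n.+2%:R]natr1 -[n.+1%:R]natr1; ring.
Qed.

Lemma parallelogramMz (R : realType) (V : zmodType) (phi : V -> R) :
  (forall u v, phi (u + v) + phi (u - v) = 2 * (phi u + phi v)) ->
  forall u (n : int), phi (u *~ n) = n%:~R ^+ 2 * phi u.
Proof.
move=> phiD u [n|n]; first by rewrite -pmulrn (parallelogramMn phiD).
have phi0 : phi 0 = 0 by have := phiD 0 0; rewrite subr0 addr0; lra.
have -> : phi (u *~ Negz n) = phi (u *+ n.+1).
  by have := phiD 0 (u *+ n.+1); rewrite !add0r phi0 NegzE mulrNz -pmulrn; lra.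
by rewrite (parallelogramMn phiD) NegzE mulrNz sqrrN.
Qed.

Lemma mixture {R : realType} d (T : measurableType d) (m1 m2 : probability T R) :
  exists m : probability T R, forall h, bm h -> Ec m h = 2^-1 * (Ec m1 h + Ec m2 h).
Proof.
have h2_ge0 : 0 <= (2^-1 : R) by rewrite invr_ge0.
pose h2 : {nonneg R} := NngNum h2_ge0.
pose s : {measure set T -> \bar R} := measure_add m1 m2.
pose m0 : {measure set T -> \bar R} := mscale h2 s.
have m0T : m0 setT = 1%E.
  rewrite -[m0 setT]/((2^-1)%:E * measure_add m1 m2 setT)%E measure_addE.
  rewrite [X in (_ * (X + _))%E]probability_setT.
  rewrite [X in (_ * (_ + X))%E]probability_setT -EFinD -EFinM.
  by congr EFin; lra.
have [m mE] : exists m : probability T R, forall E, m E = ((2^-1)%:E * measure_add m1 m2 E)%E.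
  pose m : probability T R := HB.pack (Measure.sort m0) (Measure_isProbability.Build _ _ _ m0 m0T).
  by exists m.
exists m => h [h1 h2' [M hM]].
have key (f : T -> R) : measurable_fun setT f -> (forall x, `|f x| <= M) ->
    (\int[m]_x f x = 2^-1 * (\int[m1]_x f x + \int[m2]_x f x))%R.
  move=> mf fM.
  have I (mu : probability T R) : mu.-integrable setT (EFin \o f).
    exact: (bounded_measurable_integrable mu mf fM).
  (* [m + m] and [m1 + m2] have the same values; comparing integrals gives twice the claim. *)
  have : (\int[measure_add m m]_x (f x)%:E = \int[measure_add m1 m2]_x (f x)%:E)%E.
    apply: eq_measure_integral => E _ _.
    transitivity (m E + m E)%E; first exact: measure_addE.
    rewrite !mE.
    rewrite -ge0_muleDl ?lee_fin// -EFinD (_ : 2^-1 + 2^-1 = 1) ?mul1e//; lra.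
  have J (mu nu : probability T R) : fine (\int[measure_add mu nu]_x (f x)%:E) =
      (\int[mu]_x f x + \int[nu]_x f x)%R.
    rewrite integral_measure_add//; [|exact: I|exact: I].
    by rewrite fineD//; apply: integrable_fin_num => //; exact: I.
  by move=> /(congr1 fine); rewrite !J => e; lra.
have -> : (2^-1 : R[i]) = (2^-1 : R)%:C%C by rewrite fmorphV /= rmorph_nat.
apply: complexP.
  by rewrite complexReZ complexReD; apply: key => // x; case: (hM x).
by rewrite complexImZ complexImD; apply: key => // x; case: (hM x).
Qed.

(** * Non-Gaussian pairs for p q different from -3 *)

Section Counterexamples.
Context {R : realType} {a : nat -> nat} {ha : forall n, (1 < a n)%N}.
Local Notation X := (solenoid R ha).
Local Notation Y := (dual R X).
Local Notation y0 := (level_char 0 : Y).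

Lemma level_char0_neq0 : y0 != 0.
Proof.
apply/eqP => y0E; have := level_charE (R := R) (ha := ha) 0 ((2^-1 : R), 0).
rewrite y0E dual0E /level_phase /= [adic_trunc _ _](@adic_trunc0 a ha) subr0.
rewrite /adic_base big_ord0 divr1 => /esym/cis_eq1[m h].
have : (2 : R) * 2^-1 = (2 * m)%:~R by rewrite h intrM.
rewrite divff// => /esym/eqP; rewrite -[X in _ == X]/(1%:~R) eqr_int; lia.
Qed.

Lemma level_char0Mz_inj (m n : int) : y0 *~ m = y0 *~ n -> m = n.
Proof.
move=> /eqP; rewrite -subr_eq0 -mulrzBr => /eqP mn; apply/eqP; rewrite -subr_eq0.
by apply: contraTT level_char0_neq0 => mn0; rewrite negbK; apply/eqP/(dual_torsion_free mn).
Qed.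

(** The characters that some power of c brings into the group generated by [y0]. What counts is
    closure under those divisions by c that exist in the dual. *)
Definition localization (c : int) : set Y :=
  [set y | exists (n : nat) (m : int), y *~ (c ^+ n) = y0 *~ m].

Definition dilate (r : int) (S : set Y) : set Y := [set y *~ r | y in S].

Lemma localization_subgroup c : zmod_subgroup (localization c).
Proof.
split=> [|y z [n [m ym]] [k [l zl]]]; first by exists 0%N, 0; rewrite mul0rz mulr0z.
exists (n + k)%N, (m * c ^+ k - l * c ^+ n).
rewrite mulrzBl exprD mulrzA ym [c ^+ n * _]mulrC mulrzA zl.
by rewrite -!mulrzA -mulrzBr.
Qed.

Lemma localization_div c y : localization c (y *~ c) -> localization c y.
Proof. by move=> [n [m h]]; exists n.+1, m; rewrite exprS mulrzA. Qed.

Lemma localization_y0 c : localization c y0.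
Proof. by exists 0%N, 1. Qed.

Lemma dilate_subgroup r S : zmod_subgroup S -> zmod_subgroup (dilate r S).
Proof.
move=> [S0 SB]; split; first by exists 0; rewrite ?mul0rz.
by move=> _ _ [y Sy <-] [z Sz <-]; exists (y - z); [exact: SB|rewrite mulrzBl].
Qed.

Lemma dilate_localization r c y : localization c y -> dilate r (localization c) (y *~ r).
Proof. by exists y. Qed.

(** Comparing coefficients of [y0], which has infinite order, makes s divide r c^n, although s is
    coprime to r and to c. *)
Lemma not_dilate_localization (r s c : int) : coprimez s (r * c) -> (1 < `|s|)%N ->
  ~ dilate s (localization c) (y0 *~ r).
Proof.
move=> co s1 [y [n [m ym]] yr].
have : y0 *~ (r * c ^+ n) = y0 *~ (m * s).
  by rewrite mulrzA -yr mulrzAC ym -mulrzA.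
move=> /level_char0Mz_inj e.
have : (s %| r * c ^+ n)%Z by rewrite e dvdz_mull.
move: co; rewrite coprimezMr => /andP[sr sc].
rewrite Gauss_dvdzr// => sc'.
have /coprimezP[[u v] /= uv] : coprimez s (c ^+ n) by rewrite coprimezXr.
have : (s %| u * s + v * c ^+ n)%Z by rewrite rpredD// ?dvdz_mull//.
rewrite uv dvdz1; lia.
Qed.

(** With E = r H and D the intersection of r H and s H, [y0 *~ r] lies in E only and its multiple by
    s lies in D. The values 1/2 and 1 there contradict phi (s y) = s^2 phi y. *)
Lemma mixture_charfun (r s c : int) : coprimez s (r * c) -> (1 < `|s|)%N ->
  exists2 mu : probability (borel X) R,
    (forall y, charfun mu y = 2^-1 *
      ((`[< dilate r (localization c) y >])%:R +
       (`[< dilate r (localization c) y /\ dilate s (localization c) y >])%:R)) &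
    ~ gaussian_idempotent mu.
Proof.
move=> co s1; set H := localization c.
have SH : zmod_subgroup H by exact: localization_subgroup.
have r0 : r != 0.
  apply: contraTneq co => ->; rewrite mul0r /coprimez gcdz0; lia.
have s0 : s != 0 by lia.
have nz (n : int) : n != 0 -> y0 *~ n != 0.
  by move=> n0; apply/eqP => /dual_torsion_free/(_ n0)/eqP; rewrite (negbTE level_char0_neq0).
have SE := dilate_subgroup r SH; have SD := dilate_subgroup s SH.
have SED : zmod_subgroup (fun y => dilate r H y /\ dilate s H y).
  split=> [|y z [y1 y2] [z1 z2]]; first by split; [case: SE|case: SD].
  by split; [case: SE => _; apply|case: SD => _; apply].
have H0 := localization_y0 c.
have D0 : dilate r H (y0 *~ r *~ s) /\ dilate s H (y0 *~ r *~ s).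
  by split; [rewrite mulrzAC|]; apply: dilate_localization; exact: zmod_subgroupMz.
have E0 : dilate r H (y0 *~ r) by exact: dilate_localization.
have [m1 [m1E _]] : exists m : probability (borel X) R,
    (forall y, charfun m y = (`[< dilate r H y >])%:R) /\ m (annihilator (dilate r H)) = 1%E.
  by apply: annihilator_haar => //; exists (y0 *~ r) => //; exact: nz.
have [m2 [m2E _]] : exists m : probability (borel X) R,
    (forall y, charfun m y = (`[< dilate r H y /\ dilate s H y >])%:R) /\
    m (annihilator (fun y => dilate r H y /\ dilate s H y)) = 1%E.
  apply: annihilator_haar => //; exists (y0 *~ r *~ s) => //.
  by rewrite -mulrzA; apply: nz; rewrite mulf_neq0.
have [mu muE] := mixture m1 m2.
have fE y : charfun mu y = 2^-1 * ((`[< dilate r H y >])%:R +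
       (`[< dilate r H y /\ dilate s H y >])%:R).
  by rewrite charfunE muE; [rewrite -!charfunE m1E m2E|exact: dual_bm].
exists mu => // /gaussian_idempotent_norm[phi [phiD phiE]].
have half_real : (2^-1 : R[i]) = (2^-1 : R)%:C%C by rewrite fmorphV /= rmorph_nat.
have f1 : charfun mu (y0 *~ r) = (2^-1 : R)%:C%C.
  rewrite fE (asboolT E0) asboolF ?addr0 ?mulr1 ?half_real// => -[_].
  exact: not_dilate_localization.
have f2 : charfun mu (y0 *~ r *~ s) = 1.
  by rewrite fE (asboolT D0) asboolT; [rewrite -natrD mulVf|case: D0].
have phi1 : expR (- phi (y0 *~ r)) = 2^-1.
  have := phiE (y0 *~ r); rewrite f1 => -[/eqP|].
    by rewrite -(rmorph0 (real_complex R)) => /eqP/complexI; lra.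
  by rewrite ger0_norm ?ler0c ?invr_ge0// => /complexI.
have phi2 : phi (y0 *~ r *~ s) = 0.
  have := phiE (y0 *~ r *~ s); rewrite f2 => -[/eqP|]; first by rewrite oner_eq0.
  rewrite normr1 -(rmorph1 (real_complex R)) => /complexI /esym.
  by rewrite -expR0 => /expR_inj /eqP; rewrite oppr_eq0 => /eqP.
move: phi2; rewrite (parallelogramMz phiD) => /eqP.
rewrite mulf_eq0 sqrf_eq0 intr_eq0 (negbTE s0) /= => /eqP phi0.
by move: phi1; rewrite phi0 oppr0 expR0; lra.
Qed.

Lemma dilate1 (S : set Y) : dilate 1 S = S.
Proof. by apply/seteqP; split => [_ [y Sy <-]|y Sy] //; exists y. Qed.

(* With H the localization of the cyclic group <y0> at c:
   - |p|, |q| > 1: c = p - q, (E, D) is (pH, pH & qH) for f and (qH, pH & qH) for g;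
   - p - q odd: c = p - q, (E, D) = (H, 2H) for both;
   - p = s + c, q = s - c: (E, D) = (H, sH) for both, and |s| > 1 unless p q = -3. *)
Lemma non_gaussian_pair (p q : int) : coprimez p q -> p * q != 0 -> p * q != -3 ->
  p + q != 0 -> p - q != 0 ->
  exists mu1 mu2 : probability (borel X) R,
  [/\ ~ gaussian_idempotent mu1, ~ gaussian_idempotent mu2 &
   forall u v : Y, charfun mu1 (u + v *~ p) * charfun mu2 (u + v *~ q) =
                   charfun mu1 (u - v *~ p) * charfun mu2 (u - v *~ q)].
Proof.
move=> copq pq0 pq3 pDq pBq.
(* Replacing v by - v exchanges the two sides, so that only points where the left side is nonzero
   need checking. *)
have symm (f g : Y -> R[i]) :
  (forall u v, f (u + v *~ p) * g (u + v *~ q) != 0 ->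
     f (u + v *~ p) * g (u + v *~ q) = f (u - v *~ p) * g (u - v *~ q)) ->
  forall u v, f (u + v *~ p) * g (u + v *~ q) = f (u - v *~ p) * g (u - v *~ q).
  move=> H u v.
  have [e1|] := eqVneq (f (u + v *~ p) * g (u + v *~ q)) 0; last exact: H.
  have [->//|] := eqVneq (f (u - v *~ p) * g (u - v *~ q)) 0.
  by have := H u (- v); rewrite !mulNrz !opprK => h /h ->.
have half_asbool_neq0 (A B : Prop) :
  (2^-1 : R[i]) * ((`[< A >])%:R + (`[< A /\ B >])%:R) != 0 -> A.
  by case: asboolP => // nA; rewrite asboolF ?addr0 ?mulr0 ?eqxx// => -[].
have shift (S : set Y) x y : zmod_subgroup S -> S (x - y) -> `[< S x >] = `[< S y >].
  move=> SS Sxy; apply: asbool_equiv_eq; split=> Sx.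
    by rewrite (_ : y = x - (x - y)); [case: SS => _; apply|rewrite subKr].
  by rewrite (_ : x = (x - y) + y); [exact: zmod_subgroupD|rewrite subrK].
have asbool2 (A B C D : Prop) : `[< A >] = `[< C >] -> `[< B >] = `[< D >] ->
    `[< A /\ B >] = `[< C /\ D >].
  by rewrite !asbool_and => -> ->.
have [[k l] /= kl] := coprimezP _ _ copq.
have bezout (m n x y : int) : x * m + y * n = 1 -> coprimez m n.
  by move=> xy; apply/coprimezP; exists (x, y).
have [/andP[p1 q1]|pq1] := boolP ((1 < `|p|)%N && (1 < `|q|)%N).
  pose c := p - q; pose H := localization c.
  have SH : zmod_subgroup H by exact: localization_subgroup.
  have coqp : coprimez q p by rewrite coprimez_sym.
  have [|//|f fE fG] := @mixture_charfun p q c.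
    by rewrite coprimezMr coqp /c (bezout _ _ (k + l) k)//; lia.
  have [|//|g gE gG] := @mixture_charfun q p c.
    by rewrite coprimezMr copq /c (bezout _ _ (k + l) (- l))//; lia.
  exists f, g; split=> //; apply: symm => u v.
  rewrite fE gE mulf_eq0 negb_or => /andP[/half_asbool_neq0[x Hx ex] /half_asbool_neq0[y Hy ey]].
  (* Both arguments are in H, hence so is their difference (p - q) v, and H allows the division by
     c. It follows that u lies in p H and in q H, so that each membership is unchanged when v
     becomes - v. *)
  have Hv : H v.
    apply: localization_div; rewrite mulrzBr.
    rewrite (_ : _ - _ = x *~ p - y *~ q); last by rewrite ex ey opprD addrACA subrr add0r.
    by case: (SH) => _; apply; exact: zmod_subgroupMz.
  have up : dilate p H u by exists (x - v); [case: SH => _; apply|rewrite mulrzBl ex addrK].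
  have uq : dilate q H u by exists (y - v); [case: SH => _; apply|rewrite mulrzBl ey addrK].
  have Sp := dilate_subgroup p SH; have Sq := dilate_subgroup q SH.
  have vp : dilate p H (v *~ p) by exists v.
  have vq : dilate q H (v *~ q) by exists v.
  have pm (S : set Y) w : zmod_subgroup S -> S u -> `[< S (u + w) >] = `[< S (u - w) >].
    move=> SS Su; apply: asbool_equiv_eq; split=> h.
      have -> : u - w = u + u - (u + w) by rewrite [u + w]addrC opprD addrACA subrr addr0.
      by case: (SS) => _; apply => //; exact: zmod_subgroupD.
    have -> : u + w = u + u - (u - w) by rewrite opprB [w - u]addrC addrA addrK.
    by case: (SS) => _; apply => //; exact: zmod_subgroupD.
  rewrite !fE !gE (asbool2 _ _ _ _ (pm _ _ Sp up) (pm _ _ Sq uq)) (pm _ _ Sp up).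
  by rewrite (asbool2 _ _ _ _ (pm _ _ Sq uq) (pm _ _ Sp up)) (pm _ _ Sq uq).
have [[c e]|[c [s [e1 e2]]]] : (exists c, p - q = 2 * c + 1) \/
    (exists c s, p = s + c /\ q = s - c).
- have : (exists c, p - q = 2 * c + 1) \/ (exists c, p - q = 2 * c).
    have := divz_eq (p - q) 2; have := modz_ge0 (p - q) (isT : (2 : int) != 0).
    have := @ltz_pmod (p - q) 2 isT.
    move: (modz _ _) (divz _ _) => r d h1 h2 h3.
    have [r0|r1] : r = 0 \/ r = 1 by lia.
      by right; exists d; lia.
    by left; exists d; lia.
  by case=> -[c e]; [left; exists c|right; exists c, (q + c)]; lia.
- set c' := p - q; pose H := localization c'.
  have SH : zmod_subgroup H by exact: localization_subgroup.
  have [|//|f fE fG] := @mixture_charfun 1 2 c'.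
    by rewrite mul1r (bezout _ _ (- c) 1)// /c'; lia.
  rewrite !dilate1 in fE.
  exists f, f; split=> //; apply: symm => u v.
  rewrite !fE mulf_eq0 negb_or => /andP[/half_asbool_neq0 Hx /half_asbool_neq0 Hy].
  have Hv : H v.
    apply: localization_div; rewrite mulrzBr.
    rewrite (_ : _ - _ = (u + v *~ p) - (u + v *~ q)); last by rewrite opprD addrACA subrr add0r.
    by case: (SH) => _; apply.
  (* u + n v and u - n v differ by 2 n v, an element of 2 H: each of the two factors is separately
     even in v. *)
  have d2 n : dilate 2 H ((u + v *~ n) - (u - v *~ n)).
    exists (v *~ n); first exact: zmod_subgroupMz.
    by rewrite opprB [u + _]addrC addrACA subrr addr0 -mulrzDr -mulrzA; congr (_ *~ _); lia.
  have d1 n : H ((u + v *~ n) - (u - v *~ n)).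
    by have [x Hx' <-] := d2 n; exact: zmod_subgroupMz.
  have S2 := dilate_subgroup 2 SH.
  rewrite (asbool2 _ _ _ _ (shift _ _ _ SH (d1 p)) (shift _ _ _ S2 (d2 p))) (shift _ _ _ SH (d1 p)).
  by rewrite (asbool2 _ _ _ _ (shift _ _ _ SH (d1 q)) (shift _ _ _ S2 (d2 q))) (shift _ _ _ SH (d1 q)).
pose H := localization c.
have SH : zmod_subgroup H by exact: localization_subgroup.
have [||f fE fG] := @mixture_charfun 1 s c.
(* k p + l q = 1 reads (k + l) s + (k - l) c = 1. *)
- by rewrite mul1r (bezout _ _ (k + l) (k - l))//; rewrite -kl e1 e2; ring.
(* Here |p| = 1 or |q| = 1. Then s = 1 or s = -1 would force p = q or p q = -3, while s = 0 would
   give p + q = 0. *)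
- have : p = 1 \/ p = -1 \/ q = 1 \/ q = -1 by lia.
  by case=> [|[|[|]]] ?; lia.
rewrite !dilate1 in fE.
exists f, f; split=> //; apply: symm => u v.
rewrite !fE mulf_eq0 negb_or => /andP[/half_asbool_neq0 Hx /half_asbool_neq0 Hy].
have Hv : H (v *~ 2).
  apply: localization_div.
  rewrite (_ : _ *~ _ = (u + v *~ p) - (u + v *~ q)); first by case: (SH) => _; apply.
  rewrite opprD addrACA subrr add0r -mulrzBr -mulrzA; congr (_ *~ _); lia.
have S2 := dilate_subgroup s SH.
(* As p + q = 2 s, u + p v and u - q v agree modulo s H: the factors on the left reappear on the
   right in the other order. *)
have d1 : dilate s H ((u + v *~ p) - (u - v *~ q)).
  exists (v *~ 2) => //.
  by rewrite opprB [u + _]addrC addrACA subrr addr0 -mulrzDr -mulrzA; congr (_ *~ _); lia.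
have d2 : dilate s H ((u + v *~ q) - (u - v *~ p)).
  exists (v *~ 2) => //.
  by rewrite opprB [u + _]addrC addrACA subrr addr0 -mulrzDr -mulrzA; congr (_ *~ _); lia.
have d1H : H ((u + v *~ p) - (u - v *~ q)) by have [x Hx' <-] := d1; exact: zmod_subgroupMz.
have d2H : H ((u + v *~ q) - (u - v *~ p)) by have [x Hx' <-] := d2; exact: zmod_subgroupMz.
rewrite (asbool2 _ _ _ _ (shift _ _ _ SH d1H) (shift _ _ _ S2 d1)) (shift _ _ _ SH d1H).
rewrite (asbool2 _ _ _ _ (shift _ _ _ SH d2H) (shift _ _ _ S2 d2)) (shift _ _ _ SH d2H).
by rewrite mulrC.
Qed.

Lemma automorphism_neq0 (n : int) :
  topological_automorphism (fun x : X => x *~ n) -> n != 0.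
Proof.
move=> [_ _ [g [_ gK _]]]; apply: contra_neq level_char0_neq0 => n0.
by apply: dual_eqP => x; rewrite -(gK x) n0 mulr0z dual_morph0.
Qed.

(** The quotient of y by n is y composed with the inverse automorphism. *)
Lemma automorphism_dual_div (n : int) :
  topological_automorphism (fun x : X => x *~ n) -> forall y : Y, exists z, z *~ n = y.
Proof.
move=> [nD _ [g [fgK gfK gc]]] y.
have gD : {morph g : x x' / x + x'}.
  have gE x : g x *~ n = x := gfK x.
  move=> x x'; suff -> : x + x' = (g x + g x') *~ n by rewrite [LHS]fgK.
  by rewrite mulrzDl !gE.
have zP : is_character (fun x => y (g x)).
  have [yc y1 yD] := dualP y; split => [x|//|x x']; last by rewrite gD yD.
  exact: (@continuous_comp X X R[i]^o g y x (gc x) (yc (g x))).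
exists (Dual zP); apply: dual_eqP => x.
by rewrite dualMzE -dual_morphMz /= fgK.
Qed.

End Counterexamples.

Section ComplexModulus.
Context {R : realType}.
Implicit Types z w : R[i].

Definition cabs z : R := complex.Re `|z|.

Lemma cabsE z : (cabs z)%:C%C = `|z|.
Proof. by rewrite /cabs normc_def. Qed.

Lemma cabs_ge0 z : 0 <= cabs z.
Proof. by rewrite -ler0c cabsE. Qed.

Lemma cabsM z w : cabs (z * w) = cabs z * cabs w.
Proof. by apply: complexI; rewrite rmorphM !cabsE normrM. Qed.

Lemma cabs_eq0 z : (cabs z == 0) = (z == 0).
Proof.
rewrite -[RHS]normr_eq0 -cabsE -(rmorph0 (real_complex R)).
by apply/eqP/eqP => [->//|/complexI].
Qed.

Lemma cabs_gt0 z : (0 < cabs z) = (z != 0).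
Proof. by rewrite lt_def cabs_eq0 cabs_ge0 andbT. Qed.

Lemma cabs_norm1 z : `|z| = 1 -> cabs z = 1.
Proof. by rewrite /cabs => ->. Qed.

Lemma cabs1 : cabs 1 = 1. Proof. by apply: cabs_norm1; rewrite normr1. Qed.

Lemma cabsN z : cabs (- z) = cabs z. Proof. by rewrite /cabs normrN. Qed.

Lemma cabsJ z : cabs z^* = cabs z.
Proof. by rewrite /cabs normcJ. Qed.

Lemma cabsD z w : cabs (z + w) <= cabs z + cabs w.
Proof. by rewrite -lecR rmorphD !cabsE ler_normD. Qed.

Lemma cabs_sqr z : cabs z ^+ 2 = complex.Re (z * z^*).
Proof. by rewrite -sqr_normc -cabsE -rmorphXn. Qed.

Lemma cabs_mulJ z : z * z^* = (cabs z ^+ 2)%:C%C.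
Proof. by rewrite -sqr_normc -cabsE -rmorphXn. Qed.

Lemma conj_mul_real z (r : R) : (z * r%:C%C)^* = z^* * r%:C%C.
Proof.
by apply: complexP; rewrite ?complexReJ ?complexImJ ?complexReM ?complexImM ?complexReJ ?complexImJ /=; ring.
Qed.

Lemma conj_div_real z (r : R) : (z / r%:C%C)^* = z^* / r%:C%C.
Proof.
have -> : (r%:C%C)^-1 = (r^-1)%:C%C :> R[i] by rewrite fmorphV.
exact: conj_mul_real.
Qed.

Lemma cabs_cV z : z != 0 -> `|z / (cabs z)%:C%C| = 1.
Proof.
move=> z0; rewrite cabsE normrM normfV normr_id divff// normr_eq0//.
Qed.

Lemma cabsM_diff_le (z z' w w' : R[i]) : cabs z <= 1 -> cabs w' <= 1 ->
  cabs (z * w - z' * w') <= cabs (z - z') + cabs (w - w').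
Proof.
move=> z1 w1; have -> : z * w - z' * w' = z * (w - w') + (z - z') * w' by ring.
apply: le_trans (cabsD _ _) _; rewrite !cabsM addrC lerD//.
  by rewrite -[leRHS]mulr1 ler_wpM2l ?cabs_ge0.
by rewrite -[leRHS]mul1r ler_wpM2r ?cabs_ge0.
Qed.
End ComplexModulus.

(** * Inequalities for transforms *)

Section PositiveType.
Context {R : realType}.

(* The last clause is Krein's inequality for positive definite functions. *)
Definition positive_type (V : zmodType) (f : V -> R[i]) :=
  [/\ f 0 = 1, forall y, f (- y) = (f y)^*, forall y, cabs (f y) <= 1 &
   forall x y (w : R[i]), `|w| = 1 -> f x = w * (cabs (f x))%:C%C ->
     cabs (f (x + y) - w * f y) ^+ 2 <= 2 * (1 - cabs (f x))].

(** The variance of h is nonnegative. *)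
Lemma Ec_jensen d (T : measurableType d) (P : probability T R) (h : T -> R[i]) :
  bm h -> cabs (Ec P h) ^+ 2 <= complex.Re (Ec P (fun x => h x * (h x)^*)).
Proof.
move=> bh; set c := Ec P h.
have bhJ := bmJ bh; have bhh := bmM bh bhJ.
have E x : (h x - c) * (h x - c)^* = h x * (h x)^* + ((- c^*) * h x + ((- c) * (h x)^* + c * c^*)).
  by rewrite rmorphB; ring.
have : 0 <= complex.Re (Ec P (fun x => (h x - c) * (h x - c)^*)).
  by apply: ReEc_ge0 => x; rewrite -cabs_sqr sqr_ge0.
have b3 : bm (fun x => (- c) * (h x)^* + c * c^*).
  by apply: bmD; [apply: bmM => //; exact: bm_cst|exact: bm_cst].
have b2 : bm (fun x => (- c^*) * h x + ((- c) * (h x)^* + c * c^*)).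
  by apply: bmD => //; apply: bmM => //; exact: bm_cst.
rewrite (eq_Ec P E) EcD// EcD//; last by apply: bmM => //; exact: bm_cst.
rewrite EcD; [|by apply: bmM => //; exact: bm_cst|exact: bm_cst].
rewrite (EcZ P (- c^*) bh) (EcZ P (- c) bhJ) (EcJ P bh) Ec_cst -/c.
have -> : - c^* * c + (- c * c^* + c * c^*) = - (c * c^*) by ring.
have -> : complex.Re (Ec P (fun x => h x * (h x)^*) - c * c^*) =
    complex.Re (Ec P (fun x => h x * (h x)^*)) - cabs c ^+ 2.
  by rewrite complexReD cabs_mulJ.
by rewrite subr_ge0.
Qed.

(** For the last clause, f (x + y) - w f y is the expectation of (x - w) y, whose squared modulus is
    |x - w|^2; its expectation 2 - 2 Re (w^* f x) is 2 (1 - |f x|) by the choice of w. *)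
Lemma charfun_positive_type (X : topologicalZmodType) (mu : probability (borel X) R) :
  positive_type (charfun mu).
Proof.
have le1 y : cabs (charfun mu y) <= 1.
  rewrite -(ler_pXn2r (n := 2)) ?nnegrE ?cabs_ge0// expr1n charfunE.
  apply: le_trans (Ec_jensen mu (dual_bm y)) _.
  have E x : y x * (y x)^* = 1 by rewrite cabs_mulJ cabs_norm1 ?expr1n// dual_norm.
  by rewrite (eq_Ec mu E) Ec_cst.
split => // [|y|x y w w1 fx].
- by rewrite charfunE (_ : dual_fun 0 = fun=> 1)// Ec_cst.
- rewrite !charfunE -EcJ; last exact: dual_bm.
  by apply: eq_Ec => x; rewrite dualNE norm1_conjV// dual_norm.
have bx := dual_bm (R := R) x; have by' := dual_bm (R := R) y.
have bw : bm (fun z : borel X => x z - w) by apply: bmD => //; exact: bm_cst.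
have -> : charfun mu (x + y) - w * charfun mu y = Ec mu (fun z => (x z - w) * y z).
  rewrite !charfunE -mulNr -EcZ// -EcD; [|exact: dual_bm|by apply: bmM => //; exact: bm_cst].
  by apply: eq_Ec => z; rewrite dualDE mulrBl mulNr.
apply: le_trans (Ec_jensen mu (bmM bw by')) _.
have E z : (x z - w) * y z * ((x z - w) * y z)^* = 2 + ((- w^*) * x z + (- w) * (x z)^*).
  rewrite rmorphM mulrACA [y z * _]cabs_mulJ (cabs_norm1 (dual_norm y z)) expr1n mulr1 rmorphB.
  have ww : w * w^* = 1 by rewrite cabs_mulJ cabs_norm1 ?expr1n.
  have xx : x z * (x z)^* = 1 by rewrite cabs_mulJ cabs_norm1 ?expr1n// dual_norm.
  have -> : (x z - w) * ((x z)^* - w^*) =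
    x z * (x z)^* + w * w^* + (- w^* * x z + - w * (x z)^*) by ring.
  by rewrite ww xx.
rewrite (eq_Ec mu E).
have b1 : bm (fun z : borel X => - w^* * x z) by apply: bmM => //; exact: bm_cst.
have b2 : bm (fun z : borel X => - w * (x z)^*) by apply: bmM; [exact: bm_cst|exact: bmJ].
rewrite EcD; [|exact: bm_cst|exact: bmD].
rewrite (EcD mu b1 b2) (EcZ mu (- w^*) bx) (EcZ mu (- w) (bmJ bx)) (EcJ mu bx) Ec_cst -charfunE.
set r := cabs (charfun mu x) in fx *; rewrite fx conj_mul_real.
have ww : w * w^* = 1 by rewrite cabs_mulJ cabs_norm1 ?expr1n.
have -> : 2 + (- w^* * (w * r%:C%C) + - w * (w^* * r%:C%C)) = 2 * (1 - w * w^* * r%:C%C) by ring.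
by rewrite ww mul1r -(rmorph1 (real_complex R)) -rmorphB -(rmorph_nat (real_complex R) 2) -rmorphM.
Qed.
End PositiveType.

(** * Vanishing third differences yield a Gaussian exponential *)

Section QuadraticExponent.
Context {R : realType} {a : nat -> nat} {ha : forall n, (1 < a n)%N}.
Local Notation X := (solenoid R ha).
Local Notation Y := (dual R X).
Variables (S : set Y) (g : Y -> R[i]).
Hypothesis SS : zmod_subgroup S.
Hypothesis S2 : forall y, S y -> exists2 z, S z & y = z + z.
Hypothesis pg : positive_type g.
Hypothesis g_neq0 : forall y, S y -> g y != 0.
Hypothesis g3 : forall x l k, S x -> S l -> S k ->
  g (x + l + k) * g x * g l * g k = g (l + k) * g (x + l) * g (x + k).

Let SN x : S x -> S (- x). Proof. exact: zmod_subgroupN. Qed.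
Let SD x y : S x -> S y -> S (x + y). Proof. exact: zmod_subgroupD. Qed.

Let psi y : R := - ln (cabs (g y)).

Let G_gt0 y : S y -> 0 < cabs (g y). Proof. by move=> Sy; rewrite cabs_gt0 g_neq0. Qed.

Let GN y : cabs (g (- y)) = cabs (g y).
Proof. by case: pg => _ -> _ _; rewrite cabsJ. Qed.

(** [g3] at (- y, y, y) gives |g (2 y)| = |g y|^4, and then at (x - y, y, y) the parallelogram law
    in multiplicative form. *)
Let psi_parallelogram x y : S x -> S y -> psi (x + y) + psi (x - y) = 2 * (psi x + psi y).
Proof.
move=> Sx Sy.
have h1 : cabs (g (y + y)) = cabs (g y) ^+ 4.
  have := congr1 cabs (g3 (SN Sy) Sy Sy).
  rewrite !cabsM addNr add0r GN; case: pg => -> _ _ _; rewrite cabs1 => e.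
  by rewrite !mulr1 in e; rewrite -e; ring.
have h2 := congr1 cabs (g3 (SD Sx (SN Sy)) Sy Sy).
rewrite !cabsM subrK h1 in h2.
have Gy := G_gt0 Sy; have Gx := G_gt0 Sx.
have Gp := G_gt0 (SD Sx Sy); have Gm := G_gt0 (SD Sx (SN Sy)).
have e : cabs (g (x + y)) * cabs (g (x - y)) = cabs (g x) ^+ 2 * cabs (g y) ^+ 2.
  apply: (mulIf (x := cabs (g y) ^+ 2)); first by rewrite gt_eqF// exprn_gt0.
  transitivity (cabs (g (x + y)) * cabs (g (x - y)) * cabs (g y) * cabs (g y)); first by ring.
  by rewrite h2; ring.
have := congr1 (@ln R) e.
rewrite !lnM ?posrE ?exprn_gt0// /psi; lra.
Qed.

Let psi_scale y (n : int) : S y -> psi (y *~ n) = n%:~R ^+ 2 * psi y.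
Proof.
move=> Sy; have := @parallelogramMz R int (fun n => psi (y *~ n)).
move=> /(_ _ 1 n); rewrite intz mulr1z; apply=> u v.
by rewrite mulrzDr mulrzBr psi_parallelogram//; exact: zmod_subgroupMz.
Qed.

(** Any two nonzero characters have a common nonzero multiple, so that a function scaling
    quadratically is determined by one value. *)
Let modulus_gaussian : exists2 c, 0 <= c & forall y, S y -> cabs (g y) = expR (- (c * rate y ^+ 2)).
Proof.
have psi_ge0 y : S y -> 0 <= psi y.
  by move=> Sy; rewrite /psi oppr_ge0 ln_le0//; case: pg.
suff [c c0 H] : exists2 c, 0 <= c & forall y, S y -> psi y = c * rate y ^+ 2.
  by exists c => // y Sy; rewrite -H// /psi opprK lnK// posrE G_gt0.
have psi0 : psi 0 = 0 by rewrite /psi; case: pg => -> _ _ _; rewrite cabs1 ln1 oppr0.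
have [[z Sz z0]|S0] := pselect (exists2 z, S z & z != 0); last first.
  exists 0 => // y Sy; have [->|y0] := eqVneq y 0; first by rewrite psi0 mul0r.
  by case: S0; exists y.
have rz : rate z != 0 by rewrite rate_eq0.
exists (psi z / rate z ^+ 2) => [|y Sy]; first by rewrite divr_ge0 ?psi_ge0 ?sqr_ge0.
have [->|y0] := eqVneq y 0; first by rewrite psi0 rate0 expr0n mulr0.
have [k [m [k0 m0 km]]] := dual_commensurable y0 z0.
have k0R : k%:~R != 0 :> R by rewrite intr_eq0.
have h1 : k%:~R ^+ 2 * psi y = m%:~R ^+ 2 * psi z by rewrite -!psi_scale// km.
have h2 : rate y * k%:~R = rate z * m%:~R by rewrite !mulrzr -!rateMz km.
have -> : rate y = rate z * m%:~R / k%:~R by rewrite -h2 mulfK.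
apply: (mulfI (x := k%:~R ^+ 2)); first by rewrite expf_neq0.
by rewrite h1; field; rewrite k0R rz.
Qed.

Let w y := g y / (cabs (g y))%:C%C.

Let cabsC_neq0 y : S y -> (cabs (g y))%:C%C != 0 :> R[i].
Proof. by move=> Sy; rewrite cabsE normr_eq0 g_neq0. Qed.

Let w_norm y : S y -> `|w y| = 1. Proof. by move=> Sy; rewrite cabs_cV// g_neq0. Qed.

Let w_neq0 y : S y -> w y != 0.
Proof. by move=> Sy; rewrite -normr_eq0 w_norm// oner_eq0. Qed.

Let wN y : S y -> w (- y) = (w y)^-1.
Proof.
move=> Sy; rewrite norm1_conjV ?w_norm// /w GN conj_div_real.
by case: pg => _ -> _ _.
Qed.

Let w3 x l k : S x -> S l -> S k ->
  w (x + l + k) * w x * w l * w k = w (l + k) * w (x + l) * w (x + k).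
Proof.
move=> Sx Sl Sk; have e1 := g3 Sx Sl Sk.
have e2 := congr1 (fun z => (cabs z)%:C%C : R[i]) e1.
rewrite !cabsM !rmorphM in e2.
by rewrite /w !mulf_div e1 e2.
Qed.

(** The phase satisfies w (- y) = 1 / w y, which turns [w3] at (- l - k, l, k) into additivity up to
    sign. Writing l = z + z and applying [w3] at (z, z, k) leaves only squares, which removes the
    sign. *)
Let wD l k : S l -> S k -> w (l + k) = w l * w k.
Proof.
have sq l' k' : S l' -> S k' -> w (l' + k') ^+ 2 = (w l' * w k') ^+ 2.
  move=> Sl Sk; have := w3 (SN (SD Sl Sk)) Sl Sk.
  have -> : - (l' + k') + l' + k' = 0 by rewrite -addrA addNr.
  have -> : - (l' + k') + l' = - k' by rewrite opprD addrAC addNr add0r.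
  have -> : - (l' + k') + k' = - l' by rewrite opprD addrNK.
  rewrite !wN//; last exact: SD.
  have -> : w 0 = 1 by rewrite /w; case: pg => -> _ _ _; rewrite cabs1 divr1.
  move=> e; have n1 := w_neq0 Sl; have n2 := w_neq0 Sk; have n3 := w_neq0 (SD Sl Sk).
  transitivity (w (l' + k') * w l' * w k' * (w (l' + k') / w k' / w l')).
    by field; rewrite n1 n2.
  by rewrite -e; field.
move=> Sl Sk; have [z Sz ->] := S2 Sl.
have e := w3 Sz Sz Sk; have n1 := w_neq0 Sz; have n2 := w_neq0 Sk.
have e2 := sq _ _ Sz Sk.
have n3 : w z * w z * w k != 0 by rewrite mulf_neq0// mulf_neq0.
apply: (mulIf n3).
transitivity (w (z + z + k) * w z * w z * w k); first by ring.
rewrite e; transitivity (w (z + k) ^+ 2 * w (z + z)); first by ring.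
by rewrite e2; ring.
Qed.

(** [g3] says that log g has zero third differences. The modulus keeps the quadratic part and the
    phase the linear part, which [dual_extension] realizes as evaluation at a point. *)
Lemma quadratic_exponent : exists (x : X) (c : R), 0 <= c /\
  forall y, S y -> g y = y x * (expR (- (c * rate y ^+ 2)))%:C%C.
Proof.
have [c c0 H] := modulus_gaussian.
have [x xE] := dual_extension SS w_norm wD.
exists x, c; split => // y Sy.
by rewrite xE// /w -H// mulfVK// cabsC_neq0.
Qed.

End QuadraticExponent.

(* The difference along the three edges of a cube: each of Q, R, T is constant along
   one direction, so that it cancels. *)
Lemma third_difference (F : fieldType)
  (P000 P001 P010 P011 P100 P101 P110 P111 Q00 Q01 Q10 Q11 R00 R01 R10 R11 T00 T01 T10 T11 : F) :
  Q00 != 0 -> Q01 != 0 -> Q10 != 0 -> Q11 != 0 ->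
  P000 * Q00 = R00 * T00 -> P001 * Q01 = R00 * T01 ->
  P010 * Q10 = R01 * T00 -> P011 * Q11 = R01 * T01 ->
  P100 * Q00 = R10 * T10 -> P101 * Q01 = R10 * T11 ->
  P110 * Q10 = R11 * T10 -> P111 * Q11 = R11 * T11 ->
  P111 * P100 * P010 * P001 = P000 * P110 * P101 * P011.
Proof.
move=> q0 q1 q2 q3 e0 e1 e2 e3 e4 e5 e6 e7.
have q : Q11 * Q00 * Q10 * Q01 != 0 by rewrite !mulf_neq0.
apply: (mulIf q).
transitivity ((P111 * Q11) * (P100 * Q00) * (P010 * Q10) * (P001 * Q01)); first by ring.
transitivity ((P000 * Q00) * (P110 * Q10) * (P101 * Q01) * (P011 * Q11)); last by ring.
by rewrite e0 e1 e2 e3 e4 e5 e6 e7; ring.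
Qed.

(** G at j comes from F at about 2 j / 3, while F at n needs F at n - 1 and G at n + 1. From 8 on,
    the indices 2 k and 2 k + 1 used for G at any j <= n + 1 are at most n - 1, so that strong
    induction closes. *)
Lemma nonvanishing_growth (F G : nat -> bool) :
  (forall m, (m < 8)%N -> F m && G m) ->
  (forall k, F k.*2 -> G (3 * k)%N) ->
  (forall k, F (k.*2).+1 -> G (3 * k).+1) ->
  (forall k, F (k.*2).+1 -> G (3 * k).+2) ->
  (forall n, F n.+1 -> G n.+3 -> F n.+2) ->
  forall n, F n && G n.
Proof.
move=> base G0 G1 G2 Fs n; have [m] := ubnP n; elim: m n => // m IH n nm.
have [/base//|n8] := ltnP n 8.
have GN j : (j <= n.+1)%N -> G j.
  move=> jn; have [/base/andP[]//|j8] := ltnP j 8.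
  have := divn_eq j 3; have := ltn_pmod j (isT : 0 < 3)%N.
  move: (j %% 3)%N (j %/ 3)%N => e k e3 jE.
  have Fk i : (i <= n.-1)%N -> F i by move=> ?; case/andP: (IH i ltac:(lia)).
  case: e e3 jE => [|[|[|//]]] _ jE; rewrite jE; [rewrite addn0 mulnC; apply: G0|rewrite addn1 mulnC; apply: G1|rewrite addn2 mulnC; apply: G2]; apply: Fk; lia.
apply/andP; split; last exact: GN.
case: n n8 nm GN => [|[|n]]// n8 nm GN; apply: Fs; last exact: GN.
by case/andP: (IH n.+1 ltac:(lia)).
Qed.

Lemma rate_inj {R : realType} {a : nat -> nat} {ha : forall n, (1 < a n)%N} :
  injective (@rate R a ha).
Proof.
move=> y z yz; apply/eqP; rewrite -subr_eq0 -rate_eq0 rateD rateN yz subrr//.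
Qed.

Lemma cabs0 {R : realType} : cabs (0 : R[i]) = 0.
Proof. by apply/eqP; rewrite cabs_eq0. Qed.

Lemma cvg_shift1 {R : realType} (u : nat -> R) (l : R) :
  u n.+1 @[n --> \oo] --> l <-> u n @[n --> \oo] --> l.
Proof. by rewrite -(cvg_shiftS u). Qed.

(** * The functional equation for p = 1, q = -3 *)

Section Core.
Context {R : realType} {a : nat -> nat} {ha : forall n, (1 < a n)%N}.
Local Notation X := (solenoid R ha).
Local Notation Y := (dual R X).
Variables (f g : Y -> R[i]) (half : Y -> Y).
Hypothesis pf : positive_type f.
Hypothesis pg : positive_type g.
Hypothesis half2 : forall y, half y *+ 2 = y.
Hypothesis fg : forall u v, f (u + v) * g (u - v *+ 3) = f (u - v) * g (u + v *+ 3).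

Local Notation F y := (cabs (f y)).
Local Notation G y := (cabs (g y)).
Local Notation halfn n y := (iter n half y).

Let rate_half y : rate (half y) = rate y / 2.
Proof. by rewrite -[in RHS](half2 y) rateMn; field. Qed.

Let rate_halfn n y : rate (halfn n y) = rate y / 2 ^+ n.
Proof.
elim: n => [|n IH]; first by rewrite divr1.
by rewrite iterS rate_half IH exprS invfM mulrCA [RHS]mulrC.
Qed.

(** Identities involving halves are transported by the injective [rate] to the reals, where halving
    is division by 2. *)
Ltac rate_ring := apply: rate_inj;
  rewrite !(rateD, rateN, rateMn, rate0, rate_half, rate_halfn); by field.

(** The equation in the coordinates al = u + v and ga = u + 3 v; solving for u and v only divides by
    2. In [fg_pr] the coordinates are p = u + v and r = u - v. *)
Let fgE al ga : f al * g (al *+ 3 - ga *+ 2) = f (al *+ 2 - ga) * g ga.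
Proof.
have := fg (half (al *+ 3 - ga)) (half (ga - al)).
have -> : half (al *+ 3 - ga) + half (ga - al) = al by rate_ring.
have -> : half (al *+ 3 - ga) - half (ga - al) *+ 3 = al *+ 3 - ga *+ 2 by rate_ring.
have -> : half (al *+ 3 - ga) - half (ga - al) = al *+ 2 - ga by rate_ring.
by have -> : half (al *+ 3 - ga) + half (ga - al) *+ 3 = ga by rate_ring.
Qed.

Let fg_pr p q r t : q = r *+ 2 - p -> t = p *+ 2 - r -> f p * g q = f r * g t.
Proof.
move=> -> ->; have := fg (half (p + r)) (half (p - r)).
have -> : half (p + r) + half (p - r) = p by rate_ring.
have -> : half (p + r) - half (p - r) *+ 3 = r *+ 2 - p by rate_ring.
have -> : half (p + r) - half (p - r) = r by rate_ring.
by have -> : half (p + r) + half (p - r) *+ 3 = p *+ 2 - r by rate_ring.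
Qed.

Let f0 : f 0 = 1. Proof. by case: pf. Qed.
Let g0 : g 0 = 1. Proof. by case: pg. Qed.

Let f2E y : f y = f (half y) * g (half y *+ 3).
Proof.
have := fgE (half y) 0; rewrite g0 mulr1 mul0rn !subr0 half2 => <-//.
Qed.

Let g2E y : g y = f (half y) * g (- half y).
Proof.
have := fgE 0 (- half y); rewrite f0 mul1r !mul0rn !add0r mulNrn !opprK half2 => <-//.
Qed.

Let gN_neq0 y : (g (- y) != 0) = (g y != 0).
Proof. by rewrite -!cabs_gt0; case: pg => _ -> _ _; rewrite cabsJ. Qed.

Let gN y : G (- y) = G y.
Proof. by case: pg => _ -> _ _; rewrite cabsJ. Qed.

Let halfn0 n : halfn n 0 = 0.
Proof. by rate_ring. Qed.

Let halfnB n x y : halfn n (x - y) = halfn n x - halfn n y.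
Proof. by rate_ring. Qed.

Let halfnMn n x k : halfn n (x *+ k) = halfn n x *+ k.
Proof. by rate_ring. Qed.

Let halfnK n x : halfn n x *+ (2 ^ n) = x.
Proof.
apply: rate_inj; rewrite rateMn rate_halfn -[_ *+ _]mulr_natr natrX mulfVK//.
Qed.

Let halfMn x k : half (x *+ k) = half x *+ k.
Proof. by rate_ring. Qed.

(** Krein's inequality with w the phase of h x: where |h x| is close to 1, translation by x is
    nearly multiplication by w. *)
Lemma positive_type_near (h : Y -> R[i]) x : positive_type h ->
  exists2 w : R[i], `|w| = 1 &
    forall y, cabs (h (x + y) - w * h y) <= Num.sqrt (2 * (1 - cabs (h x))).
Proof.
move=> [h0 hN h1 hK].
have [w w1 wE] : exists2 w : R[i], `|w| = 1 & h x = w * (cabs (h x))%:C%C.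
  have [hx|hx] := eqVneq (h x) 0.
    exists 1; first exact: normr1.
    by rewrite hx cabs0 mulr0.
  exists (h x / (cabs (h x))%:C%C); first exact: cabs_cV.
  by rewrite divfK// cabsE normr_eq0.
exists w => // y; rewrite -[leLHS]ger0_norm ?cabs_ge0// -sqrtr_sqr.
by rewrite ler_wsqrtr// hK.
Qed.

Lemma positive_type_lower (h : Y -> R[i]) x y : positive_type h ->
  cabs (h y) - Num.sqrt (2 * (1 - cabs (h x))) <= cabs (h (x + y)).
Proof.
move=> ph; have [w w1 wy] := positive_type_near x ph.
have : cabs (w * h y) <= cabs (h (x + y)) + cabs (h (x + y) - w * h y).
  rewrite -{1}(subKr (h (x + y)) (w * h y)).
  by apply: le_trans (cabsD _ _) _; rewrite cabsN.
rewrite cabsM (cabs_norm1 w1) mul1r; have := wy y; lra.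
Qed.

Definition lim1 (h : Y -> R[i]) y := cabs (h (halfn n y)) @[n --> \oo] --> (1 : R).

Lemma lim1_sqrt (h : Y -> R[i]) y : lim1 h y ->
  Num.sqrt (2 * (1 - cabs (h (halfn n y)))) @[n --> \oo] --> (0 : R).
Proof.
move=> hy; have h1 : 2 * (1 - cabs (h (halfn n y))) @[n --> \oo] --> (2 * (1 - 1) : R).
  by apply: cvgM; [exact: cvg_cst|apply: cvgB => //; exact: cvg_cst].
rewrite -(sqrtr0 R) -(mulr0 2) -(subrr 1).
exact: (continuous_cvg _ (@sqrt_continuous R _) h1).
Qed.

(** Krein's inequality bounds |h| at (x - y) / 2^n below by |h (y / 2^n)| minus a term that vanishes
    with 1 - |h (x / 2^n)|. *)
Lemma lim1_subgroup (h : Y -> R[i]) : positive_type h -> zmod_subgroup (lim1 h).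
Proof.
move=> ph; split=> [|x y hx hy].
  rewrite /lim1; under eq_fun do rewrite halfn0.
  by case: ph => -> _ _ _; rewrite cabs1; exact: cvg_cst.
apply: (squeeze_cvgr (f := fun n => cabs (h (halfn n y)) - Num.sqrt (2 * (1 - cabs (h (halfn n x))))) (h := fun=> 1)); last exact: cvg_cst.
- apply: nearW => n; rewrite halfnB; apply/andP; split; last by case: ph.
  apply: le_trans (positive_type_lower (halfn n x) (- halfn n y) ph).
  by case: ph => _ -> _ _; rewrite cabsJ.
- by rewrite -[X in _ --> X]subr0; apply: cvgB => //; exact: lim1_sqrt.
Qed.

Lemma lim1_half (h : Y -> R[i]) y : lim1 h y -> lim1 h (half y).
Proof.
rewrite /lim1 => hy; under eq_fun do rewrite -iterSr.
by apply/(cvg_shift1 (fun n => cabs (h (halfn n y)))).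
Qed.

Lemma lim1_near (h : Y -> R[i]) y : lim1 h y -> \forall n \near \oo, h (halfn n y) != 0.
Proof.
move=> /cvgrPdist_lt /(_ 1 ltr01); apply: filterS => n.
by apply: contraTneq => ->; rewrite cabs0 subr0 normr1 ltxx.
Qed.

Lemma lim1_ex (h : Y -> R[i]) y : lim1 h y -> exists n, h (halfn n y) != 0.
Proof. by move=> /lim1_near [n _ H]; exists n; exact: (H n (leqnn n)). Qed.

(** s increases to a positive limit, so that the quotients t n of consecutive terms tend to 1. *)
Lemma factors_cvg1 (s t : nat -> R) : (forall n, s n = t n * s n.+1) ->
  (forall n, t n <= 1) -> (forall n, 0 <= s n <= 1) -> 0 < s 0%N -> t n @[n --> \oo] --> (1 : R).
Proof.
move=> st t1 s01 s0.
have nd : nondecreasing_seq s.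
  apply/nondecreasing_seqP => n; rewrite st -[leRHS]mul1r ler_wpM2r//.
  by case/andP: (s01 n.+1).
have ub : has_ubound (range s) by exists 1 => _ [n _ <-]; case/andP: (s01 n).
have cs := nondecreasing_cvgn nd ub; set l := sup _ in cs.
have spos n : 0 < s n by apply: lt_le_trans s0 _; exact: nd.
have l0 : 0 < l by apply: lt_le_trans s0 _; apply: ub_le_sup => //; exists 0%N.
have -> : t = (fun n => s n / s n.+1).
  by apply/funext => n; rewrite st mulfK// gt_eqF.
have <- : l / l = 1 by rewrite divff// gt_eqF.
apply: cvgM => //; apply: cvgV; first by rewrite gt_eqF.
by apply/cvg_shift1.
Qed.

Let f_le1 y : F y <= 1. Proof. by case: pf. Qed.
Let g_le1 y : G y <= 1. Proof. by case: pg. Qed.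

Let lim1_f y : g y != 0 -> lim1 f y.
Proof.
rewrite -cabs_gt0 => gy; apply/cvg_shift1.
apply: (@factors_cvg1 (fun n => G (halfn n y))) => [n|n|n|] //.
- by rewrite g2E cabsM gN.
- by rewrite cabs_ge0 g_le1.
Qed.

Let lim1_g y : f y != 0 -> lim1 g (y *+ 3).
Proof.
rewrite -cabs_gt0 => fy; apply/cvg_shift1.
apply: (@factors_cvg1 (fun n => F (halfn n y))) => [n|n|n|] //.
- by rewrite f2E cabsM mulrC; congr (_ * _); rewrite halfnMn.
- by rewrite cabs_ge0 f_le1.
Qed.

Let subgroup_halfn S n y : zmod_subgroup S -> S (halfn n y) -> S y.
Proof. by move=> SS Sy; rewrite -(halfnK n y); exact: zmod_subgroupMn. Qed.

Let C y := lim1 f y /\ lim1 g y.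

Let CS : zmod_subgroup C.
Proof.
have [f1 f2] := lim1_subgroup pf; have [g1 g2] := lim1_subgroup pg.
by split=> // x y [? ?] [? ?]; split; [exact: f2|exact: g2].
Qed.

Let C_half y : C y -> C (half y).
Proof. by move=> [? ?]; split; exact: lim1_half. Qed.

Let C_halfn n y : C y -> C (halfn n y).
Proof. by move=> Cy; elim: n => //= n; exact: C_half. Qed.

(** [lim1_g] settles g at 3 y. Hence g is nonzero at some 3 y / 2^n, where [lim1_f] applies, and
    multiplication by 2^n returns to 3 y. *)
Let C_f y : f y != 0 -> C (y *+ 3).
Proof.
move=> /lim1_g gy; split=> //; have [n] := lim1_ex gy.
by move=> /lim1_f; apply: subgroup_halfn; exact: lim1_subgroup.
Qed.

Let C_g y : g y != 0 -> C (y *+ 3).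
Proof.
move=> /lim1_f/lim1_ex[n] /C_f; rewrite -halfnMn.
exact: subgroup_halfn.
Qed.

Let C_neq0 y : C y -> f y != 0 /\ g y != 0.
Proof.
move=> Cy.
have [N HN] : exists N, forall m, (m < 8)%N ->
    (f (halfn N y *+ m) != 0) && (g (halfn N y *+ m) != 0).
  suff [N _ HN] : \forall n \near \oo, forall m, (m < 8)%N ->
    (f (halfn n y *+ m) != 0) && (g (halfn n y *+ m) != 0) by exists N; exact: (HN N (leqnn N)).
  move: 8%N => M; elim: M => [|M IH]; first by apply: nearW => n m.
  have [Fm Gm] : C (y *+ M) by exact: zmod_subgroupMn.
  near=> n => m; rewrite ltnS leq_eqVlt => /orP[/eqP ->|].
    rewrite -halfnMn; apply/andP; split; near: n; exact: lim1_near.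
  by move: m; near: n.
set x := halfn N y in HN.
rewrite -(halfnK N y) -/x; apply/andP.
(* A nonzero right side of [fgE] forces g on the left to be nonzero. In units of x, the pairs (k,
   0), (k + 1, 1) and (k, -1) for (al, ga) give the first three growth rules; the last one reads the
   equation in the other direction at (n + 1, n). *)
have fgx al ga p q : f p != 0 -> g ga != 0 -> p = al *+ 2 - ga -> q = al *+ 3 - ga *+ 2 -> g q != 0.
  move=> fp gga pE qE; have : f al * g q != 0 by rewrite qE fgE -pE mulf_neq0.
  by rewrite mulf_eq0 negb_or => /andP[].
have gx : g x != 0 by have /andP[] := HN 1%N isT.
apply: (@nonvanishing_growth (fun m => f (x *+ m) != 0) (fun m => g (x *+ m) != 0) HN).
- move=> k fk; apply: (fgx (x *+ k) 0 _ _ fk); first by rewrite g0 oner_neq0.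
    by rewrite subr0 -mulrnA muln2.
  by rewrite mul0rn subr0 -mulrnA mulnC.
- move=> k fk; apply: (fgx (x *+ k.+1) x _ _ fk gx); rewrite -?mul2n; rate_ring.
- move=> k fk; apply: (fgx (x *+ k) (- x) _ _ fk); first by rewrite gN_neq0.
    by rewrite -mul2n; rate_ring.
  by rate_ring.
- move=> n fn gn; have : f (x *+ n.+1) * g (x *+ n.+3) != 0 by rewrite mulf_neq0.
  have -> : x *+ n.+3 = x *+ n.+1 *+ 3 - x *+ n *+ 2 by rate_ring.
  rewrite fgE mulf_eq0 negb_or => /andP[+ _].
  by have -> : x *+ n.+2 = x *+ n.+1 *+ 2 - x *+ n by rate_ring.
Unshelve. all: by end_near. Qed.


Let f3 S : zmod_subgroup S -> (forall y, S y -> S (half y)) ->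
  (forall y, S y -> f y != 0 /\ g y != 0) -> forall x l k, S x -> S l -> S k ->
  f (x + l + k) * f x * f l * f k = f (l + k) * f (x + l) * f (x + k).
Proof.
move=> SS Sh S0 x l k Sx Sl Sk.
have gS y : S y -> g y != 0 by case/S0.
have SD u v : S u -> S v -> S (u + v) by exact: zmod_subgroupD.
have SN u : S u -> S (- u) by exact: zmod_subgroupN.
have SM u n : S u -> S (u *+ n) by exact: zmod_subgroupMn.
(* The vertex is p = k + l + x, and r = k / 2 + 2 l. Then 2 r - p = 3 l - x is free of k, r is free
   of x, and 2 p - r = 3 k / 2 + 2 x is free of l. *)
have := @third_difference R[i] (f 0) (f x) (f l) (f (l + x)) (f k) (f (k + x)) (f (l + k)) (f (x + l + k))
  (g 0) (g (- x)) (g (l *+ 3)) (g (l *+ 3 - x))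
  (f 0) (f (l *+ 2)) (f (half k)) (f (half k + l *+ 2))
  (g 0) (g (x *+ 2)) (g (half k *+ 3)) (g (half k *+ 3 + x *+ 2)).
rewrite f0 => H.
transitivity (f (x + l + k) * f k * f l * f x); first by ring.
rewrite H; first by rewrite [k + x]addrC [l + x]addrC; ring.
all: try (by rewrite g0 oner_neq0); try (by apply: gS; auto 6); rewrite -1?f0; apply: fg_pr; rate_ring.
Qed.

(** With g at the vertex q = 2 r - p, a step absent from 2 p - r contributes one third of itself to
    p and two thirds to r. Hence the step 6 m, entering p as 2 m and r as 4 m; L and K need only
    halving. *)
Let g3_base s m L K : C s -> C m -> C L -> C K ->
  g (s + m *+ 6 + L + K) * g (s + m *+ 6) * g (s + L) * g (s + K) =
  g (s + m *+ 6 + L) * g (s + m *+ 6 + K) * g (s + L + K) * g s.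
Proof.
move=> Cs Cm CL CK.
have fC y : C y -> f y != 0 by case/C_neq0.
have CD u v : C u -> C v -> C (u + v) by exact: zmod_subgroupD.
have CN u : C u -> C (- u) by exact: zmod_subgroupN.
have CM u n : C u -> C (u *+ n) by exact: zmod_subgroupMn.
have := @third_difference R[i] (g s) (g (s + m *+ 6)) (g (s + L)) (g (s + m *+ 6 + L))
  (g (s + K)) (g (s + m *+ 6 + K)) (g (s + L + K)) (g (s + m *+ 6 + L + K))
  (f s) (f (s + m *+ 2)) (f (s - L)) (f (s - L + m *+ 2))
  (g s) (g (s - L *+ 2)) (g (s - half K)) (g (s - half K - L *+ 2))
  (f s) (f (s + m *+ 4)) (f (s + half K)) (f (s + half K + m *+ 4)).
move=> H.
transitivity (g (s + m *+ 6 + L + K) * g (s + K) * g (s + L) * g (s + m *+ 6)); first by ring.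
rewrite H; first by ring.
all: try (by apply: fC; auto 6).
all: rewrite [LHS]mulrC [RHS]mulrC; apply: fg_pr; rate_ring.
Qed.

(** With s = x / 4^n, [g3_base] applies to x = s + 6 m and gives the wanted identity with g
    translated by s in half of the factors. By Krein's inequality each translation is multiplication
    by w up to [del]; both sides acquire the factor w^2 and the error 4 [del] tends to 0. *)
Let g3 x l k : C x -> C l -> C k ->
  g (x + l + k) * g x * g l * g k = g (l + k) * g (x + l) * g (x + k).
Proof.
move=> Cx Cl Ck; apply/eqP; rewrite -subr_eq0 -cabs_eq0 eq_le cabs_ge0 andbT.
set D := _ - _; pose del n := Num.sqrt (2 * (1 - G (halfn n x))).
have bound n : cabs D <= 4 * del n.*2.
  set s := halfn n.*2 x; have Cs : C s by exact: C_halfn.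
  (* 4^n = 3 t + 1 gives x = 4^n s = s + 3 t s, and halving t s gives m. *)
  have [t tE] : exists t, (4 ^ n = 3 * t + 1)%N.
    elim: n {s Cs} => [|n [t IH]]; first by exists 0%N.
    by exists (4 * t + 1)%N; rewrite expnS IH; lia.
  pose m := half (s *+ t).
  have xE : x = s + m *+ 6.
    have -> : m *+ 6 = s *+ (3 * t).
      by rewrite mulnC mulrnA /m (_ : 6 = 2 * 3)%N// mulrnA half2.
    by rewrite -mulrS -addn1 -tE (_ : 4 = 2 ^ 2)%N// -expnM mul2n /s halfnK.
  have Cm : C m by apply: C_half; exact: zmod_subgroupMn.
  have := g3_base Cs Cm Cl Ck; rewrite -xE => e.
  have [w w1 wE] := positive_type_near s pg; rewrite -/(del n.*2) in wE.
  set d := del n.*2 in wE *.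
  have -> : cabs D = cabs (w * w * D) by rewrite !cabsM (cabs_norm1 w1) !mul1r.
  have -> : w * w * D = g (x + l + k) * g x * ((w * g l) * (w * g k) - g (s + l) * g (s + k))
     - g (x + l) * g (x + k) * ((w * g (l + k)) * w - g (s + (l + k)) * g s).
    rewrite [s + (l + k)]addrA /D; set A := g (x + l + k) * g x * (g (s + l) * g (s + k)).
    have eA : A = g (x + l) * g (x + k) * (g (s + l + k) * g s) by rewrite mulrA -e /A mulrA.
    transitivity (g (x + l + k) * g x * ((w * g l) * (w * g k)) - A
      - (g (x + l) * g (x + k) * ((w * g (l + k)) * w) - A)); first by ring.
    by rewrite {2}eA /A; ring.
  have near_diff u v : cabs (w * g u * (w * g v) - g (s + u) * g (s + v)) <= d + d.
    apply: le_trans (cabsM_diff_le _ _ _ _) _ => //.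
      by rewrite cabsM (cabs_norm1 w1) mul1r.
    by rewrite lerD// -cabsN opprB.
  have le1M u v z : cabs (g u * g v * z) <= cabs z.
    rewrite !cabsM -[leRHS]mul1r ler_wpM2r ?cabs_ge0// -[leRHS]mulr1 ler_pM ?cabs_ge0//.
  apply: le_trans (cabsD _ _) _; rewrite cabsN.
  have h1 := le_trans (le1M (x + l + k) x _) (near_diff l k).
  have h2 := le_trans (le1M (x + l) (x + k) _) (near_diff (l + k) 0).
  rewrite g0 mulr1 addr0 in h2.
  apply: le_trans (lerD h1 h2) _; lra.
have dl : del n @[n --> \oo] --> (0 : R) by apply: lim1_sqrt; case: Cx.
apply/ler_addgt0Pr => e e0; rewrite add0r.
have /cvgrPdist_lt /(_ (e / 4)) := dl; rewrite divr_gt0// => /(_ isT)[N _ HN].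
have := HN N.*2; rewrite sub0r normrN ger0_norm ?sqrtr_ge0// => /(_ _) h.
by apply: le_trans (bound N) _; have := h (leq_trans (leq_addr N N) (eq_leq (addnn N))); lra.
Qed.

Let gaussian_on (h : Y -> R[i]) (S : set Y) := exists (x : X) (c : R),
  0 <= c /\ forall y, h y = y x * (expR (- (c * rate y ^+ 2)))%:C%C * (`[< S y >])%:R.

Let gaussian_support h S : (forall y, S y -> S (half y)) -> zmod_subgroup S -> positive_type h ->
  (forall y, S y <-> h y != 0) ->
  (forall x l k, S x -> S l -> S k ->
    h (x + l + k) * h x * h l * h k = h (l + k) * h (x + l) * h (x + k)) -> gaussian_on h S.
Proof.
move=> Sh SS ph S0 h3.
have [y Sy|y /S0 //|x [c [c0 H]]] := quadratic_exponent SS _ ph _ h3.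
  by exists (half y); [exact: Sh|rewrite -mulr2n half2].
exists x, c; split=> // y; case: asboolP => [/H ->|nS]; first by rewrite mulr1.
by rewrite mulr0; apply/eqP; apply: contra_notT nS => /S0.
Qed.

Let gaussian_g : (forall y, g y != 0 -> C y) -> gaussian_on g C.
Proof.
move=> gC; apply: (gaussian_support C_half CS pg _ g3).
by move=> y; split; [case/C_neq0|exact: gC].
Qed.

(** In f y = f (y / 2) g (3 y / 2) the last factor is nonzero, since 3 y / 2 lies in C. *)
Let f_descent n y : C (y *+ 3) -> f (halfn n y) != 0 -> f y != 0.
Proof.
elim: n y => // n IH y Cy; rewrite iterSr => fh.
have Ch : C (half y *+ 3) by rewrite -halfMn; exact: C_half.
by rewrite f2E mulf_neq0//; [exact: IH|case: (C_neq0 Ch)].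
Qed.

Let f_third y : lim1 f y -> C (y *+ 3) -> f y != 0.
Proof. by move=> /lim1_ex[n fn] Cy; exact: (f_descent Cy fn). Qed.

Let C3 y := C (y *+ 3).

Let C3S : zmod_subgroup C3.
Proof.
rewrite /C3; split=> [|x y Cx Cy]; first by rewrite mul0rn; case: CS.
by rewrite mulrnBl; case: CS => _; apply.
Qed.

Let C3_half y : C3 y -> C3 (half y).
Proof. by rewrite /C3 -halfMn; exact: C_half. Qed.

(** In the cyclic group of a common level, C consists of the multiples of some e, and C3 of the k
    with e dividing 3 k. As b is in C3 but not in C, 3 divides e, and C3 is the group of multiples
    of e / 3, with cosets represented by 0, b and - b. *)
Let C3_cosets b y : C3 b -> ~ C b -> C3 y -> [\/ C y, C (y - b) | C (y + b)].
Proof.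
move=> Cb nCb Cy.
have [n [k [m [yE bE]]]] := dual_common_level y b.
set z := level_char n in yE bE.
have [e [Ce eP]] := zmod_subgroup_cyclic z CS.
have /eP[k1 k1E] : C (z *~ (k * 3)) by rewrite mulrzA -yE.
have /eP[m1 m1E] : C (z *~ (m * 3)) by rewrite mulrzA -bE.
have CeM j : C (z *~ (e%:Z * j)) by rewrite mulrzA; exact: zmod_subgroupMz.
have ne j : m <> e%:Z * j by move=> mj; apply: nCb; rewrite bE mj; exact: CeM.
have div3 (i : int) : exists q r, i = 3 * q + r /\ (r = 0 \/ r = 1 \/ r = 2).
  exists (i %/ 3)%Z, (i %% 3)%Z; split; first by rewrite mulrC -divz_eq.
  have := modz_ge0 i (isT : (3 : int) != 0); have := @ltz_pmod i 3 isT; lia.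
have [e' [re [eE reE]]] := div3 e%:Z.
have [m' [rm [mE rmE]]] := div3 m1.
have [k' [rk [kE rkE]]] := div3 k1.
(* 3 m = e m1: if 3 did not divide e it would divide m1, and b would lie in C. *)
have re0 : re = 0.
  case: reE => // reE; exfalso; apply: (ne m').
  by case: reE => reE; move: rmE => [|[|]] rmE; subst; lia.
have rm0 : rm <> 0 by move=> rm0; apply: (ne m'); subst; lia.
have yb j : y = z *~ (e%:Z * j) -> C y by move=> ->.
have em : m = e' * m1 by subst; lia.
have ek : k = e' * k1 by subst; lia.
case: rkE => [rk0|rkE]; first by apply: Or31; rewrite yE ek (_ : e' * k1 = e%:Z * k'); [exact: CeM|subst; lia].
have [rkm|rkm] : rk = rm \/ rk + rm = 3 by lia.
  apply: Or32; rewrite yE bE -mulrzBr ek em (_ : _ - _ = e%:Z * (k' - m')); first exact: CeM.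
  by subst; lia.
apply: Or33; rewrite yE bE -mulrzDr ek em (_ : _ + _ = e%:Z * (k' + m' + 1)); first exact: CeM.
by subst; lia.
Qed.

(** |f| tends to 1 along halvings of b and of elements of C, hence on all of C3 by the coset
    description; so f does not vanish on C3. Nonvanishing of g there follows from that at b, and
    [f3] applies on C3. *)
Let gaussian_f b : g b != 0 -> ~ C b -> gaussian_on f C3.
Proof.
move=> gb nCb; have C3b : C3 b by exact: C_g.
have fb := lim1_f gb; have fS := lim1_subgroup pf.
have CC y : C y -> lim1 f y by case.
have C3lim y : C3 y -> lim1 f y.
  move=> Cy; have [/CC//|/CC h|/CC h] := C3_cosets C3b nCb Cy.
    by rewrite -(subrK b y); exact: (zmod_subgroupD fS h fb).
  by rewrite -(addrK b y); exact: (fS.2 _ _ h fb).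
have f_neq0 y : C3 y -> f y != 0 by move=> Cy; apply: f_third => //; exact: C3lim.
have C3_halfn n y : C3 y -> C3 (halfn n y) by move=> Cy; elim: n => //= n; exact: C3_half.
have g_descent n y : C3 y -> g (halfn n y) != 0 -> g y != 0.
  elim: n y => // n IH y Cy; rewrite iterSr => gh; rewrite g2E mulf_neq0//.
    by apply: f_neq0; exact: C3_half.
  by rewrite gN_neq0; apply: IH => //; exact: C3_half.
have g_mono n : G b <= G (halfn n b).
  elim: n => //= n /le_trans; apply.
  by rewrite [in leLHS]g2E cabsM gN -[leRHS]mul1r ler_wpM2r ?cabs_ge0.
have gcb c : C c -> g (c + b) != 0.
  (* For large N, g is nearly 1 in modulus at c / 2^N, so Krein's inequality compares g at (c + b) /
     2^N with g at b / 2^N, whose modulus is at least |g b|; [g_descent] then climbs back. *)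
  move=> [cf cg]; have G0 : 0 < G b by rewrite cabs_gt0.
  have /cvgrPdist_lt /(_ _ G0)[N _ /(_ N (leqnn N))] := lim1_sqrt cg.
  rewrite sub0r normrN ger0_norm ?sqrtr_ge0// => hN.
  apply: (g_descent N); first by apply: zmod_subgroupD => //; exact: zmod_subgroupMn.
  rewrite -cabs_gt0; have -> : halfn N (c + b) = halfn N c + halfn N b by rate_ring.
  have := positive_type_lower (halfn N c) (halfn N b) pg; have := g_mono N; lra.
have g_neq0 y : C3 y -> g y != 0.
  move=> Cy; have [/C_neq0[]//|h|h] := C3_cosets C3b nCb Cy.
    by rewrite -(subrK b y); exact: gcb.
  by rewrite -gN_neq0 (_ : - y = - (y + b) + b); [apply: gcb; exact: zmod_subgroupN|rewrite opprD addrNK].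
apply: (gaussian_support C3_half C3S pf).
  by move=> y; split; [exact: f_neq0|exact: C_f].
by apply: f3 => // y Cy; split; [exact: f_neq0|exact: g_neq0].
Qed.

Lemma gaussian_factor :
  (exists (S : set Y) (x : X) (c : R), [/\ zmod_subgroup S, 0 <= c &
     forall y, f y = y x * (expR (- (c * rate y ^+ 2)))%:C%C * (`[< S y >])%:R]) \/
  (exists (S : set Y) (x : X) (c : R), [/\ zmod_subgroup S, 0 <= c &
     forall y, g y = y x * (expR (- (c * rate y ^+ 2)))%:C%C * (`[< S y >])%:R]).
Proof.
have [[b gb nCb]|gC] := pselect (exists2 b, g b != 0 & ~ C b).
  have [x [c [c0 H]]] := gaussian_f gb nCb.
  by left; exists C3, x, c; split => //; exact: C3S.
have [y gy|x [c [c0 H]]] := gaussian_g.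
  by apply: contra_notP gC => nCy; exists y.
by right; exists C, x, c; split => //; exact: CS.
Qed.

End Core.

Lemma gaussian_idempotent_pair {R : realType} {a : nat -> nat} {ha : forall n, (1 < a n)%N}
    (mu1 mu2 : probability (borel (solenoid R ha)) R) :
  (forall y : dual R (solenoid R ha), exists z, z *+ 2 = y) ->
  (forall u v, charfun mu1 (u + v) * charfun mu2 (u - v *+ 3) =
               charfun mu1 (u - v) * charfun mu2 (u + v *+ 3)) ->
  gaussian_idempotent mu1 \/ gaussian_idempotent mu2.
Proof.
move=> div2 fg; have /choice[half half2] := div2.
have [|] := gaussian_factor (charfun_positive_type mu1) (charfun_positive_type mu2) half2 fg.
  by move=> [S [x [c [SS c0 H]]]]; left; exact: gaussian_idempotent_charfun SS c0 H.
by move=> [S [x [c [SS c0 H]]]]; right; exact: gaussian_idempotent_charfun SS c0 H.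
Qed.

Theorem theorem1 (R : realType) (a : nat -> nat) (ha : forall n, (1 < a n)%N)
  (p q : int) (pq_coprime : coprimez p q) (pq_neq0 : p * q != 0)
  (aut_p : topological_automorphism (fun x : solenoid R ha => x *~ p))
  (aut_q : topological_automorphism (fun x : solenoid R ha => x *~ q))
  (aut_pDq : topological_automorphism (fun x : solenoid R ha => x *~ (p + q)))
  (aut_pBq : topological_automorphism (fun x : solenoid R ha => x *~ (p - q))) :
  (p * q = - 3 ->
   forall (d : measure_display) (Omega : measurableType d)
     (P : probability Omega R) (xi1 xi2 : {RV P >-> borel (solenoid R ha)}),
     independent_RV P xi1 xi2 ->
     cond_symmetric P
       (fun w => (xi1 w : solenoid R ha) + (xi2 w : solenoid R ha))
       (fun w => (xi1 w : solenoid R ha) *~ p + (xi2 w : solenoid R ha) *~ q) ->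
     gaussian_idempotent (distribution P xi1) \/
     gaussian_idempotent (distribution P xi2)) /\
  (p * q <> - 3 ->
   exists (d : measure_display) (Omega : measurableType d)
     (P : probability Omega R) (xi1 xi2 : {RV P >-> borel (solenoid R ha)}),
     [/\ independent_RV P xi1 xi2,
         cond_symmetric P
           (fun w => (xi1 w : solenoid R ha) + (xi2 w : solenoid R ha))
           (fun w => (xi1 w : solenoid R ha) *~ p + (xi2 w : solenoid R ha) *~ q),
         ~ gaussian_idempotent (distribution P xi1) &
         ~ gaussian_idempotent (distribution P xi2)]).
Proof.
split=> [pq3 d Omega P xi1 xi2 ind /(cond_symmetric_charfun _ _ ind) sym|pq3].
  have p3 : (`|p| <= 3)%N.
    by apply: dvdn_leq => //; apply/dvdnP; exists `|q|%N; rewrite mulnC -abszM pq3.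
  have pqE : (p = 1 /\ q = -3) \/ (p = -1 /\ q = 3) \/
      (p = 3 /\ q = -1) \/ (p = -3 /\ q = 1).
    have p0 : p != 0 by apply: contra_neq pq_neq0 => ->; rewrite mul0r.
    have : p = 1 \/ p = -1 \/ p = 2 \/ p = -2 \/ p = 3 \/ p = -3 by lia.
    by case=> [|[|[|[|[|]]]]] pE; move: pq3; rewrite pE; lia.
  have div2 (y : dual R (solenoid R ha)) : exists z, z *+ 2 = y.
    have [z zy] := automorphism_dual_div aut_pDq y.
    (* The sum of 1 and -3, up to sign: the automorphism attached to p + q is what makes the dual
       divisible by 2. *)
    have [e|e] : p + q = 2 \/ p + q = -2 by lia.
      by exists z; rewrite -zy e.
    by exists (- z); rewrite -zy e mulrNz mulNrn.
  (* The four cases become p = 1, q = -3 by changing the sign of v and exchanging the two laws. *)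
  case: pqE => [[pE qE]|[[pE qE]|[[pE qE]|[pE qE]]]]; rewrite {}pE {}qE in sym.
  - apply: gaussian_idempotent_pair => // u v; have := sym u v.
    by rewrite !mulrNz !opprK.
  - apply: gaussian_idempotent_pair => // u v; have := sym u (- v).
    by rewrite !mulrNz !mulNrz !opprK.
  - apply/or_comm; apply: gaussian_idempotent_pair => // u v; have := sym u (- v).
    by rewrite !mulrNz !mulNrz !opprK mulrC [RHS]mulrC.
  - apply/or_comm; apply: gaussian_idempotent_pair => // u v; have := sym u v.
    by rewrite !mulrNz !opprK mulrC [RHS]mulrC.
have [mu1 [mu2 [n1 n2 H]]] := @non_gaussian_pair R a ha p q pq_coprime pq_neq0 (introN eqP pq3)
  (automorphism_neq0 aut_pDq) (automorphism_neq0 aut_pBq).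
have [P [xi1 [xi2 [ind E1 E2]]]] := independent_realization mu1 mu2.
(* The laws of the realized variables agree with [mu1] and [mu2] on measurable sets only, so
   membership has to be transferred. *)
have GE (mu nu : probability (borel (solenoid R ha)) R) :
    (forall E, measurable E -> mu E = nu E) -> gaussian_idempotent mu -> gaussian_idempotent nu.
  by move=> e [g [w [gg ww ee]]]; exists g, w; split=> // E mE; rewrite -e// ee.
exists _, _, P, xi1, xi2; split=> //.
- apply/(cond_symmetric_charfun _ _ ind) => u v.
  by rewrite !(eq_charfun _ E1) !(eq_charfun _ E2).
- by move/(GE _ _ E1).
- by move/(GE _ _ E2).
Qed.
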